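(* Let $d\ge1$, let $Q:\mathbb{R}^d\to[0,\infty)$ be continuous with $Q(x) = \gamma |x|^{\alpha} + O(|x|^{\alpha-\varepsilon})$ as $|x|\to\infty$ for some positive constants $\alpha,\gamma,\varepsilon$, and let $\mu^Q$ be its equilibrium measure. For $n>k$ define \[ R_{k,n}(y_1,\dots,y_k) = D_n \int\cdots\int e^{-n\sum_{j=1}^n Q(y_j)} \prod_{1\le i<j\le n}|y_i-y_j|^2\, dy_{k+1}\cdots dy_n , \] where $y_j\in\mathbb{R}^d$ and $D_n$ is chosen so that $D_n\int_{(\mathbb{R}^d)^n} e^{-n\sum_j Q(y_j)}\prod_{i<j}|y_i-y_j|^2\,dy = 1$. Then for every bounded continuous function $\phi$ on $(\mathbb{R}^d)^k$, \[ \lim_{n\to\infty} \int_{(\mathbb{R}^d)^k} \phi(y)\, R_{k,n}(y)\, dy = \int_{(\mathbb{R}^d)^k} \phi(x)\, d\mu^Q(x_1)\cdots d\mu^Q(x_k). \]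
   Context: $|x|$ is the Euclidean norm on $\mathbb{R}^d$. For a probability measure $\mu$ on $\mathbb{R}^d$, $I^Q(\mu) = \iint \log\frac{1}{|x-y|}\,d\mu(x)\,d\mu(y) + \int Q\,d\mu$. The equilibrium measure $\mu^Q$ is the unique probability measure minimizing $I^Q$ (it exists and is compactly supported for such $Q$). *)

(* Defs.v *)
From HB Require Import structures.
From mathcomp Require Import all_boot all_order all_algebra.
From mathcomp Require Import all_classical all_reals all_analysis.
Set Implicit Arguments. Unset Strict Implicit. Unset Printing Implicit Defensive.
Import Order.TTheory GRing.Theory Num.Theory.
Import numFieldNormedType.Exports.
Local Open Scope classical_set_scope.
Local Open Scope ring_scope.

(* Points of R^d are d-tuples of reals; d.-tuple R carries (in
   MathComp-Analysis) the product sigma-algebra of the Borel sets,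
   i.e. the Borel sigma-algebra of R^d. *)

Definition edist (R : realType) (d : nat) (x y : d.-tuple R) : R :=
  Num.sqrt (\sum_(i < d) (tnth x i - tnth y i) ^+ 2).

Definition enorm (R : realType) (d : nat) (x : d.-tuple R) : R :=
  Num.sqrt (\sum_(i < d) (tnth x i) ^+ 2).

Definition continuous_Rd (R : realType) (d : nat) (f : d.-tuple R -> R) :=
  forall x (e : R), 0 < e -> exists2 delta : R, 0 < delta &
    forall y, edist x y < delta -> `|f x - f y| < e.

Definition continuous_Rdk (R : realType) (d k : nat)
    (f : k.-tuple (d.-tuple R) -> R) :=
  forall x (e : R), 0 < e -> exists2 delta : R, 0 < delta &
    forall y, (forall i, edist (tnth x i) (tnth y i) < delta) ->
      `|f x - f y| < e.

Definition bounded_fun_on (T : Type) (R : realType) (f : T -> R) :=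
  exists M : R, forall x, `|f x| <= M.

Fixpoint iter_int (R : realType) (T : Type) (I : (T -> \bar R) -> \bar R)
    (m : nat) : (m.-tuple T -> \bar R) -> \bar R :=
  match m return (m.-tuple T -> \bar R) -> \bar R with
  | 0 => fun F => F [tuple]
  | m'.+1 => fun F => I (fun t => iter_int I (fun v => F (cons_tuple t v)))
  end.

Definition leb_int (R : realType) (F : R -> \bar R) : \bar R :=
  (\int[@lebesgue_measure R]_(t in [set: R]) F t)%E.

(* Lebesgue integral on R^d (iterated one-dimensional integrals, which by
   Fubini-Tonelli equals the integral for d-dimensional Lebesgue measure) *)
Definition leb_int_Rd (R : realType) (d : nat) (F : d.-tuple R -> \bar R) :=
  iter_int (@leb_int R) F.

Definition leb_int_Rdm (R : realType) (d m : nat)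
    (F : m.-tuple (d.-tuple R) -> \bar R) :=
  iter_int (@leb_int_Rd R d) F.

Definition mu_int_k (R : realType) (d : nat) (mu : probability (d.-tuple R) R)
    (k : nat) (F : k.-tuple (d.-tuple R) -> \bar R) :=
  iter_int (fun G => (\int[mu]_x G x)%E) F.

(* Logarithmic energy with external field Q:
   I^Q(mu) = \iint log(1/|x-y|) dmu dmu + \int Q dmu, written (as usual, to
   make it well defined in (-oo, +oo]) as the double integral of the kernel
   log(1/|x-y|) + Q(x)/2 + Q(y)/2, the kernel being +oo on the diagonal. *)
Definition energy_kernel (R : realType) (d : nat) (Q : d.-tuple R -> R)
    (x y : d.-tuple R) : \bar R :=
  if x == y then +oo%E
  else (ln (edist x y)^-1 + Q x / 2 + Q y / 2)%:E.

Definition IQ (R : realType) (d : nat) (Q : d.-tuple R -> R)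
    (mu : probability (d.-tuple R) R) : \bar R :=
  (\int[mu]_x \int[mu]_y energy_kernel Q x y)%E.

Definition is_equilibrium_measure (R : realType) (d : nat)
    (Q : d.-tuple R -> R) (mu : probability (d.-tuple R) R) : Prop :=
  forall nu : probability (d.-tuple R) R, (IQ Q mu <= IQ Q nu)%E.

Definition growth_condition (R : realType) (d : nat) (Q : d.-tuple R -> R)
    (alpha gamma eps : R) : Prop :=
  exists C M : R, forall x, M <= enorm x ->
    `|Q x - gamma * (enorm x `^ alpha)| <= C * (enorm x `^ (alpha - eps)).

Definition weight (R : realType) (d : nat) (Q : d.-tuple R -> R) (n : nat)
    (s : seq (d.-tuple R)) : R :=
  expR (- (n%:R * \sum_(y <- s) Q y)) *
  \prod_(i < size s) \prod_(j < size s | (i < j)%N)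
     edist (nth [tuple of nseq d 0] s i) (nth [tuple of nseq d 0] s j) ^+ 2.

Definition Zn (R : realType) (d : nat) (Q : d.-tuple R -> R) (n : nat) : \bar R :=
  leb_int_Rdm (fun y : n.-tuple (d.-tuple R) => (weight Q n y)%:E).

Definition Dn (R : realType) (d : nat) (Q : d.-tuple R -> R) (n : nat) : R :=
  (fine (Zn Q n))^-1.

Definition Rkn (R : realType) (d : nat) (Q : d.-tuple R -> R) (k n : nat)
    (y : k.-tuple (d.-tuple R)) : \bar R :=
  ((Dn Q n)%:E *
   leb_int_Rdm (fun z : (n - k).-tuple (d.-tuple R) =>
                  (weight Q n (y ++ z))%:E))%E.

(* Main.v *)
(* The density of n particles is proportional to exp(-H), where H is the
   sum of the Q(y_i) plus twice the sum over pairs of the kernel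
   K(x,y) = -log|x-y| + (Q(x)+Q(y))/2 + C, with C large enough to make K >= 0, and
   I^Q(mu) + C is the double integral of K.  Jensen's inequality, applied to a
   smeared version of mu^Q which has a density, bounds the partition function below by
   exp(-n^2 (J + o(1))), where J is the minimal energy; hence, except on an event
   of exponentially small probability, twice the pair sum is at most n^2 (J + o(1)).
   Smearing the empirical measure of such a configuration at a small fixed scale
   gives a measure of finite, nearly minimal, energy.

   By Frullani's formula -log|x-y| is a mixture of Gaussian kernels, so the
   logarithmic energy of a difference of probability measures is nonnegative.
   Testing minimality at the midpoint of the two measures bounds this energy, and
   therefore the L^2 distance of the two measures after convolution with a narrow
   Gaussian.  This compares their integrals of Lipschitz functions of compact
   support.

   By exchangeability, averaging a coordinate over all particles turns it into
   the empirical measure, so an induction on k gives the lower bound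
   liminf E phi >= mu^k(phi) for nonnegative Lipschitz phi of compact support.
   Every nonnegative bounded continuous phi is an increasing limit of such
   functions, by inf-convolution and truncation, so the lower bound extends to
   it.  For |phi| <= M the lower bounds for M + phi and M - phi give the limit,
   because both sides have total mass one; no tightness is needed. *)
Require Import Defs.
From HB Require Import structures.
From mathcomp Require Import all_boot all_order all_algebra.
From mathcomp Require Import all_classical all_reals all_analysis.
From mathcomp Require Import measurable_realfun.
From mathcomp Require Import ring lra zify.
(* Again, since MathComp-Analysis has its own [edist]. *)
Require Import Defs.
Import Order.TTheory GRing.Theory Num.Theory.
Import numFieldNormedType.Exports.
Local Open Scope classical_set_scope.
Local Open Scope ring_scope.

(** * Finite powers of a measure on tuples *)

Set Implicit Arguments.
Unset Strict Implicit.
Unset Printing Implicit Defensive.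

Section tuple_product_measure.
Context d (T : measurableType d) (R : realType).
Local Open Scope ereal_scope.

(** The obstacle is the diagonal: the kernel is [+oo] there, so an empirical measure has infinite
    energy, while [mu] is not assumed to have a density. Uniform noise in a cube of side [dl]
    answers both. The kernel averaged over the noise is at most [(1 + e) K + e] at all pairs of
    points, which controls energies, and the noise has density at most [dl] to the power [-d], which
    compares the trial measure with Lebesgue measure at a cost only exponential in [n], against
    [n^2] in the energy. In the Gaussian mixture each scale [t] has weight [dt / (2t)]. This weight
    gives every interval [T, 2T] the same mass, so a small energy gap yields a scale in any such
    interval where the Gaussian gap is small; this makes the comparison quantitative and uniform
    over the test functions with given bounds. Kernels are kept nonnegative and identities are
    written as sums on both sides, so that Tonelli applies and no infinite quantity is
    subtracted. *)

Definition consp n (p : T * n.-tuple T) : n.+1.-tuple T :=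
  cons_tuple p.1 p.2.

Definition unconsp n (v : n.+1.-tuple T) : T * n.-tuple T :=
  (thead v, [tuple of behead v]).

Lemma measurable_consp n : measurable_fun setT (@consp n).
Proof. exact: (measurable_cons measurable_fst measurable_snd). Qed.

Lemma measurable_unconsp n : measurable_fun setT (@unconsp n).
Proof.
apply/measurable_fun_pair; last exact: measurable_behead.
exact: measurable_tnth.
Qed.

Lemma conspK n : cancel (@consp n) (@unconsp n).
Proof. by move=> [t v]; congr pair; exact/val_inj. Qed.

Lemma emeasurable_prod d' (S : measurableType d') I (s : seq I)
    (h : I -> S -> \bar R) :
  (forall i, measurable_fun setT (h i)) ->
  measurable_fun setT (fun x => \prod_(i <- s) h i x).
Proof.
move=> mh; elim: s => [|a s IH]; first by under eq_fun do rewrite big_nil; exact: measurable_cst.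
by under eq_fun do rewrite big_cons; exact: emeasurable_funM.
Qed.

Section step.
Variables (m : {sigma_finite_measure set T -> \bar R}) (n : nat).
Variable m' : {sigma_finite_measure set (n.-tuple T) -> \bar R}.

Definition tpmS : set (n.+1.-tuple T) -> \bar R :=
  pushforward (m \x m') (@consp n).

HB.instance Definition _ := Measure.copy tpmS
  (measure_function_pushforward__canonical__measure_function_Measure
    (m \x m') (@measurable_consp n)).

Let tpmS_sigma_finite : sigma_finite setT tpmS.
Proof.
have /sigma_finiteP[F [TF ndF Foo]] := sigma_finiteT m.
have /sigma_finiteP[G [TG ndG Goo]] := sigma_finiteT m'.
exists (fun k => @unconsp n @^-1` (F k `*` G k)).
  rewrite -preimage_bigcup; apply/seteqP; split => // v _.
  have [i _ Fi] : (\bigcup_i F i) (thead v) by rewrite -TF.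
  have [j _ Gj] : (\bigcup_i G i) [tuple of behead v] by rewrite -TG.
  (* Both exhaustions are nondecreasing, so the larger index serves for both factors. *)
  exists (maxn i j) => //; split => /=.
    by move: Fi; exact/subsetPset/ndF/leq_maxl.
  by move: Gj; exact/subsetPset/ndG/leq_maxr.
move=> k; have [? ?] := Foo k; have [? ?] := Goo k; split.
  by rewrite -[X in measurable X]setTI; apply: measurable_unconsp => //; exact: measurableX.
rewrite /tpmS /pushforward (_ : _ @^-1` _ = F k `*` G k); last first.
  by rewrite -comp_preimage (_ : _ \o _ = id)//; apply/funext; exact: conspK.
by rewrite product_measure1E// lte_mul_pinfty// ge0_fin_numE.
Qed.

HB.instance Definition _ := Measure_isSigmaFinite.Build _ _ _ tpmS
  tpmS_sigma_finite.
End step.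

Section power.
Variable m : {sigma_finite_measure set T -> \bar R}.

(** The recursion mirrors that of [iter_int], so the iterated integrals of the statement become
    integrals against a single measure. *)
Fixpoint tpm n : {sigma_finite_measure set (n.-tuple T) -> \bar R} :=
  match n with
  | 0 => dirac [tuple]
  | n'.+1 => tpmS m (tpm n')
  end.

Lemma tpm0E (F : 0.-tuple T -> \bar R) : measurable_fun setT F ->
  \int[tpm 0]_v F v = F [tuple].
Proof. by move=> mF; rewrite integral_dirac// diracT mul1e. Qed.

Lemma ge0_tpmSE n (F : n.+1.-tuple T -> \bar R) :
  measurable_fun setT F -> (forall v, 0 <= F v) ->
  \int[tpm n.+1]_v F v = \int[m]_t \int[tpm n]_v F (cons_tuple t v).
Proof.
move=> mF F0; rewrite /= ge0_integral_pushforward//; last first.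
  exact: measurable_consp.
rewrite preimage_setT fubini_tonelli1//; last first.
  by move=> x; exact: F0.
by apply: measurableT_comp => //; exact: measurable_consp.
Qed.

Lemma tpmSE n (F : n.+1.-tuple T -> \bar R) :
  (tpm n.+1).-integrable setT F ->
  \int[tpm n.+1]_v F v = \int[m]_t \int[tpm n]_v F (cons_tuple t v).
Proof.
move=> iF; have mF := measurable_int _ iF.
have iFc : (m \x tpm n).-integrable setT (F \o @consp n).
  apply/integrableP; split; first by apply: measurableT_comp => //; exact: measurable_consp.
  move/integrableP : iF => [_]; apply: le_lt_trans.
  rewrite /= ge0_integral_pushforward//.
  - exact: measurable_consp.
  - exact: measurableT_comp.
rewrite /= integral_pushforward//.
- by rewrite preimage_setT -integral12_prod_meas1.
- exact: measurable_consp.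
Qed.

Lemma measurable_cons_tuple d' (S : measurableType d') n
    (f : S -> T) (g : S -> n.-tuple T) :
  measurable_fun setT f -> measurable_fun setT g ->
  measurable_fun setT (fun x => cons_tuple (f x) (g x)).
Proof. by move=> mf mg; exact: measurable_cons. Qed.

Lemma measurable_cons_section n (F : n.+1.-tuple T -> \bar R) t :
  measurable_fun setT F -> measurable_fun setT (fun v => F (cons_tuple t v)).
Proof.
by move=> mF; apply: measurableT_comp => //; exact: measurable_cons_tuple.
Qed.

Lemma measurable_int_section n (F : n.+1.-tuple T -> \bar R) :
  measurable_fun setT F -> (forall v, 0 <= F v) ->
  measurable_fun setT (fun t => \int[tpm n]_v F (cons_tuple t v)).
Proof.
move=> mF F0.
apply: (measurable_fun_fubini_tonelli_F (fun p => F (cons_tuple p.1 p.2))) => //.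
by apply: measurableT_comp => //; exact: measurable_cons_tuple.
Qed.

(** Agreement of [I] with the integral is asked only on nonnegative measurable functions.
    Integrating out coordinates preserves this class, so the lemma can be applied again to the
    functional it has just identified: from R to R^d, then to n points of R^d. *)
Lemma ge0_iter_intE (I : (T -> \bar R) -> \bar R) n (F : n.-tuple T -> \bar R) :
  (forall G, measurable_fun setT G -> (forall t, 0 <= G t) ->
    I G = \int[m]_t G t) ->
  measurable_fun setT F -> (forall v, 0 <= F v) ->
  iter_int I F = \int[tpm n]_v F v.
Proof.
move=> IE; elim: n F => [|n IH] F mF F0; first by rewrite tpm0E.
have e t : iter_int I (fun v => F (cons_tuple t v)) =
    \int[tpm n]_v F (cons_tuple t v).
  by apply: IH => //; exact: measurable_cons_section.
rewrite ge0_tpmSE//= (funext e) IE//; first exact: measurable_int_section.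
by move=> t; exact: integral_ge0.
Qed.

Lemma ge0_integral_prod n (f : nat -> T -> \bar R) :
  (forall i, measurable_fun setT (f i)) -> (forall i t, 0 <= f i t) ->
  \int[tpm n]_v \prod_(i < n) f i (tnth v i) = \prod_(i < n) \int[m]_t f i t.
Proof.
move=> mf f0.
have mp k (g : nat -> T -> \bar R) : (forall i, measurable_fun setT (g i)) ->
    measurable_fun setT (fun v : k.-tuple T => \prod_(i < k) g i (tnth v i)).
  move=> mg; apply: emeasurable_prod => i _.
  by apply: measurableT_comp => //; exact: measurable_tnth.
elim: n f mf f0 => [|n IH] f mf f0; first by rewrite tpm0E ?big_ord0//; exact: mp.
rewrite ge0_tpmSE//; last 2 first.
- exact: mp.
- by move=> v; exact: prode_ge0.
under eq_integral => t _.
  under eq_integral => v _ do rewrite big_ord_recl/= tnth0.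
  rewrite ge0_integralZl//; last 2 first.
  - apply: emeasurable_prod => i _; apply: measurableT_comp => //.
    under eq_fun do rewrite tnthS; exact: measurable_tnth.
  - by move=> v _; apply: prode_ge0.
  under eq_integral => v _ do under eq_bigr => i _ do rewrite tnthS.
  over.
rewrite /= ge0_integralZr//; last first.
  by apply: integral_ge0 => v _; exact: prode_ge0.
by rewrite big_ord_recl (IH (fun i => f i.+1)).
Qed.

End power.
End tuple_product_measure.

Section tuple_integrals.
Context d (T : measurableType d) (R : realType).
Local Open Scope ereal_scope.
Variable m : {sigma_finite_measure set T -> \bar R}.

Lemma integrable_consp n (F : n.+1.-tuple T -> \bar R) :
  (tpm m n.+1).-integrable setT F ->
  (m \x tpm m n).-integrable setT (F \o @consp d T n).
Proof.
move=> iF; have mF := measurable_int _ iF.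
apply/integrableP; split.
  by apply: measurableT_comp => //; exact: measurable_consp.
move/integrableP : iF => [_]; apply: le_lt_trans.
rewrite /= ge0_integral_pushforward//.
- exact: measurable_consp.
- exact: measurableT_comp.
Qed.

Lemma dom_integrable n (h : T -> R) (C : R) (F : n.-tuple T -> \bar R) :
  measurable_fun setT h -> (forall t, 0 <= h t)%R ->
  \int[m]_t (h t)%:E < +oo -> measurable_fun setT F -> (0 <= C)%R ->
  (forall v, `|F v| <= (C * \prod_(i < n) h (tnth v i))%:E) ->
  (tpm m n).-integrable setT F /\
  \int[tpm m n]_v `|F v| <= (C * fine (\int[m]_t (h t)%:E) ^+ n)%:E.
Proof.
move=> mh h0 hoo mF C0 FC.
have mp : measurable_fun setT (fun v : n.-tuple T => \prod_(i < n) (h (tnth v i))%:E).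
  apply: emeasurable_prod => i; apply/measurable_EFinP.
  by apply: measurableT_comp => //; exact: measurable_tnth.
have hfin : \int[m]_t (h t)%:E \is a fin_num.
  by rewrite ge0_fin_numE// integral_ge0// => t _; rewrite lee_fin.
have le : \int[tpm m n]_v `|F v| <= (C * fine (\int[m]_t (h t)%:E) ^+ n)%:E.
  apply: (@le_trans _ _ (\int[tpm m n]_v (C%:E * \prod_(i < n) (h (tnth v i))%:E))).
    apply: ge0_le_integral => //=.
    - exact: measurableT_comp.
    - exact: measurable_funeM.
    - by move=> v _; rewrite (le_trans (FC v))// EFinM prodEFin.
  rewrite ge0_integralZl//; last first.
    by move=> v _; apply: prode_ge0 => i _; rewrite lee_fin.
  rewrite (ge0_integral_prod m n (f := fun _ t => (h t)%:E))//.
  - under eq_bigr => i _ do rewrite -(fineK hfin).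
    by rewrite prodEFin prodr_const card_ord -EFinM.
  - by move=> i; exact/measurable_EFinP.
by split=> //; apply/integrableP; split => //; apply: le_lt_trans le _; exact: ltry.
Qed.

(** For signed [F] the functional [I] is known only on functions dominated by [h]. A product
    majorant survives: integrating out the other coordinates leaves a function of [t] bounded, for
    every [t], by a constant times [h t]. *)
Lemma dom_iter_intE (I : (T -> \bar R) -> \bar R) n (h : T -> R) (C : R)
    (F : n.-tuple T -> \bar R) :
  (forall G, measurable_fun setT G ->
    (exists c : R, forall t, `|G t| <= (c * h t)%:E) -> I G = \int[m]_t G t) ->
  measurable_fun setT h -> (forall t, 0 <= h t)%R ->
  \int[m]_t (h t)%:E < +oo -> measurable_fun setT F -> (0 <= C)%R ->
  (forall v, `|F v| <= (C * \prod_(i < n) h (tnth v i))%:E) ->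
  iter_int I F = \int[tpm m n]_v F v.
Proof.
move=> IE mh h0 hoo; elim: n C F => [|n IH] C F mF C0 FC.
  by rewrite tpm0E.
have FC' t v : `|F (cons_tuple t v)| <= (C * h t * \prod_(i < n) h (tnth v i))%:E.
  apply: le_trans (FC _) _; rewrite big_ord_recl -mulrA lee_fin.
  by rewrite tnth0; under eq_bigr do rewrite tnthS.
have e t : iter_int I (fun v => F (cons_tuple t v)) =
    \int[tpm m n]_v F (cons_tuple t v).
  apply: (IH (C * h t)%R) => //; first exact: measurable_cons_section.
  exact: mulr_ge0.
have [iF _] := dom_integrable mh h0 hoo mF C0 FC.
rewrite tpmSE//= (funext e) IE//.
  exact: (measurable_fubini_F (integrable_consp iF)).
exists (C * (fine (\int[m]_t (h t)%:E) ^+ n))%R => t.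
have Cht : (0 <= C * h t)%R by exact: mulr_ge0.
have mFt := measurable_cons_section t mF.
have [_ le] := dom_integrable mh h0 hoo mFt Cht (FC' t).
rewrite (le_trans (le_abse_integral _ _ _))// (le_trans le)//.
by rewrite -!mulrA (mulrC (h t)).
Qed.

Lemma measurable_cat_tuple d' (S : measurableType d') k n
    (f : S -> k.-tuple T) (g : S -> n.-tuple T) :
  measurable_fun setT f -> measurable_fun setT g ->
  measurable_fun setT (fun x => cat_tuple (f x) (g x)).
Proof.
move=> mf mg; apply/measurable_fun_tnthP => i.
case: (fintype.splitP i) => j ij.
- have -> : i = lshift n j by exact/val_inj.
  rewrite (_ : _ \o _ = (@tnth _ T ^~ j) \o f).
    by apply: measurableT_comp => //; exact: measurable_tnth.
  apply/funext => x /=; rewrite -(tnth_lshift (f x) (g x) j).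
  by congr tnth; exact/val_inj.
- have -> : i = rshift k j by exact/val_inj.
  rewrite (_ : _ \o _ = (@tnth _ T ^~ j) \o g).
    by apply: measurableT_comp => //; exact: measurable_tnth.
  apply/funext => x /=; rewrite -(tnth_rshift (f x) (g x) j).
  by congr tnth; exact/val_inj.
Qed.

(** [G] is defined on all sequences, so that concatenations need no cast between tuple lengths. *)
Lemma ge0_integral_cat k n (G : seq T -> \bar R) :
  measurable_fun setT (fun w : (k + n).-tuple T => G w) ->
  (forall s, 0 <= G s) ->
  \int[tpm m k]_y \int[tpm m n]_z G (y ++ z) = \int[tpm m (k + n)]_w G w.
Proof.
elim: k G => [|k IH] G mG G0.
  rewrite tpm0E//=.
  have -> : (fun v : 0.-tuple T => \int[tpm m n]_z G (v ++ z)) =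
            fun=> \int[tpm m n]_z G z.
    by apply/funext => v; rewrite tuple0.
  exact: measurable_cst.
rewrite (ge0_tpmSE m (n := k + n) mG)//.
rewrite ge0_tpmSE//; last 2 first.
- apply: (measurable_fun_fubini_tonelli_F (fun p : k.+1.-tuple T * n.-tuple T =>
    G (p.1 ++ p.2))) => //.
  apply: (measurableT_comp mG); exact: measurable_cat_tuple.
- by move=> v; exact: integral_ge0.
apply: eq_integral => t _.
rewrite -(IH (fun s => G (t :: s)))//.
exact: (measurable_cons_section t mG).
Qed.

(** Presents the insertion as a tuple with explicit entries, so that measurability can be checked
    coordinate by coordinate. *)
Lemma val_insT n i (t x0 : T) (w : n.-tuple T) : (i <= n)%N ->
  [tuple (if (j < i)%N then nth x0 w j else if j == i :> nat then t
          else nth x0 w j.-1) | j < n.+1] = take i w ++ t :: drop i w :> seq T.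
Proof.
move=> i_n; apply: (@eq_from_nth _ x0) => [|j].
  rewrite size_tuple size_cat/= size_drop size_takel ?size_tuple//; lia.
rewrite size_tuple => jn; rewrite (nth_mktuple _ _ (Ordinal jn))/=.
rewrite nth_cat size_takel ?size_tuple//.
have [ji|ij] := ltnP j i; first by rewrite nth_take.
have [->|ji] := eqVneq j i; first by rewrite subnn.
have ij' : (i < j)%N by rewrite ltn_neqAle eq_sym ji.
rewrite (_ : j - i = (j - i).-1.+1)%N/=; last by lia.
by rewrite nth_drop; congr nth; lia.
Qed.

(** Induction on the position: the head is split off, exchanged with the inserted variable by
    Tonelli, and put back in front of the remaining coordinates. *)
Lemma ge0_integral_insert i n (G : seq T -> \bar R) :
  (i <= n)%N ->
  measurable_fun setT (fun w : n.+1.-tuple T => G w) ->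
  (forall s, 0 <= G s) ->
  \int[tpm m n.+1]_w G w =
  \int[m]_t \int[tpm m n]_v G (take i v ++ t :: drop i v).
Proof.
elim: i n G => [|i IH] n G i_n mG G0.
  rewrite ge0_tpmSE//; apply: eq_integral => t _; apply: eq_integral => v _.
  by rewrite take0 drop0.
case: n i_n mG => // n i_n mG.
have mins d' (S : measurableType d') (t : S -> T) (w : S -> n.-tuple T) :
    measurable_fun setT t -> measurable_fun setT w ->
    measurable_fun setT (fun x => [tuple (if (j < i)%N then nth (t x) (w x) j
      else if j == i :> nat then t x else nth (t x) (w x) j.-1) | j < n.+1]).
  move=> mt mw; apply/measurable_fun_tnthP => j.
  rewrite (_ : _ \o _ = fun x => if (j < i)%N then nth (t x) (w x) j
    else if j == i :> nat then t x else nth (t x) (w x) j.-1); last first.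
    by apply/funext => x; rewrite /= tnth_mktuple.
  have mnth k : measurable_fun setT (fun x => nth (t x) (w x) k).
    have [kn|nk] := ltnP k n.
      rewrite (_ : (fun x => _) = (@tnth _ T ^~ (Ordinal kn)) \o w).
        by apply: measurableT_comp => //; exact: measurable_tnth.
      by apply/funext => x; rewrite /= (tnth_nth (t x)).
    rewrite (_ : (fun x => _) = t)//; apply/funext => x.
    by rewrite nth_default// size_tuple.
  by case: (j < i)%N; [exact: mnth|case: (j == i :> nat); [exact: mt|exact: mnth]].
have mH : measurable_fun setT (fun p : (T * T) * n.-tuple T =>
    G (p.1.1 :: take i p.2 ++ p.1.2 :: drop i p.2)).
  rewrite (_ : (fun p => _) = (fun w : n.+2.-tuple T => G w) \o
    (fun p : (T * T) * n.-tuple T => cons_tuple p.1.1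
      [tuple (if (j < i)%N then nth p.1.2 p.2 j
      else if j == i :> nat then p.1.2 else nth p.1.2 p.2 j.-1) | j < n.+1])); last first.
    by apply/funext => p /=; rewrite val_insT.
  apply: measurableT_comp => //; apply: measurable_cons_tuple.
    by apply: measurableT_comp => //.
  by apply: mins => //; apply: measurableT_comp.
rewrite ge0_tpmSE//=.
transitivity (\int[m]_s \int[m]_t \int[tpm m n]_w
    G (s :: take i w ++ t :: drop i w)).
  apply: eq_integral => s _.
  rewrite (IH n (fun v => G (s :: v)))//.
  exact: (measurable_cons_section s mG).
rewrite (fubini_tonelli (fun p => \int[tpm m n]_w
  G (p.1 :: take i w ++ p.2 :: drop i w)))/=; last 2 first.
- exact: (measurable_fun_fubini_tonelli_F _ mH).
- by move=> p; exact: integral_ge0.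
apply: eq_integral => t _; rewrite ge0_tpmSE//.
rewrite (_ : (fun v => _) = (fun p : (T * T) * n.-tuple T =>
    G (p.1.1 :: take i p.2 ++ p.1.2 :: drop i p.2)) \o
    (fun v : n.+1.-tuple T => ((thead v, t), [tuple of behead v]))).
  apply: (measurableT_comp mH).
  apply/measurable_fun_pair; last exact: measurable_behead.
  by apply/measurable_fun_pair => //; exact: measurable_tnth.
by apply/funext => v /=; case/tupleP: v => x v; rewrite /= theadE.
Qed.

Fixpoint pairsum (f : T -> T -> \bar R) (s : seq T) : \bar R :=
  if s is t :: s' then \sum_(y <- s') f t y + pairsum f s' else 0.

Lemma pairsum_ge0 f s : (forall x y, 0 <= f x y) -> 0 <= pairsum f s.
Proof. by move=> f0; elim: s => //= t s IH; rewrite adde_ge0// sume_ge0. Qed.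

Lemma measurable_sum_tuple n (g : T -> \bar R) : measurable_fun setT g ->
  measurable_fun setT (fun v : n.-tuple T => \sum_(y <- v) g y).
Proof.
move=> mg; under eq_fun do rewrite big_tuple.
apply: emeasurable_sum => i; apply: measurableT_comp => //.
exact: measurable_tnth.
Qed.

Lemma measurable_pairsum n (f : T -> T -> \bar R) :
  measurable_fun setT (fun p => f p.1 p.2) ->
  measurable_fun setT (fun v : n.-tuple T => pairsum f v).
Proof.
move=> mf; elim: n => [|n IH].
  rewrite (_ : (fun v => _) = cst 0); first exact: measurable_cst.
  by apply/funext => v; rewrite tuple0.
rewrite (_ : (fun v => _) = fun v : n.+1.-tuple T =>
  \sum_(i < n) f (thead v) (tnth [tuple of behead v] i) +
  pairsum f [tuple of behead v]); last first.
  apply/funext => v; case/tupleP: v => x v; rewrite /= theadE big_tuple.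
  congr (_ + _); apply: eq_bigr => i _; congr f; congr tnth; exact/val_inj.
apply: emeasurable_funD; last first.
  by apply: (measurableT_comp IH); exact: measurable_behead.
apply: emeasurable_sum => i.
apply: (measurableT_comp (g := fun v : n.+1.-tuple T => (thead v, tnth [tuple of behead v] i)) mf).
apply/measurable_fun_pair; first exact: measurable_tnth.
by apply: (measurableT_comp (measurable_tnth i)); exact: measurable_behead.
Qed.

Section probability_case.
Hypothesis m1 : m setT = 1.

Lemma tpm_setT n : tpm m n setT = 1.
Proof.
rewrite -[LHS]mul1e -(integral_cst (tpm m n) measurableT 1).
transitivity (\int[tpm m n]_v \prod_(i < n) (fun=> 1) (tnth v i)).
  by apply: eq_integral => v _; rewrite big1.
rewrite (ge0_integral_prod m n (f := fun _ => cst 1))//.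
by rewrite big1// => i _; rewrite integral_cst// mul1e.
Qed.

Let int_cst (c : \bar R) : \int[m]_t c = c.
Proof. by rewrite integral_cst// -[RHS]mule1; congr (_ * _). Qed.

Let tpm_int_cst n (c : \bar R) : \int[tpm m n]_v c = c.
Proof.
by rewrite integral_cst// -[RHS]mule1; congr (_ * _); exact: tpm_setT.
Qed.

Lemma ge0_integral_sum_tuple n (g : T -> \bar R) :
  measurable_fun setT g -> (forall t, 0 <= g t) ->
  \int[tpm m n]_v \sum_(y <- v) g y = n%:R%:E * \int[m]_t g t.
Proof.
move=> mg g0; elim: n => [|n IH].
  by rewrite tpm0E ?big_nil ?mul0e//; exact: measurable_sum_tuple.
rewrite ge0_tpmSE//; last 2 first.
- exact: measurable_sum_tuple.
- by move=> v; exact: sume_ge0.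
under eq_integral => t _.
  under eq_integral => v _ do rewrite big_cons.
  rewrite ge0_integralD//; last 2 first.
  - by move=> v _; exact: sume_ge0.
  - exact: measurable_sum_tuple.
  rewrite IH tpm_int_cst.
  over.
rewrite /= ge0_integralD//; last first.
  by move=> t _; rewrite mule_ge0// ?lee_fin// integral_ge0.
rewrite int_cst -[n.+1%:R]natr1 EFinD ge0_muleDl ?lee_fin//.
by rewrite mul1e addeC.
Qed.

Lemma ge0_integral_pairsum n (f : T -> T -> \bar R) :
  measurable_fun setT (fun p => f p.1 p.2) -> (forall x y, 0 <= f x y) ->
  \int[tpm m n]_v pairsum f v = 'C(n, 2)%:R%:E * \int[m]_x \int[m]_y f x y.
Proof.
move=> mf f0.
have ms t : measurable_fun setT (f t).
  exact: (measurableT_comp mf (pair1_measurable t)).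
have mi : measurable_fun setT (fun t => \int[m]_y f t y).
  exact: (measurable_fun_fubini_tonelli_F _ mf).
elim: n => [|n IH].
  by rewrite tpm0E ?mul0e//; exact: measurable_pairsum.
rewrite ge0_tpmSE//; last 2 first.
- exact: measurable_pairsum.
- by move=> v; exact: pairsum_ge0.
under eq_integral => t _.
  rewrite /= ge0_integralD//; last 4 first.
  - by move=> v _; exact: sume_ge0.
  - exact: measurable_sum_tuple.
  - by move=> v _; exact: pairsum_ge0.
  - exact: measurable_pairsum.
  rewrite IH ge0_integral_sum_tuple//.
  over.
have i0 t : 0 <= \int[m]_y f t y by exact: integral_ge0.
rewrite /= ge0_integralD//; last 3 first.
- by move=> t _; rewrite mule_ge0// lee_fin.
- exact: measurable_funeM.
- by move=> t _; rewrite mule_ge0// ?lee_fin// integral_ge0.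
rewrite ge0_integralZl ?lee_fin// int_cst.
rewrite -ge0_muleDl ?lee_fin// -EFinD -natrD; congr (_%:R%:E * _).
by rewrite binS bin1 addnC.
Qed.

End probability_case.
End tuple_integrals.

(** The domination of [p] by [m] is used on the first coordinate, the induction hypothesis inside.
    With [p] a smeared measure and [m] Lebesgue measure, it bounds the law of [n] independent
    smeared points. *)
Lemma tpm_dominated d (T : measurableType d) (R : realType)
    (p m : {sigma_finite_measure set T -> \bar R}) (c : R) n
    (F : n.-tuple T -> \bar R) : (0 <= c)%R ->
  (forall G, measurable_fun setT G -> (forall t, 0 <= G t)%E ->
    c%:E * \int[p]_t G t <= \int[m]_t G t)%E ->
  measurable_fun setT F -> (forall v, 0 <= F v)%E ->
  ((c ^+ n)%:E * \int[tpm p n]_v F v <= \int[tpm m n]_v F v)%E.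
Proof.
move=> c0 pm; elim: n F => [|n IH] F mF F0.
  by rewrite !tpm0E// expr0 mul1e.
rewrite !ge0_tpmSE// exprS mulrC EFinM -muleA.
apply: (@le_trans _ _ ((c ^+ n)%:E * \int[m]_t \int[tpm p n]_v F (cons_tuple t v))%E).
  apply: lee_wpmul2l; first by rewrite lee_fin exprn_ge0.
  apply: pm; first exact: measurable_int_section.
  by move=> t; exact: integral_ge0.
rewrite -ge0_integralZl//; last 3 first.
- exact: measurable_int_section.
- by move=> t _; exact: integral_ge0.
- by rewrite lee_fin exprn_ge0.
apply: ge0_le_integral => //.
- by move=> t _; rewrite mule_ge0 ?lee_fin ?exprn_ge0// integral_ge0.
- by apply: measurable_funeM; exact: measurable_int_section.
- exact: measurable_int_section.
- move=> t _; apply: IH => //; exact: measurable_cons_section.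
Qed.

Section mkprob.
Context d (T : measurableType d) (R : realType).
Variable P : {measure set T -> \bar R}.
Hypothesis P1 : P setT = 1%E.

(** The proof of unit mass is an argument of the constant, so that the probability instance can be
    attached to it. *)
Definition mkprob of (P setT = 1%E) := (P : set T -> \bar R).

HB.instance Definition _ := Measure.on (mkprob P1).
HB.instance Definition _ := Measure_isProbability.Build _ _ _ (mkprob P1) P1.
End mkprob.

(** * Euclidean distance and measurability *)

Section euclidean_distance.
Context (R : realType) (d : nat).
Implicit Types x y z : d.-tuple R.

Lemma sqrt_sum_sqrD (a b : 'I_d -> R) :
  Num.sqrt (\sum_(i < d) (a i + b i) ^+ 2) <=
  Num.sqrt (\sum_(i < d) (a i) ^+ 2) + Num.sqrt (\sum_(i < d) (b i) ^+ 2).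
Proof.
set A := Num.sqrt (\sum_(i < d) (a i) ^+ 2).
set B := Num.sqrt (\sum_(i < d) (b i) ^+ 2).
have s0 (c : 'I_d -> R) : 0 <= \sum_(i < d) (c i) ^+ 2.
  by apply: sumr_ge0 => i _; exact: sqr_ge0.
have A0 : 0 <= A by exact: sqrtr_ge0.
have B0 : 0 <= B by exact: sqrtr_ge0.
have AE : \sum_(i < d) (a i) ^+ 2 = A ^+ 2 by rewrite sqr_sqrtr.
have BE : \sum_(i < d) (b i) ^+ 2 = B ^+ 2 by rewrite sqr_sqrtr.
rewrite -(ler_pXn2r (n := 2))// ?nnegrE ?sqrtr_ge0 ?addr_ge0// sqr_sqrtr//.
under eq_bigr do rewrite sqrrD.
rewrite !big_split/= AE BE sqrrD lerD2r lerD2l mulr2n.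
suff : \sum_(i < d) a i * b i <= A * B by move=> h; exact: lerD.
have [A00|Apos] := eqVneq A 0.
  rewrite A00 mul0r big1// => i _.
  have /eqP := AE; rewrite A00 expr0n/= psumr_eq0; last by move=> j _; exact: sqr_ge0.
  by move=> /allP/(_ i); rewrite mem_index_enum sqrf_eq0 => /(_ isT)/eqP ->; rewrite mul0r.
have [B00|Bpos] := eqVneq B 0.
  rewrite B00 mulr0 big1// => i _.
  have /eqP := BE; rewrite B00 expr0n/= psumr_eq0; last by move=> j _; exact: sqr_ge0.
  by move=> /allP/(_ i); rewrite mem_index_enum sqrf_eq0 => /(_ isT)/eqP ->; rewrite mulr0.
have Agt : 0 < A by rewrite lt0r Apos.
have Bgt : 0 < B by rewrite lt0r Bpos.
(* Weighted arithmetic-geometric inequality for each product, with weights that make both sums equal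
   to A B / 2. *)
apply: (@le_trans _ _ (\sum_(i < d) (B / (2 * A) * a i ^+ 2 + A / (2 * B) * b i ^+ 2))).
  apply: ler_sum => i _; rewrite -subr_ge0.
  rewrite (_ : _ - _ = (B * a i - A * b i) ^+ 2 / (2 * A * B)); last by field; rewrite Apos Bpos.
  by rewrite divr_ge0 ?sqr_ge0// !mulr_ge0.
rewrite big_split/= -!mulr_sumr AE BE le_eqVlt; apply/orP; left; apply/eqP.
by field; rewrite Apos Bpos.
Qed.

Lemma edist_ge0 x y : 0 <= edist x y. Proof. exact: sqrtr_ge0. Qed.

Lemma edistC x y : edist x y = edist y x.
Proof. by congr Num.sqrt; apply: eq_bigr => i _; rewrite -sqrrN opprB. Qed.

Lemma edist_triangle y x z : edist x z <= edist x y + edist y z.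
Proof.
apply: le_trans (sqrt_sum_sqrD _ _); rewrite le_eqVlt; apply/orP; left; apply/eqP.
by congr Num.sqrt; apply: eq_bigr => i _; rewrite subrKA.
Qed.

Lemma edist_le_sum x y : edist x y <= \sum_(i < d) `|tnth x i - tnth y i|.
Proof.
have h (s : seq 'I_d) (f : 'I_d -> R) : 0 <= \sum_(i <- s) `|f i| /\
    \sum_(i <- s) (f i) ^+ 2 <= (\sum_(i <- s) `|f i|) ^+ 2.
  elim: s => [|i s [IH0 IH]]; first by rewrite !big_nil expr0n.
  rewrite !big_cons; split; first by rewrite addr_ge0.
  rewrite sqrrD real_normK ?num_real// -addrA lerD2l (le_trans IH)// lerDr.
  by rewrite mulrn_wge0// mulr_ge0.
have [s0 le] := h (index_enum _) (fun i => tnth x i - tnth y i).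
rewrite -(ler_pXn2r (n := 2))// ?nnegrE ?sqrtr_ge0//.
by rewrite sqr_sqrtr//; apply: sumr_ge0 => i _; exact: sqr_ge0.
Qed.

Lemma coord_le_edist x y i : `|tnth x i - tnth y i| <= edist x y.
Proof.
rewrite -sqrtr_sqr; apply: ler_wsqrtr; rewrite (bigD1 i)//= lerDl.
by apply: sumr_ge0 => j _; exact: sqr_ge0.
Qed.

Lemma edistxx x : edist x x = 0.
Proof.
rewrite /edist big1 ?sqrtr0// => i _; by rewrite subrr expr0n.
Qed.

Lemma edist_eq0 x y : (edist x y == 0) = (x == y).
Proof.
apply/eqP/eqP => [xy0|->]; last exact: edistxx.
apply: eq_from_tnth => i; apply/eqP; rewrite -subr_eq0 -normr_le0 -xy0.
exact: coord_le_edist.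
Qed.

Lemma edist_gt0 x y : (0 < edist x y) = (x != y).
Proof. by rewrite lt0r edist_eq0 edist_ge0 andbT. Qed.

Lemma enormE x : enorm x = edist x [tuple of nseq d 0].
Proof.
congr Num.sqrt; apply: eq_bigr => i _.
by rewrite (tnth_nth 0 [tuple of nseq d 0])/= nth_nseq if_same subr0.
Qed.

Lemma enorm_ge0 x : 0 <= enorm x. Proof. exact: sqrtr_ge0. Qed.

Lemma enorm_le x y : enorm y <= enorm x + edist x y.
Proof. by rewrite !enormE addrC (edistC x); exact: edist_triangle. Qed.

Lemma edist_le_enorm x y : edist x y <= enorm x + enorm y.
Proof. by rewrite !enormE (edistC y); exact: edist_triangle. Qed.

Lemma measurable_edist (dS : measure_display) (S : measurableType dS)
    (f g : S -> d.-tuple R) : measurable_fun setT f -> measurable_fun setT g ->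
  measurable_fun setT (fun s => edist (f s) (g s)).
Proof.
move=> mf mg; apply: (measurableT_comp (f := @Num.sqrt R)).
  by apply: continuous_measurable_fun; exact: sqrt_continuous.
apply: measurable_sum => i; apply: measurable_funX; apply: measurable_funB;
  by apply: (measurableT_comp (measurable_tnth i)).
Qed.

End euclidean_distance.

(* Only separability of the pseudo-distance [rho] and measurability of its
   balls are used: every superlevel set is a countable union of balls. *)
Lemma metric_continuous_measurable (dS : measure_display) (S : measurableType dS)
    (R : realType) (rho : S -> S -> R) (c : nat -> S) (f : S -> R) :
  (forall a, measurable_fun setT (rho a)) ->
  (forall x y, rho x y = rho y x) ->
  (forall x y z, rho x z <= rho x y + rho y z) ->
  (forall x e, 0 < e -> exists n, rho (c n) x < e) ->
  (forall x e, 0 < e -> exists2 dl, 0 < dl &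
    forall y, rho x y < dl -> `|f x - f y| < e) ->
  measurable_fun setT f.
Proof.
move=> mrho rhoC tri dense cf.
move=> mS; apply: (measurability _ (RGenOInfty.measurableE R)) => //.
move=> /= _ [_ [a ->]] <-; apply: measurableI => //.
pose B n q := [set x | rho (c n) x < q.+1%:R^-1].
pose good n q := `[< forall y, B n q y -> a < f y >].
have -> : f @^-1` `]a, +oo[ =
    \bigcup_n \bigcup_q (if good n q then B n q else set0).
  apply/seteqP; split => [x /=|x [n _ [q _]]]; last first.
    case: ifP => // /asboolP g Bx.
    by rewrite /= in_itv/= andbT; exact: g.
  rewrite in_itv/= andbT => afx.
  have [dl dl0 H] := cf x (f x - a) ltac:(by rewrite subr_gt0).
  pose q := Num.truncn (2 / dl).
  have q1 : q.+1%:R^-1 < dl / 2.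
    by rewrite -[ltRHS]invrK ltf_pV2 ?posrE ?invr_gt0 ?divr_gt0// invf_div truncnS_gt.
  have [n Hn] := dense x (q.+1%:R^-1) ltac:(by rewrite invr_gt0).
  exists n => //; exists q => //.
  suff -> : good n q by [].
  apply/asboolP => y; rewrite /B/= => By.
  have : rho x y < dl.
    apply: le_lt_trans (tri _ (c n) _) _; rewrite rhoC (splitr dl).
    by apply: ltrD; exact: lt_trans q1.
  by move=> /H; rewrite ltr_distlC => /andP[+ _]; rewrite opprB addrC subrK.
apply: bigcupT_measurable => n; apply: bigcupT_measurable => q.
case: ifP => // _; rewrite /B.
rewrite (_ : [set _ | _] = rho (c n) @^-1` `]-oo, q.+1%:R^-1[%classic).
  by rewrite -[X in measurable X]setTI; apply: mrho.
by apply/seteqP; split => x /=; rewrite in_itv.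
Qed.

(** A witness in [Type], so that one rational can be chosen for each coordinate inside a tuple. *)
Lemma rat_approx (R : realType) (x e : R) : 0 < e ->
  {q : rat | `|ratr q - x| < e}.
Proof.
move=> e0; apply/cid; have [q] := @rat_in_itvoo R (x - e) (x + e) ltac:(lra).
by rewrite in_itv/= -ltr_distl => ?; exists q.
Qed.

(** The sigma-algebra on tuples is a product one; continuity reaches it through the separability of
    the summed distance [rho], with the rational points as a countable dense set. *)
Lemma continuous_Rdk_measurable (R : realType) d k
    (f : k.-tuple (d.-tuple R) -> R) :
  continuous_Rdk f -> measurable_fun setT f.
Proof.
move=> cf.
pose rho (x y : k.-tuple (d.-tuple R)) := \sum_(i < k) edist (tnth x i) (tnth y i).
pose emb (q : k.-tuple (d.-tuple rat)) : k.-tuple (d.-tuple R) :=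
  map_tuple (map_tuple ratr) q.
pose c n := emb (odflt [tuple of nseq k [tuple of nseq d 0]] (unpickle n)).
apply: (@metric_continuous_measurable _ _ _ rho c).
- move=> a; apply: measurable_sum => i; apply: measurable_edist => //.
  exact: measurable_tnth.
- by move=> x y; apply: eq_bigr => i _; exact: edistC.
- by move=> x y z; rewrite -big_split/=; apply: ler_sum => i _; exact: edist_triangle.
- move=> x e e0.
  (* [k * d] coordinates are each off by at most [e']; the successor covers [k * d = 0] and makes
     the total strictly less than [e]. *)
  pose e' := e / (k * d).+1%:R.
  have e'0 : 0 < e' by rewrite divr_gt0.
  pose q := [tuple [tuple sval (rat_approx (tnth (tnth x i) j) e'0) | j < d] | i < k].
  exists (pickle q); rewrite /c pickleK/=.
  apply: (@le_lt_trans _ _ ((k * d)%:R * e')).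
    rewrite /rho natrM -mulrA mulr_natl -[X in _ *+ X]card_ord -sumr_const.
    apply: ler_sum => i _; apply: le_trans (edist_le_sum _ _) _.
    rewrite mulr_natl -[X in _ *+ X]card_ord -sumr_const.
    apply: ler_sum => j _; rewrite !tnth_map !tnth_ord_tuple ltW//.
    by case: rat_approx.
  by rewrite /e' mulrCA gtr_pMr// ltr_pdivrMr// mul1r ltr_nat.
- move=> x e e0; have [dl dl0 H] := cf x e e0; exists dl => // y xy.
  apply: H => i; apply: le_lt_trans xy; rewrite /rho (bigD1 i)//= lerDl.
  by apply: sumr_ge0 => j _; exact: edist_ge0.
Qed.

Lemma continuous_Rd_measurable (R : realType) d (f : d.-tuple R -> R) :
  continuous_Rd f -> measurable_fun setT f.
Proof.
move=> cf.
have mf1 : measurable_fun setT (fun v : 1.-tuple (d.-tuple R) => f (thead v)).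
  apply: continuous_Rdk_measurable => x e e0.
  have [dl dl0 H] := cf (thead x) e e0; exists dl => // y xy.
  by apply: H; exact: xy.
rewrite (_ : f = (fun v : 1.-tuple (d.-tuple R) => f (thead v)) \o
                 (fun x => cons_tuple x [tuple])).
  apply: measurableT_comp => //; exact: measurable_cons_tuple.
by apply/funext.
Qed.

(** Heine's theorem: closed boxes are compact among row vectors, and the covering form of
    compactness gives one radius. Only [x] is confined to a bounded set; [y] just has to be close to
    it. *)
Lemma continuous_Rd_unif (R : realType) d (f : d.-tuple R -> R) (B e : R) :
  continuous_Rd f -> 0 < e ->
  exists2 dl : R, 0 < dl & forall x y, enorm x <= B -> edist x y < dl ->
    `|f x - f y| < e.
Proof.
move=> cf e0.
pose tup (v : 'rV[R]_d) := [tuple v ord0 i | i < d].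
have cK : compact [set v : 'rV[R]_d | forall i, `[- B, B]%classic (v ord0 i)].
  by apply: (@rV_compact _ _ (fun=> `[- B, B]%classic)) => i; exact: segment_compact.
have /compact_near_coveringP/(_ R (0^'+)
    (fun dl v => forall y, edist (tup v) y < dl -> `|f (tup v) - f y| < e)) := cK.
case.
- move=> v _; have [dl dl0 H] := cf (tup v) (e / 2) ltac:(lra).
  have near0 : \forall v' \near v & r \near 0^'+, edist (tup v) (tup v') < dl / 2 /\ r < dl / 2.
    exists (ball v (dl / 2 / d.+1%:R), [set r | r < dl / 2]).
      split => /=; first by apply: nbhsx_ballx; rewrite !divr_gt0.
      by apply: nbhs_right_lt; lra.
    move=> [v' r]/= [vv' rdl]; split => //.
    apply: le_lt_trans (edist_le_sum _ _) _.
    apply: (@le_lt_trans _ _ (\sum_(i < d) dl / 2 / d.+1%:R)).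
      apply: ler_sum => i _; rewrite !tnth_mktuple ltW//.
      by case: vv' => _; apply.
    rewrite sumr_const card_ord -[ltLHS]mulr_natr mulrAC ltr_pdivrMr//.
    by rewrite ltr_pM2l ?divr_gt0// ltr_nat.
  apply: filterS near0 => -[v' r]/= [vv' rd] y v'y.
  have h1 := H _ (lt_trans vv' (ltac:(lra) : dl / 2 < dl)).
  have h2 : `|f (tup v) - f y| < e / 2.
    by apply: H; apply: le_lt_trans (edist_triangle (tup v') _ _) _; lra.
  have := ler_distD (f (tup v)) (f (tup v')) (f y).
  by rewrite (distrC (f (tup v')) (f (tup v))); lra.
- move=> r0 /= r0P H.
  exists (r0 / 2); first by rewrite divr_gt0.
  move=> x y xB xy.
  pose v : 'rV[R]_d := \row_i tnth x i.
  have vx : tup v = x by apply: eq_from_tnth => i; rewrite tnth_mktuple mxE.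
  rewrite -vx; apply: (H (r0 / 2)) => /=.
  - by rewrite sub0r normrN gtr0_norm ?divr_gt0//; lra.
  - by rewrite divr_gt0.
  - move=> i; rewrite /= in_itv/= mxE -ler_norml; apply: le_trans xB.
    rewrite enormE; apply: le_trans (coord_le_edist _ _ i).
    by rewrite (tnth_nth 0 [tuple of nseq d 0])/= nth_nseq if_same subr0.
  - by rewrite vx.
Qed.

(** * Growth of the potential *)

Lemma powR_eventually_ge (R : realType) (a K : R) : 0 < a ->
  exists2 r1 : R, 1 <= r1 & forall r, r1 <= r -> K <= r `^ a.
Proof.
move=> a0; exists (Num.max 1 (`|K| `^ a^-1)) => [|r]; first by rewrite le_max lexx.
rewrite ge_max => /andP[r1 Kr].
have r0 : 0 <= r by exact: le_trans r1.
apply: (le_trans (ler_norm K)).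
have -> : `|K| = (`|K| `^ a^-1) `^ a.
  by rewrite -powRrM mulVf ?gt_eqF// powRr1.
by apply: ge0_ler_powR; rewrite ?nnegrE ?powR_ge0// ltW.
Qed.

Section growth.
Context (R : realType) (d : nat) (Q : d.-tuple R -> R) (alpha gamma eps : R).
Hypothesis Q0 : forall x, 0 <= Q x.
Hypothesis cQ : continuous_Rd Q.
Hypothesis alpha0 : 0 < alpha.
Hypothesis gamma0 : 0 < gamma.
Hypothesis eps0 : 0 < eps.
Hypothesis growQ : growth_condition Q alpha gamma eps.

(** The error term is at most [gamma * e] times |x|^alpha as soon as |x|^eps exceeds |C| / (gamma
    e). *)
Lemma growth_asymp (e : R) : 0 < e ->
  exists2 r1 : R, 1 <= r1 & forall x, r1 <= enorm x ->
    gamma * (1 - e) * enorm x `^ alpha <= Q x <= gamma * (1 + e) * enorm x `^ alpha.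
Proof.
move=> e0; have [C [M H]] := growQ.
have [r1 r11 Hr] := powR_eventually_ge (`|C| / (gamma * e)) eps0.
exists (Num.max r1 M) => [|x]; first by rewrite le_max r11.
rewrite ge_max => /andP[r1x Mx].
have x1 : 1 <= enorm x by exact: le_trans r1x.
have x0 : 0 < enorm x by exact: lt_le_trans x1.
have := H x Mx; rewrite powRB; last by rewrite (gt_eqF x0) implybT.
have p0 : 0 < enorm x `^ alpha by exact: powR_gt0.
have q0 : 0 < enorm x `^ eps by exact: powR_gt0.
move=> le1.
have : `|Q x - gamma * enorm x `^ alpha| <= gamma * e * enorm x `^ alpha.
  apply: le_trans le1 _.
  apply: (@le_trans _ _ (`|C| * (enorm x `^ alpha / enorm x `^ eps))).
    by rewrite ler_wpM2r ?ler_norm// divr_ge0 ?ltW.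
  rewrite mulrA mulrAC ler_wpM2r ?(ltW p0)// ler_pdivrMr//.
  by have := Hr _ r1x; rewrite ler_pdivrMr ?mulr_gt0// mulrC.
by rewrite ler_distl => /andP[h1 h2]; apply/andP; split; lra.
Qed.

(** The logarithm is beaten by any small multiple of [Q]. The case th = 1/4 bounds the kernel from
    below, and th = 1/N makes exp(-Q) integrable. *)
Lemma ln_enorm_le (th : R) : 0 < th ->
  exists2 C : R, 0 <= C & forall x, ln (1 + enorm x) <= th * Q x + C.
Proof.
move=> th0.
have [r1 r11 H] := @growth_asymp 2^-1 ltac:(lra).
(* The sublinear bound on [ln] is applied to [th'] times |x|^alpha; [gamma / 2] is the lower growth
   constant of [Q] beyond [r1]. *)
pose th' := alpha * th * (gamma / 2).
have th'0 : 0 < th' by rewrite /th' !mulr_gt0// invr_gt0.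
pose C := ln (1 + r1) + ln 2 + alpha^-1 * `|ln th'|.
have C1 : 0 <= ln (1 + r1) by apply: ln_ge0; lra.
have C2 : 0 <= ln (2 : R) by apply: ln_ge0; lra.
have C3 : 0 <= alpha^-1 * `|ln th'| by rewrite mulr_ge0 ?invr_ge0 ?(ltW alpha0).
exists C; first by rewrite /C !addr_ge0.
move=> x; have [xr|rx] := ltP (enorm x) r1.
  apply: (@le_trans _ _ (ln (1 + r1))).
    by rewrite ler_ln ?posrE; have := enorm_ge0 x; lra.
  by have := mulr_ge0 (ltW th0) (Q0 x); rewrite /C; lra.
have x1 : 1 <= enorm x by exact: le_trans rx.
have x0 : 0 < enorm x by exact: lt_le_trans x1.
have p0 : 0 < enorm x `^ alpha by exact: powR_gt0.
apply: (@le_trans _ _ (ln 2 + ln (enorm x))).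
  rewrite -lnM ?posrE// ler_ln ?posrE; lra.
have lnx : ln (enorm x) = alpha^-1 * ln (enorm x `^ alpha).
  by rewrite ln_powR mulrA mulVf ?gt_eqF// mul1r.
have := ln_sublinear (mulr_gt0 th'0 p0); rewrite lnM ?posrE// => le1.
have := H x rx => /andP[le2 _].
have le3 : th' * enorm x `^ alpha <= alpha * (th * Q x).
  have -> : th' * enorm x `^ alpha = alpha * (th * (gamma * (1 - 2^-1) * enorm x `^ alpha)).
    by rewrite /th'; field.
  by rewrite ler_pM2l// ler_pM2l.
have : ln (enorm x) <= th * Q x + alpha^-1 * `|ln th'|.
  rewrite lnx ler_pdivrMl// mulrDr (mulrA _ _^-1) mulfV ?gt_eqF// mul1r.
  by have := ler_norm (- ln th'); rewrite normrN; lra.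
by rewrite /C; lra.
Qed.

(** [Q] need not be uniformly continuous, so its variation at small distance is measured relative to
    [Q] itself. On a ball uniform continuity is enough; outside, |y| <= (1 + s) |x| and the power
    growth gives a factor close to one. *)
Lemma Q_shift (e : R) : 0 < e ->
  exists2 dl : R, 0 < dl & forall x y, edist x y <= dl -> Q y <= (1 + e) * Q x + e.
Proof.
wlog e1 : e / e <= 1.
  move=> H e0; have [/H/(_ e0)//|e1] := leP e 1.
  have [dl dl0 Hd] := H 1 (lexx _) ltr01; exists dl => // x y xy.
  have := Hd x y xy; have : (1 + 1) * Q x <= (1 + e) * Q x.
    by rewrite ler_wpM2r//; lra.
  lra.
(* With [e <= 1], this leaves room for (1 + a)^2 <= (1 + e)(1 - a). *)
move=> e0; pose a := e / 8.
have a0 : 0 < a by rewrite /a; lra.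
have [r1 r11 H] := growth_asymp a0.
pose s := (1 + a) `^ alpha^-1 - 1.
have s0 : 0 < s.
  have : 1 `^ alpha^-1 < (1 + a) `^ alpha^-1.
    by apply: gt0_ltr_powR; rewrite ?invr_gt0// ?nnegrE; lra.
  by rewrite powR1 /s subr_gt0.
(* Beyond [r1 + 1] the neighbour [y] is also in the asymptotic range; beyond 1/s a displacement of
   length one is at most [s] times |x|. *)
pose B := Num.max (r1 + 1) s^-1.
have [dl dl0 Hd] := continuous_Rd_unif B cQ e0.
exists (Num.min 1 (dl / 2)) => [|x y]; first by rewrite lt_min ltr01 divr_gt0.
rewrite le_min => /andP[xy1 xydl].
have [xB|Bx] := leP (enorm x) B.
  have := Hd x y xB ltac:(lra); rewrite ltr_distlC => /andP[_ h].
  have : 0 <= e * Q x by rewrite mulr_ge0// ltW.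
  lra.
have /andP[Bx1 Bx2] : (r1 + 1 <= enorm x) && (s^-1 <= enorm x).
  by rewrite -ge_max ltW.
have nyx : enorm y <= enorm x + 1 by have := enorm_le x y; lra.
have nxy : r1 <= enorm y by have := enorm_le y x; rewrite edistC; lra.
have /andP[_ Qy] := H y nxy.
have /andP[Qx _] := H x ltac:(lra).
have x0 : 0 < enorm x by lra.
have p0 : 0 < enorm x `^ alpha by exact: powR_gt0.
have pyx : enorm y `^ alpha <= (1 + a) * enorm x `^ alpha.
  apply: (@le_trans _ _ (((1 + s) * enorm x) `^ alpha)).
    apply: ge0_ler_powR; rewrite ?nnegrE ?enorm_ge0 ?(ltW alpha0)//.
      by rewrite mulr_ge0//; lra.
    have : 1 <= s * enorm x by rewrite -ler_pdivrMl// mulr1.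
    lra.
  rewrite powRM; [|lra|lra].
  rewrite ler_wpM2r// ?(ltW p0)// /s addrC subrK -powRrM mulVf ?gt_eqF// powRr1//; lra.
have P : gamma * (1 + a) * enorm y `^ alpha <= (1 + a) * (1 + a) * (gamma * enorm x `^ alpha).
  have -> : (1 + a) * (1 + a) * (gamma * enorm x `^ alpha) =
    gamma * (1 + a) * ((1 + a) * enorm x `^ alpha) by ring.
  by rewrite ler_wpM2l// mulr_ge0 ?ltW//; lra.
set g := gamma * enorm x `^ alpha in P.
have g0 : 0 < g by rewrite mulr_gt0.
have : (1 + a) * (1 + a) * g <= (1 + e) * ((1 - a) * g).
  rewrite [leRHS]mulrA ler_wpM2r ?(ltW g0)// /a; nra.
have : (1 + e) * ((1 - a) * g) <= (1 + e) * Q x.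
  rewrite ler_wpM2l; [by []|lra|]; apply: le_trans Qx; rewrite /g; lra.
lra.
Qed.

End growth.

(** * One-dimensional Lebesgue integrals *)

Section lebesgue_affine.
Context (R : realType).
Local Notation L := (@lebesgue_measure R).

Let affine (a b : R) : measurableTypeR R -> measurableTypeR R :=
  fun t => a * t + b.

Let measurable_affine a b : measurable_fun setT (affine a b).
Proof. by apply: measurable_funD => //; exact: measurable_funM. Qed.

Let affine_image a b := pushforward L (affine a b).

HB.instance Definition _ a b := Measure.copy (affine_image a b)
  (measure_function_pushforward__canonical__measure_function_Measure
    L (measurable_affine a b)).

(** The image of Lebesgue measure under the affine map, scaled by [a], agrees with it on half-open
    intervals, hence everywhere. *)
Lemma ge0_integral_affine (f : R -> \bar R) (a b : R) : 0 < a ->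
  measurable_fun setT f -> (forall t, 0 <= f t)%E ->
  (a%:E * \int[L]_t f (a * t + b)%R = \int[L]_t f t)%E.
Proof.
move=> a0 mf f0.
have E (u v : R) :
    (L `]u, v]%classic = a%:E * L `]((u - b) / a)%R, ((v - b) / a)%R]%classic)%E.
  rewrite !lebesgue_measure_itv/= !lte_fin ltr_pM2r ?invr_gt0// ltrD2r.
  case: ifP => _; last by rewrite mule0.
  by rewrite -!EFinD -EFinM; congr EFin; field; rewrite gt_eqF.
have muE A : measurable A -> L A = mscale (PosNum a0)%:num%:nng (affine_image a b) A.
  apply: lebesgue_measure_unique => _ [[u v]] _ <-.
  apply: etrans (E u v) _; congr (_ * L _)%E.
  apply/seteqP; split => t /=; rewrite /affine !in_itv/=;
    by rewrite ltr_pdivrMr// ler_pdivlMr// ltrBlDr lerBrDr mulrC.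
rewrite [RHS](eq_measure_integral (mscale (PosNum a0)%:num%:nng (affine_image a b))); last first.
  by move=> A mA _; exact: muE.
rewrite ge0_integral_mscale//; congr (_ * _)%E.
by rewrite ge0_integral_pushforward.
Qed.

Lemma integral_inv (a b : R) : 0 < a -> a <= b ->
  (\int[L]_(t in `[a, b]) (t^-1)%:E = (ln b - ln a)%:E)%E.
Proof.
move=> a0; rewrite le_eqVlt => /predU1P[<-|ab].
  by rewrite set_itv1 integral_set1 subrr.
rewrite (@continuous_FTC2 _ _ (@ln R))//.
- apply: continuous_in_subspaceT => x /[!inE]/= /itvP xab.
  by apply: inv_continuous; rewrite gt_eqF// (lt_le_trans a0)// xab.
- split.
  + move=> x /itvP xab; apply: ex_derive; apply: is_derive1_ln.
    by rewrite (lt_trans a0)// xab.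
  + by apply: cvg_at_right_filter; exact: continuous_ln.
  + by apply: cvg_at_left_filter; apply: continuous_ln; exact: lt_trans ab.
- move=> x /itvP xab; rewrite derive1E.
  by have [|_ ->] := @is_derive1_ln R x; first by rewrite (lt_trans a0)// xab.
Qed.

(** Positive part of log(1/|s|), with the value at 0 that keeps it above the kernel on the
    diagonal. *)
Definition pl (s : R) : \bar R :=
  if s == 0 then +oo%E else (Num.max 0 (- ln `|s|))%:E.

Lemma pl_ge0 s : (0 <= pl s)%E.
Proof. by rewrite /pl; case: ifP => // _; rewrite lee_fin le_max lexx. Qed.

Lemma measurable_pl : measurable_fun setT pl.
Proof.
apply: measurable_fun_ifT => //.
- exact: measurable_fun_eqr.
- apply/measurable_EFinP; apply: measurable_maxr => //.
  by apply: measurableT_comp => //; apply: measurableT_comp.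
Qed.

(** Layer-cake density: for nonzero [s], [pl s] is the integral of 1/t over |s| <= t <= 1. *)
Let layer (p : R * R) : \bar R :=
  (if `|p.1| <= p.2 <= 1 then p.2^-1 else 0)%:E.

Let layer_ge0 p : (0 <= layer p)%E.
Proof.
rewrite lee_fin; case: ifP => // /andP[h _]; rewrite invr_ge0.
exact: le_trans h.
Qed.

Let measurable_layer : measurable_fun setT layer.
Proof.
rewrite (_ : layer = fun p => (if `|p.1| <= p.2 <= 1 then p.2 `^ (-1) else 0)%:E); last first.
  apply/funext => p; rewrite /layer; case: ifP => // /andP[h _].
  by rewrite powR_inv1// (le_trans _ h).
apply/measurable_EFinP; apply: measurable_fun_ifT => //.
- apply: measurable_and.
    by apply: measurable_fun_ler => //; exact: measurableT_comp.
  exact: measurable_fun_ler.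
- apply: (@measurableT_comp _ _ _ _ _ _ (fun x : R => x `^ (-1)) _ snd) => //.
Qed.

Let layerE s : s != 0 -> (\int[L]_t layer (s, t) = (Num.max 0 (- ln `|s|))%:E)%E.
Proof.
move=> s0; have s1 : 0 < `|s| by rewrite normr_gt0.
transitivity (\int[L]_(t in `[`|s|%R, 1%R]) (t^-1)%:E)%E.
  rewrite [RHS]integral_mkcond; apply: eq_integral => t _.
  by rewrite patchE /layer/= mem_setE in_itv/=; case: ifP.
have [s_le1|s_gt1] := leP `|s| 1.
  rewrite integral_inv// ln1 sub0r max_r// oppr_ge0; exact: ln_le0.
rewrite set_itv_ge ?bnd_simp -?ltNge// integral_set0 max_l//.
by rewrite oppr_le0 ln_ge0// ltW.
Qed.

(** After Tonelli, the layer at height [t] in (0, 1] has length 2t and weight 1/t. *)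
Lemma integral_pl : (\int[L]_s pl s <= 2%:E)%E.
Proof.
have plE s : (pl s <= \int[L]_t layer (s, t))%E.
  (* At [s = 0] the layers must have infinite integral: they dominate those at exp(-A), whose
     integral is [A], for arbitrarily large [A]. *)
  rewrite /pl; case: ifPn => [/eqP ->|s0]; last by rewrite layerE.
  rewrite leye_eq; apply/eqP/eqyP => A A0.
  have e0 : 0 < expR (- A) by exact: expR_gt0.
  apply: (@le_trans _ _ (\int[L]_t layer (expR (- A), t))%E).
    rewrite layerE ?gt_eqF// gtr0_norm// expRK opprK lee_fin.
    by rewrite le_max lexx orbT.
  apply: ge0_le_integral => //.
  - exact: (measurableT_comp measurable_layer (pair1_measurable _)).
  - exact: (measurableT_comp measurable_layer (pair1_measurable _)).
  - move=> t _; rewrite lee_fin /= normr0.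
    case: ifP => [/andP[h1 h2]|_].
      have h3 : 0 <= t by exact: le_trans h1.
      by rewrite h3 h2.
    by case: ifP => // /andP[h _]; rewrite invr_ge0.
apply: (@le_trans _ _ (\int[L]_s \int[L]_t layer (s, t))%E).
  apply: ge0_le_integral => //.
  - by move=> s _; exact: pl_ge0.
  - exact: measurable_pl.
  - exact: (@measurable_fun_fubini_tonelli_F _ _ (measurableTypeR R) (measurableTypeR R) R L layer).
rewrite (@fubini_tonelli _ _ (measurableTypeR R) (measurableTypeR R) R L L layer)//.
apply: (@le_trans _ _ (\int[L]_(t in `[0%R, 1%R]) 2%:E)%E); last first.
  by rewrite integral_cst//= lebesgue_measure_itv/= lte01 oppr0 adde0 mule1.
rewrite [leRHS]integral_mkcond; apply: ge0_le_integral => //.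
- by move=> t _; exact: integral_ge0.
- exact: (@measurable_fun_fubini_tonelli_G _ _ (measurableTypeR R) (measurableTypeR R) R L layer).
- by apply/measurable_restrict => //; apply: measurable_funTS.
move=> t _; rewrite patchE mem_setE in_itv/=.
have [/andP[t0 t1]|t01] := boolP (0 <= t <= 1); last first.
  rewrite integral0_eq// => s _; rewrite /layer/=; case: ifP => // /andP[h1 h2].
  by move: t01; rewrite h2 (le_trans _ h1).
apply: (@le_trans _ _ (\int[L]_(s in `[(- t)%R, t]) (t^-1)%:E)%E).
  rewrite [leRHS]integral_mkcond; apply: ge0_le_integral => //.
  - exact: (measurableT_comp measurable_layer (pair2_measurable _)).
  - by apply/measurable_restrict => //; exact: measurable_funTS.
  - move=> s _; rewrite patchE mem_setE in_itv/= -ler_norml /layer/= t1 andbT.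
    by case: ifP.
rewrite integral_cst//= lebesgue_measure_itv/= lte_fin.
case: ifPn => [tt|_]; last by rewrite mule0.
have tp : 0 < t by lra.
by rewrite -EFinD -EFinM lee_fin opprK mulrDr mulVf ?gt_eqF.
Qed.

End lebesgue_affine.

(** * Smearing the kernel *)

Section canonical_display.
Context (R : realType) (m : {sigma_finite_measure set (measurableTypeR R) -> \bar R}).

Let toR : measurableTypeR R -> R := id.

Let measurable_toR : measurable_fun setT toR.
Proof. by move=> _ Y mY; rewrite setTI. Qed.

(* [measurableTypeR R] and the canonical structure on [R] have the same
   measurable sets but different displays. *)
Definition onR : set R -> \bar R := pushforward m toR.

HB.instance Definition _ := Measure.copy onR
  (measure_function_pushforward__canonical__measure_function_Measure
    m measurable_toR).

Let onR_sigma_finite : sigma_finite setT onR.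
Proof. by have [F FT mF] := sigma_finiteT m; exists F. Qed.

HB.instance Definition _ := Measure_isSigmaFinite.Build _ _ _ onR
  onR_sigma_finite.

Lemma ge0_integral_onR (f : R -> \bar R) : measurable_fun setT f ->
  (forall t, 0 <= f t)%E -> (\int[onR]_t f t = \int[m]_t f t)%E.
Proof. by move=> mf f0; rewrite /onR ge0_integral_pushforward. Qed.

Lemma integral_onR (f : R -> \bar R) : measurable_fun setT f ->
  (\int[m]_t `|f t| < +oo)%E -> (\int[onR]_t f t = \int[m]_t f t)%E.
Proof.
move=> mf foo; rewrite /onR integral_pushforward//.
by apply/integrableP.
Qed.

End canonical_display.

Definition Leb1 (R : realType) : {sigma_finite_measure set R -> \bar R} :=
  onR (@lebesgue_measure R).

Definition Unif1 (R : realType) : {sigma_finite_measure set R -> \bar R} :=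
  onR (uniform_prob (@ltr01 R)).

Notation Lebd R d := (tpm (@Leb1 R) d).
Notation Unifd R d := (tpm (@Unif1 R) d).

Lemma ge0_integral_tnth (dT : measure_display) (T : measurableType dT)
    (R : realType) (m : {sigma_finite_measure set T -> \bar R}) n (i : 'I_n)
    (g : T -> \bar R) : m setT = 1%E ->
  measurable_fun setT g -> (forall t, 0 <= g t)%E ->
  (\int[tpm m n]_v g (tnth v i) = \int[m]_t g t)%E.
Proof.
move=> m1 mg g0.
pose f k t := if k == i :> nat then g t else 1%E.
transitivity (\int[tpm m n]_v \prod_(k < n) f k (tnth v k))%E.
  apply: eq_integral => v _; rewrite (bigD1 i)//= /f eqxx big1 ?mule1// => k ki.
  by case: eqP => // /val_inj ki'; rewrite ki' eqxx in ki.
rewrite (ge0_integral_prod m n (f := f)); last 2 first.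
- by move=> k; rewrite /f; case: (k == i :> nat).
- by move=> k t; rewrite /f; case: (k == i :> nat).
rewrite (bigD1 i)//= big1 ?mule1; first by rewrite /f eqxx.
move=> k ki; rewrite -[RHS]mul1e -m1 -integral_cst//; apply: eq_integral => t _.
by rewrite /f; case: eqP => // /val_inj ki'; rewrite ki' eqxx in ki.
Qed.

Section noise.
Context (R : realType).

(* Clamping makes the noise bounded everywhere, not just almost surely. *)
Definition clamp (u : R) : R := Num.min 1 (Num.max 0 u).

Lemma clamp_itv u : 0 <= clamp u <= 1.
Proof. by rewrite /clamp le_min ge_min le_max !lexx ler01. Qed.

Lemma clamp_id u : 0 <= u <= 1 -> clamp u = u.
Proof. by case/andP => u0 u1; rewrite /clamp max_r// min_r. Qed.

Lemma measurable_clamp : measurable_fun setT clamp.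
Proof. by apply: measurable_minr => //; exact: measurable_maxr. Qed.

Lemma Unif1_setT : Unif1 R setT = 1%E.
Proof. exact: probability_setT. Qed.

(** For [u] uniform on [0, 1], [x + dl * u] has density 1/dl on an interval, and clamping changes
    nothing on [0, 1]. *)
Lemma noise1_dom (f : R -> \bar R) (x dl : R) : 0 < dl ->
  measurable_fun setT f -> (forall t, 0 <= f t)%E ->
  (dl%:E * \int[Unif1 R]_u f (x + dl * clamp u)%R <= \int[Leb1 R]_t f t)%E.
Proof.
move=> dl0 mf f0.
have mg : measurable_fun setT (fun u => f (x + dl * clamp u)).
  apply: measurableT_comp => //; apply: measurable_funD => //.
  by apply: measurable_funM => //; exact: measurable_clamp.
have mh : measurable_fun setT (fun u => f (dl * u + x)).
  by apply: measurableT_comp => //; apply: measurable_funD => //; exact: measurable_funM.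
rewrite ge0_integral_onR// integral_uniform// subr0 invr1 mul1e.
rewrite ge0_integral_onR// -(ge0_integral_affine x dl0 mf f0).
apply: lee_wpmul2l; first by rewrite lee_fin ltW.
apply: (@le_trans _ _
    (\int[lebesgue_measure]_(u in `[0%R, 1%R]) f (dl * u + x)%R)%E).
  rewrite le_eqVlt; apply/orP; left; apply/eqP; apply: eq_integral => u.
  by rewrite inE/= in_itv/= => u01; rewrite clamp_id// addrC.
exact: ge0_subset_integral.
Qed.

Lemma noise1_pl (a : R) : (\int[Unif1 R]_u pl (a + clamp u)%R <= 2%:E)%E.
Proof.
apply: le_trans (integral_pl R).
rewrite -ge0_integral_onR; [|exact: measurable_pl|exact: pl_ge0].
have := @noise1_dom (@pl R) a 1 ltr01 (@measurable_pl R) (@pl_ge0 R).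
by rewrite mul1e; under eq_integral => u _ do rewrite mul1r.
Qed.

(** A point displaced inside a cube of side [dl] having [x] as its lowest corner. *)
Definition shift d (dl : R) (x u : d.-tuple R) : d.-tuple R :=
  [tuple tnth x i + dl * clamp (tnth u i) | i < d].

Lemma tnth_shift d dl (x u : d.-tuple R) i :
  tnth (shift dl x u) i = tnth x i + dl * clamp (tnth u i).
Proof. by rewrite tnth_mktuple. Qed.

Lemma shift_cons d dl x0 (x : d.-tuple R) u0 u :
  shift dl (cons_tuple x0 x) (cons_tuple u0 u) =
  cons_tuple (x0 + dl * clamp u0) (shift dl x u).
Proof.
apply: eq_from_tnth => i; rewrite tnth_shift.
by case: (unliftP ord0 i) => [j|] ->; rewrite ?tnth0// !tnthS tnth_shift.
Qed.

Lemma measurable_shift d dl (dS : measure_display) (S : measurableType dS)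
    (f g : S -> d.-tuple R) : measurable_fun setT f -> measurable_fun setT g ->
  measurable_fun setT (fun s => shift dl (f s) (g s)).
Proof.
move=> mf mg; apply/measurable_fun_tnthP => i.
rewrite (_ : _ \o _ = fun s => tnth (f s) i + dl * clamp (tnth (g s) i)); last first.
  by apply/funext => s /=; rewrite tnth_shift.
apply: measurable_funD.
  exact: (measurableT_comp (measurable_tnth i) mf).
apply: measurable_funM => //; apply: (measurableT_comp measurable_clamp).
exact: (measurableT_comp (measurable_tnth i) mg).
Qed.

Lemma edist_shift d (dl : R) (x u : d.-tuple R) : 0 <= dl ->
  edist x (shift dl x u) <= d%:R * dl.
Proof.
move=> dl0; apply: le_trans (edist_le_sum _ _) _.
rewrite mulr_natl -[X in _ *+ X]card_ord -sumr_const; apply: ler_sum => i _.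
rewrite tnth_shift opprD addNKr normrN.
have /andP[c0 c1] := clamp_itv (tnth u i).
by rewrite ger0_norm ?mulr_ge0// ler_piMr.
Qed.

Lemma noise_dom d (f : d.-tuple R -> \bar R) (x : d.-tuple R) (dl : R) : 0 < dl ->
  measurable_fun setT f -> (forall t, 0 <= f t)%E ->
  ((dl ^+ d)%:E * \int[Unifd R d]_u f (shift dl x u) <= \int[Lebd R d]_t f t)%E.
Proof.
move=> dl0; elim: d f x => [|d IH] f x mf f0.
  rewrite expr0 mul1e !tpm0E//; last exact: (measurableT_comp mf (measurable_shift _ _ _)).
  by rewrite tuple0.
case/tupleP: x => x0 x.
have mfs d' (y : d'.-tuple R) (g : d'.-tuple R -> \bar R) : measurable_fun setT g ->
    measurable_fun setT (fun u => g (shift dl y u)).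
  by move=> mg; apply: (measurableT_comp mg); exact: measurable_shift.
rewrite [X in (_ * X)%E](_ : _ = \int[Unif1 R]_u0 \int[Unifd R d]_u
    f (cons_tuple (x0 + dl * clamp u0)%R (shift dl x u)))%E; last first.
  rewrite ge0_tpmSE//; last exact: mfs.
  apply: eq_integral => u0 _; apply: eq_integral => u _.
  by rewrite -shift_cons; congr f; congr shift; exact/val_inj.
have mint : measurable_fun setT (fun t => \int[Unifd R d]_u f (cons_tuple t (shift dl x u)))%E.
  apply: (measurable_fun_fubini_tonelli_F (fun p => f (cons_tuple p.1 (shift dl x p.2)))) => //.
  apply: (measurableT_comp mf); apply: measurable_cons_tuple => //.
  exact: measurable_shift.
have maff : measurable_fun setT (fun u => x0 + dl * clamp u).
  apply: measurable_funD => //.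
  by apply: measurable_funM => //; exact: measurable_clamp.
rewrite exprS EFinM -muleA -ge0_integralZl//; last 3 first.
- exact: (measurableT_comp mint maff).
- by move=> u0 _; exact: integral_ge0.
- by rewrite lee_fin exprn_ge0// ltW.
rewrite [leRHS]ge0_tpmSE//.
have m1 := measurable_int_section (@Leb1 R) mf f0.
apply: le_trans (@noise1_dom (fun t => \int[Lebd R d]_v f (cons_tuple t v))%E x0 dl dl0 m1 _); last first.
  by move=> t; exact: integral_ge0.
apply: lee_wpmul2l; first by rewrite lee_fin ltW.
apply: ge0_le_integral => //.
- by move=> u0 _; rewrite mule_ge0 ?lee_fin ?exprn_ge0 ?(ltW dl0)// integral_ge0.
- apply: measurable_funeM.
  exact: (measurableT_comp mint maff).
- exact: (measurableT_comp m1 maff).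
- move=> u0 _; apply: IH => //; exact: measurable_cons_section.
Qed.

End noise.

Section kernel.
Context (R : realType) (d : nat) (Q : d.-tuple R -> R) (C0 : R).

Definition KK (x y : d.-tuple R) : \bar R := (energy_kernel Q x y + C0%:E)%E.

Lemma KKxx x : KK x x = +oo%E. Proof. by rewrite /KK /energy_kernel eqxx. Qed.

Lemma KKE x y : x != y ->
  KK x y = (- ln (edist x y) + Q x / 2 + Q y / 2 + C0)%:E.
Proof.
by move=> xy; rewrite /KK /energy_kernel (negbTE xy) lnV ?posrE ?edist_gt0.
Qed.

Hypothesis Q0 : forall x, 0 <= Q x.
Hypothesis cQ : continuous_Rd Q.
Hypothesis C00 : 0 <= C0.
(** Asking for (Q x + Q y) / 4, and not just for positivity, lets a finite energy control the
    integral of [Q]. *)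
Hypothesis KQ : forall x y, x != y ->
  (Q x + Q y) / 4 <= - ln (edist x y) + Q x / 2 + Q y / 2 + C0.
Hypothesis QS : forall e, 0 < e ->
  exists2 dl : R, 0 < dl & forall x y, edist x y <= dl -> Q y <= (1 + e) * Q x + e.

Lemma KK_ge x y : (((Q x + Q y) / 4)%:E <= KK x y)%E.
Proof.
have [->|xy] := eqVneq x y; first by rewrite KKxx leey.
by rewrite KKE// lee_fin KQ.
Qed.

Lemma KK_ge0 x y : (0 <= KK x y)%E.
Proof. by apply: le_trans (KK_ge _ _); rewrite lee_fin divr_ge0// addr_ge0. Qed.

Lemma KKC x y : KK x y = KK y x.
Proof.
have [->//|xy] := eqVneq x y.
by rewrite !KKE ?(eq_sym y)// edistC; congr EFin; ring.
Qed.

Lemma measurable_Q : measurable_fun setT Q.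
Proof. exact: continuous_Rd_measurable. Qed.

Lemma measurable_KK (dS : measure_display) (S : measurableType dS)
    (f g : S -> d.-tuple R) : measurable_fun setT f -> measurable_fun setT g ->
  measurable_fun setT (fun s => KK (f s) (g s)).
Proof.
move=> mf mg.
have me := measurable_edist mf mg.
rewrite (_ : (fun s => _) = fun s => if edist (f s) (g s) == 0 then +oo%E
  else (- ln (edist (f s) (g s)) + Q (f s) / 2 + Q (g s) / 2 + C0)%:E); last first.
  apply/funext => s; rewrite edist_eq0.
  by have [->|xy] := eqVneq (f s) (g s); [rewrite KKxx|rewrite KKE].
apply: measurable_fun_ifT => //; first exact: measurable_fun_eqr.
apply/measurable_EFinP.
have mQf : measurable_fun setT (fun s => Q (f s)) by exact: (measurableT_comp measurable_Q).
have mQg : measurable_fun setT (fun s => Q (g s)) by exact: (measurableT_comp measurable_Q).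
apply: measurable_funD => //; apply: measurable_funD; last exact: measurable_funM.
apply: measurable_funD; last exact: measurable_funM.
by apply: measurableT_comp => //; apply: measurableT_comp.
Qed.

Hypothesis d0 : (0 < d)%N.

(** The Euclidean distance is at least the distance in one coordinate, which reduces the singularity
    to the one-dimensional [pl]; rescaling by [dl] produces the term [- ln dl]. *)
Lemma KK_le_pl (i : 'I_d) (dl : R) (z y : d.-tuple R) : 0 < dl ->
  (KK z y <= pl ((tnth z i - tnth y i) / dl)%R + (- ln dl + Q z / 2 + Q y / 2 + C0)%:E)%E.
Proof.
move=> dl0; rewrite /pl mulf_eq0 invr_eq0 (gt_eqF dl0) orbF.
case: ifPn => [_|zy]; first by rewrite addye// leey.
have zy' : z != y by apply: contraNneq zy => ->; rewrite subrr.
rewrite KKE// -EFinD lee_fin.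
have n0 : 0 < `|tnth z i - tnth y i| by rewrite normr_gt0.
have le1 : ln `|tnth z i - tnth y i| <= ln (edist z y).
  by rewrite ler_ln ?posrE ?edist_gt0// coord_le_edist.
have le2 : - ln `|(tnth z i - tnth y i) / dl| <=
    Num.max 0 (- ln `|(tnth z i - tnth y i) / dl|) by rewrite le_max lexx orbT.
move: le2; rewrite normrM normfV (gtr0_norm dl0) {1}ln_div ?posrE//.
by lra.
Qed.

Lemma measurable_noise_KK dl x y :
  measurable_fun setT (fun u => KK (shift dl x u) y).
Proof. by apply: measurable_KK => //; exact: measurable_shift. Qed.

(** Smearing one argument already removes the singularity, at the cost [2 - ln dl], where 2 bounds
    the integral of [pl]. *)
Lemma noise_KK_le (e dl : R) : 0 < e -> 0 < dl -> dl <= 1 ->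
  (forall x y, edist x y <= d%:R * dl -> Q y <= (1 + e) * Q x + e) ->
  forall x y, (\int[Unifd R d]_u KK (shift dl x u) y <=
    (2 - ln dl + ((1 + e) * Q x + e) / 2 + Q y / 2 + C0)%:E)%E.
Proof.
move=> e0 dl0 dl1 HQ x y.
pose i := Ordinal d0.
pose c := - ln dl + ((1 + e) * Q x + e) / 2 + Q y / 2 + C0.
have lndl : ln dl <= 0 by exact: ln_le0.
have c0 : 0 <= c.
  have := mulr_ge0 (ltW e0) (Q0 x); have := Q0 x; have := Q0 y; have := C00.
  by rewrite /c; lra.
have mpl : measurable_fun setT (fun u : R => pl ((tnth x i - tnth y i) / dl + clamp u)).
  apply: (measurableT_comp (@measurable_pl R)); apply: measurable_funD => //.
  exact: measurable_clamp.
have mplu : measurable_fun setT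
    (fun u : d.-tuple R => pl ((tnth x i - tnth y i) / dl + clamp (tnth u i))).
  exact: (measurableT_comp mpl (measurable_tnth i)).
apply: (@le_trans _ _ (\int[Unifd R d]_u
    (pl ((tnth x i - tnth y i) / dl + clamp (tnth u i))%R + c%:E))%E).
  apply: ge0_le_integral => //.
  - by move=> u _; exact: KK_ge0.
  - exact: measurable_noise_KK.
  - by apply: emeasurable_funD.
  move=> u _; apply: le_trans (KK_le_pl i _ _ dl0) _.
  have -> : (tnth (shift dl x u) i - tnth y i) / dl =
      (tnth x i - tnth y i) / dl + clamp (tnth u i).
    by rewrite tnth_shift; field; rewrite gt_eqF.
  apply: leeD => //; rewrite lee_fin /c.
  by have := HQ _ _ (edist_shift x u (ltW dl0)); lra.
rewrite ge0_integralD//; last by move=> u _; exact: pl_ge0.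
rewrite (ge0_integral_tnth (m := @Unif1 R) i (g := fun u => pl ((tnth x i - tnth y i) / dl + clamp u)))//; last 2 first.
- exact: Unif1_setT.
- by move=> t; exact: pl_ge0.
rewrite integral_cst// [X in (_ + _ * X)%E](_ : _ = 1%E); last first.
  exact: (tpm_setT (Unif1_setT R)).
rewrite mule1; apply: (@le_trans _ _ (2%:E + c%:E)%E).
  by apply: leeD => //; exact: noise1_pl.
by rewrite -EFinD lee_fin /c; lra.
Qed.

Lemma int_Unifd_cst (c : \bar R) : (\int[Unifd R d]_u c = c)%E.
Proof.
rewrite integral_cst// -[RHS]mule1; congr (_ * _)%E.
exact: (tpm_setT (Unif1_setT R)).
Qed.

Lemma measurable_noise_KK_int dl x y :
  measurable_fun setT (fun v => \int[Unifd R d]_u KK (shift dl x u) (shift dl y v))%E.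
Proof.
apply: (measurable_fun_fubini_tonelli_G (fun p => KK (shift dl x p.1) (shift dl y p.2))).
  by apply: measurable_KK; exact: measurable_shift.
by move=> p; exact: KK_ge0.
Qed.

Definition noise2K dl x y : \bar R := (\int[Unifd R d]_v \int[Unifd R d]_u KK (shift dl x u) (shift dl y v))%E.

Lemma noise2K_ge0 dl x y : (0 <= noise2K dl x y)%E.
Proof. by apply: integral_ge0 => v _; apply: integral_ge0 => u _; exact: KK_ge0. Qed.

Lemma measurable_noise2K dl :
  measurable_fun setT (fun p : d.-tuple R * d.-tuple R => noise2K dl p.1 p.2).
Proof.
apply: (measurable_fun_fubini_tonelli_F (fun q => \int[Unifd R d]_u
  KK (shift dl q.1.1 u) (shift dl q.1.2 q.2))%E); last first.
  by move=> p; apply: integral_ge0 => u _; exact: KK_ge0.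
apply: (measurable_fun_fubini_tonelli_F (fun q =>
  KK (shift dl q.1.1.1 q.2) (shift dl q.1.1.2 q.1.2))); last by move=> p; exact: KK_ge0.
have m11 := measurableT_comp (@measurable_fst _ _ (d.-tuple R * d.-tuple R)%type (d.-tuple R))
  (@measurable_fst _ _ ((d.-tuple R * d.-tuple R) * d.-tuple R)%type (d.-tuple R)).
apply: measurable_KK => //; apply: measurable_shift => //.
- exact: (measurableT_comp measurable_fst m11).
- exact: (measurableT_comp measurable_snd m11).
- exact: (measurableT_comp measurable_snd measurable_fst).
Qed.

Lemma noise2_KK_bounded (dl : R) (x y : d.-tuple R) (c : R) :
  (forall u v, KK (shift dl x u) (shift dl y v) <= c%:E)%E ->
  (noise2K dl x y <= c%:E)%E.
Proof.
move=> Kc; rewrite -[leRHS]int_Unifd_cst; apply: ge0_le_integral => //.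
- by move=> v _; apply: integral_ge0 => u _; exact: KK_ge0.
- exact: measurable_noise_KK_int.
move=> v _; rewrite -[leRHS]int_Unifd_cst; apply: ge0_le_integral => //.
- by move=> u _; exact: KK_ge0.
- exact: measurable_noise_KK.
Qed.

(* Of interest at [x = y], where the kernel itself may be [+oo]. *)
Lemma noise2_KK_le (e dl : R) : 0 < e -> 0 < dl -> dl <= 1 ->
  (forall x y, edist x y <= d%:R * dl -> Q y <= (1 + e) * Q x + e) ->
  forall x y,
  (noise2K dl x y <=
    (2 - ln dl + (1 + e) * (Q x + Q y) / 2 + e + C0)%:E)%E.
Proof.
move=> e0 dl0 dl1 HQ x y.
rewrite -[leRHS]int_Unifd_cst; apply: ge0_le_integral => //.
- by move=> v _; apply: integral_ge0 => u _; exact: KK_ge0.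
- exact: measurable_noise_KK_int.
move=> v _; apply: le_trans (noise_KK_le e0 dl0 dl1 HQ _ _) _; rewrite lee_fin.
by have := HQ _ _ (edist_shift y v (ltW dl0)); lra.
Qed.

(* Smearing at scale [dl] almost does not increase the kernel: at distance
   more than [r] it moves [ln] by little, below [r] it costs at most a constant,
   negligible with respect to [ln (1 / r)]. *)
Lemma noise2_KK (e : R) : 0 < e -> exists2 dl0 : R, 0 < dl0 <= 1 &
  (forall x y, edist x y <= d%:R * dl0 -> Q y <= (1 + e) * Q x + e) /\
  forall dl, 0 < dl <= dl0 -> forall x y,
  (noise2K dl x y <=
    (1 + e)%:E * KK x y + e%:E)%E.
Proof.
move=> e0; pose b := e / 4.
have b0 : 0 < b by rewrite /b; lra.
have dR : 1 <= d%:R :> R by rewrite ler1n.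
have dgt0 : 0 < d%:R :> R by lra.
(* [C2] covers both near cases: halving the distance costs [ln 2], and below distance 4 d dl the
   smeared kernel costs 2 - ln dl. *)
pose C2 := ln (4 * d%:R) + 2 : R.
have C2ge : ln 2 <= C2.
  have : ln (2 : R) <= ln (4 * d%:R) by rewrite ler_ln ?posrE; lra.
  by rewrite /C2; lra.
have C20 : 0 < C2 by have : 0 < ln (2 : R) by [apply: ln_gt0; lra]; lra.
(* Below distance [r], b ln(1 / r1) is at least [C2], so that constant is absorbed by the slack in
   the factor [1 + e]. *)
pose r := expR (- (C2 / b)).
have r0 : 0 < r by exact: expR_gt0.
have [dlQ dlQ0 HQ] := QS b0.
have eb1 : expR (- b) < 1 by rewrite expR_lt1; lra.
(* The last bound gives 2 d dl <= r (1 - exp(-b)): at distance at least [r], the noise shrinks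
   distances by no more than the factor exp(-b). *)
pose dl0 := Num.min 1 (Num.min (dlQ / d%:R) (r * (1 - expR (- b)) / (2 * d%:R))).
have dl00 : 0 < dl0.
  rewrite /dl0 !lt_min ltr01 !divr_gt0 ?mulr_gt0//; lra.
exists dl0; first by rewrite dl00 /dl0 ge_min lexx.
have dldQ : d%:R * dl0 <= dlQ.
  by rewrite mulrC -ler_pdivlMr// /dl0 !ge_min lexx orbT.
split.
  move=> x y xy; have := HQ x y (le_trans xy dldQ).
  have : (1 + b) * Q x <= (1 + e) * Q x by rewrite ler_wpM2r// /b; lra.
  by rewrite /b; lra.
move=> dl /andP[dlgt0 dlle] x y.
have dl1 : dl <= 1 by apply: le_trans dlle _; rewrite /dl0 ge_min lexx.
have ddl : d%:R * dl <= dlQ by apply: le_trans dldQ; rewrite ler_pM2l.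
have HQ' x' y' : edist x' y' <= d%:R * dl -> Q y' <= (1 + b) * Q x' + b.
  by move=> h; apply: HQ; exact: le_trans ddl.
have [->|xy] := eqVneq x y.
  by rewrite KKxx gt0_muley ?lte_fin ?addye ?leey//; lra.
set r1 := edist x y.
have r10 : 0 < r1 by rewrite edist_gt0.
have KQxy := KQ xy.
have Qx0 := Q0 x; have Qy0 := Q0 y.
rewrite KKE// -/r1 -EFinM -EFinD.
have K0 : 0 <= - ln r1 + Q x / 2 + Q y / 2 + C0 by move: KQxy; rewrite -/r1; lra.
have eb : e = 4 * b by rewrite /b; field.
have far u v : r1 - 2 * (d%:R * dl) <= edist (shift dl x u) (shift dl y v).
  have h1 := edist_triangle (shift dl x u) x y.
  have h2 := edist_triangle (shift dl y v) (shift dl x u) y.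
  have h3 := edist_shift x u (ltW dlgt0); have h4 := edist_shift y v (ltW dlgt0).
  by move: h1 h2; rewrite (edistC (shift dl y v) y) -/r1; lra.
have bnd lo : 0 < lo -> lo <= r1 - 2 * (d%:R * dl) -> forall u v,
    (KK (shift dl x u) (shift dl y v) <=
     (- ln lo + (1 + b) * (Q x + Q y) / 2 + b + C0)%:E)%E.
  move=> lo0 lor u v.
  have le1 := le_trans lor (far u v).
  have ne : shift dl x u != shift dl y v by rewrite -edist_gt0 (lt_le_trans lo0).
  rewrite KKE// lee_fin.
  have : ln lo <= ln (edist (shift dl x u) (shift dl y v)).
    by rewrite ler_ln ?posrE ?edist_gt0.
  have := HQ' _ _ (edist_shift x u (ltW dlgt0)).
  have := HQ' _ _ (edist_shift y v (ltW dlgt0)).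
  by lra.
have [rr1|r1r] := leP r r1.
  pose lo := r1 * expR (- b).
  have lo0 : 0 < lo by rewrite mulr_gt0// expR_gt0.
  have lnlo : ln lo = ln r1 - b by rewrite lnM ?posrE ?expR_gt0// expRK.
  apply: le_trans (noise2_KK_bounded (bnd lo lo0 _)) _.
    have : dl * (2 * d%:R) <= r * (1 - expR (- b)).
      rewrite -ler_pdivlMr ?mulr_gt0//; apply: le_trans dlle _.
      by rewrite /dl0 !ge_min lexx !orbT.
    have : r * (1 - expR (- b)) <= r1 * (1 - expR (- b)) by rewrite ler_wpM2r//; lra.
    by rewrite /lo; lra.
  rewrite lee_fin lnlo.
  have bK := ler_wpM2l (ltW b0) KQxy; rewrite -/r1 in bK.
  have bK0 := mulr_ge0 (ltW b0) K0.
  by rewrite eb; lra.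
have bln : C2 <= b * (- ln r1).
  have : ln r1 < ln r by rewrite ltr_ln ?posrE.
  rewrite /r expRK => /ltW/(ler_wpM2l (ltW b0)).
  by rewrite mulrN (_ : b * (C2 / b) = C2); [lra|field; rewrite gt_eqF].
have bK0 := mulr_ge0 (ltW b0) K0.
have bC0 := mulr_ge0 (ltW b0) C00; have C00' := C00.
have fin : - ln r1 + C2 + (1 + b) * (Q x + Q y) / 2 + b + C0 <=
    (1 + e) * (- ln r1 + Q x / 2 + Q y / 2 + C0) + e.
  by rewrite eb; lra.
(* Below [r], either the noise at most halves the distance, or the distance is at most of order [dl]
   and the bound valid up to the diagonal is used. *)
have [dlr|rdl] := leP (4 * (d%:R * dl)) r1.
  have lnlo : ln (r1 / 2) = ln r1 - ln 2 by rewrite ln_div ?posrE.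
  apply: le_trans (noise2_KK_bounded (bnd (r1 / 2) _ _)) _; [lra|lra|].
  by rewrite lee_fin lnlo; apply: le_trans fin; lra.
apply: le_trans (noise2_KK_le b0 dlgt0 dl1 HQ' x y) _.
rewrite lee_fin; apply: le_trans fin.
have : ln r1 <= ln (4 * d%:R * dl).
  by rewrite ler_ln ?posrE ?mulr_gt0// -mulrA ltW.
by rewrite lnM ?posrE ?mulr_gt0// /C2; lra.
Qed.

End kernel.

(** * Energy *)

Section probability_constructions.
Context (dT : measure_display) (T : measurableType dT) (R : realType).
Local Open Scope ereal_scope.

(** Only the action on nonnegative measurable functions is recorded, which determines every energy
    of the mixture. *)
Lemma probability_mixture (P P' : probability T R) :
  exists M : probability T R, forall f : T -> \bar R,
    measurable_fun setT f -> (forall x, 0 <= f x) ->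
    \int[M]_x f x = 2^-1%:E * (\int[P]_x f x + \int[P']_x f x).
Proof.
have h0 : (0 <= 2^-1 :> R)%R by rewrite invr_ge0.
pose m : {measure set T -> \bar R} := mscale (NngNum h0) (measure_add P P').
have m1 : m setT = 1.
  have -> : m setT = (2^-1)%:E * (P setT + P' setT) by congr (_ * _); exact: measure_addE.
  by rewrite !probability_setT -EFinD -EFinM mulVf.
exists (mkprob m1) => f mf f0.
by rewrite /mkprob ge0_integral_mscale// ge0_integral_measure_add.
Qed.

Lemma probability_empirical n (y : n.-tuple T) : (0 < n)%N ->
  exists M : probability T R, forall f : T -> \bar R,
    measurable_fun setT f -> (forall x, 0 <= f x) ->
    \int[M]_x f x = n%:R^-1%:E * \sum_(x <- y) f x.
Proof.
move=> n0; pose x0 := tnth y (Ordinal n0).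
pose md i := [the {measure set T -> \bar R} of dirac (nth x0 y i)].
have h0 : (0 <= n%:R^-1 :> R)%R by rewrite invr_ge0.
pose m : {measure set T -> \bar R} := mscale (NngNum h0) (msum md n).
have m1 : m setT = 1.
  have -> : m setT = n%:R^-1%:E * \sum_(k < n) md k setT by [].
  under eq_bigr do rewrite /md/= diracT.
  by rewrite sumEFin sumr_const card_ord -EFinM mulVf// pnatr_eq0 -lt0n.
exists (mkprob m1) => f mf f0.
rewrite /mkprob ge0_integral_mscale// ge0_integral_measure_sum//.
congr (_ * _); rewrite big_tuple; apply: eq_bigr => i _.
by rewrite integral_dirac// diracT mul1e (tnth_nth x0).
Qed.

Lemma probability_integral_cst (P : probability T R) (c : \bar R) :
  \int[P]_x c = c.
Proof.
by rewrite integral_cst// -[RHS]mule1; congr (_ * _); exact: probability_setT.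
Qed.

(** Additivity without integrability: since [f] is at least [- c], its negative part has finite
    integral, so the constant can be moved out although the integral of [f] may be [+oo]. *)
Lemma integralDr_cst (P : probability T R) (f : T -> \bar R) (c : R) :
  measurable_fun setT f -> (0 <= c)%R -> (forall x, 0 <= f x + c%:E) ->
  \int[P]_x (f x + c%:E) = \int[P]_x f x + c%:E.
Proof.
move=> mf c0 fc0.
have Pc := probability_integral_cst P.
have mp := measurable_funepos mf; have mn := measurable_funeneg mf.
have neg_le x : f^\- x <= c%:E.
  rewrite funenegE ge_max lee_fin c0 andbT; move: (fc0 x).
  case: (f x) => [r| |]//=; last by rewrite leNye.
  by rewrite -EFinD !lee_fin => ?; lra.
have nfin : \int[P]_x f^\- x \is a fin_num.
  rewrite ge0_fin_numE ?integral_ge0//.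
  apply: (@le_lt_trans _ _ c%:E); last exact: ltry.
  by rewrite -[leRHS]Pc; apply: ge0_le_integral.
have E : \int[P]_x (f x + c%:E) + \int[P]_x f^\- x = \int[P]_x f^\+ x + c%:E.
  rewrite -[X in _ = _ + X]Pc -!ge0_integralD//.
  - apply: eq_integral => x _; rewrite addeAC; congr (_ + _).
    rewrite funeposE funenegE; move: (fc0 x); case: (f x) => [r| |]//= _.
      rewrite -!EFin_max -EFinD; congr EFin.
      by have [r0|r0] := leP 0%R r; [rewrite max_r ?max_l; lra|rewrite max_l ?max_r; lra].
    by rewrite max_r ?leNye// max_l ?leey// adde0.
  - exact: emeasurable_funD.
rewrite [in RHS]integralE addeAC -E addeK//.
Qed.

End probability_constructions.

Definition is_smear (R : realType) d (P : probability (d.-tuple R) R) (dl : R)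
    (M : probability (d.-tuple R) R) :=
  forall f : d.-tuple R -> \bar R, measurable_fun setT f -> (forall x, 0 <= f x)%E ->
  (\int[M]_x f x = \int[P]_x \int[Unifd R d]_u f (shift dl x u))%E.

Lemma probability_smear (R : realType) d (P : probability (d.-tuple R) R) (dl : R) :
  exists M, is_smear P dl M.
Proof.
pose g (p : d.-tuple R * d.-tuple R) := shift dl p.1 p.2.
have mg : measurable_fun setT g by exact: measurable_shift.
pose m : {measure set (d.-tuple R) -> \bar R} :=
  measure_function_pushforward__canonical__measure_function_Measure
    (P \x Unifd R d)%E mg.
have m1 : m setT = 1%E.
  rewrite /m /= /pushforward preimage_setT -setXTT product_measure1E//.
  rewrite [X in (X * _)%E]probability_setT mul1e.
  exact: (tpm_setT (Unif1_setT R)).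
exists (mkprob m1) => f mf f0.
rewrite /mkprob /m /= ge0_integral_pushforward// preimage_setT.
have mfg : measurable_fun setT (f \o g) by exact: measurableT_comp.
have fg0 x : (0 <= (f \o g) x)%E by exact: f0.
by rewrite (fubini_tonelli1 (f \o g)).
Qed.

Section energy.
Context (R : realType) (d : nat) (Q : d.-tuple R -> R) (C0 : R).
Local Open Scope ereal_scope.
Hypothesis Q0 : forall x, (0 <= Q x)%R.
Hypothesis cQ : continuous_Rd Q.
Hypothesis C00 : (0 <= C0)%R.
Hypothesis KQ : forall x y, x != y ->
  ((Q x + Q y) / 4 <= - ln (edist x y) + Q x / 2 + Q y / 2 + C0)%R.
Local Notation K := (KK Q C0).
Implicit Types P S M : probability (d.-tuple R) R.

Definition JJ P P' : \bar R := \int[P]_x \int[P']_y K x y.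

Lemma JJ_ge0 P P' : 0 <= JJ P P'.
Proof. by apply: integral_ge0 => x _; apply: integral_ge0 => y _; exact: KK_ge0. Qed.

Let mK x : measurable_fun setT (K x).
Proof. exact: (measurable_KK C0 cQ (measurable_cst x) (@measurable_id _ _ _)). Qed.

Lemma measurable_intK P : measurable_fun setT (fun x => \int[P]_y K x y).
Proof.
apply: (measurable_fun_fubini_tonelli_F (fun p => K p.1 p.2)).
  exact: measurable_KK.
by move=> p; exact: KK_ge0.
Qed.

(** The kernel of [IQ] may be negative but is at least [- C0], so the constant is extracted from the
    inner integral, then from the outer one. *)
Lemma IQE P : IQ Q P + C0%:E = JJ P P.
Proof.
have mek x : measurable_fun setT (energy_kernel Q x).
  rewrite (_ : energy_kernel Q x = fun y => K x y - C0%:E).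
    by apply: emeasurable_funB => //; exact: mK.
  by apply/funext => y; rewrite /KK addeK.
have inner x : \int[P]_y K x y = \int[P]_y energy_kernel Q x y + C0%:E.
  by rewrite /KK integralDr_cst// => y; exact: (KK_ge0 Q0 KQ).
rewrite /JJ /IQ (eq_integral _ _ (fun x _ => inner x)) integralDr_cst//.
- rewrite (_ : (fun x => _) = fun x => \int[P]_y K x y - C0%:E).
    by apply: emeasurable_funB => //; exact: measurable_intK.
  by apply/funext => x; rewrite inner addeK.
- by move=> x; rewrite -inner; apply: integral_ge0 => y _; exact: KK_ge0.
Qed.

Lemma JJC P P' : JJ P P' = JJ P' P.
Proof.
rewrite /JJ (fubini_tonelli (fun p => K p.1 p.2))/=.
- by apply: eq_integral => x _; apply: eq_integral => y _; exact: KKC.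
- exact: measurable_KK.
- by move=> p; exact: KK_ge0.
Qed.

Lemma JJ_min P P' : is_equilibrium_measure Q P -> JJ P P <= JJ P' P'.
Proof. by move=> /(_ P') h; rewrite -!IQE leeD2r. Qed.

Lemma Q_le_JJ P : \int[P]_x (Q x / 4)%:E <= JJ P P.
Proof.
apply: ge0_le_integral => //.
- by move=> x _; rewrite lee_fin divr_ge0.
- by apply/measurable_EFinP; apply: measurable_funM => //; exact: continuous_Rd_measurable.
- exact: measurable_intK.
move=> x _; rewrite -[leLHS](probability_integral_cst P).
apply: ge0_le_integral => //.
- by move=> y _; rewrite lee_fin divr_ge0.
move=> y _; apply: le_trans (KK_ge KQ x y); rewrite lee_fin.
by have := Q0 y; lra.
Qed.

Hypothesis d0 : (0 < d)%N.

(** By Tonelli, smearing the measures amounts to averaging the kernel, so pointwise bounds on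
    [noise2K] become bounds on energies. *)
Lemma JJ_smear P P' S S' (dl : R) :
  is_smear P dl S -> is_smear P' dl S' ->
  JJ S S' = \int[P]_x \int[P']_y noise2K Q C0 dl x y.
Proof.
move=> HS HS'; rewrite /JJ HS; [|exact: measurable_intK|]; last first.
  by move=> x; apply: integral_ge0 => y _; exact: KK_ge0.
apply: eq_integral => x _.
have K0 := KK_ge0 Q0 KQ.
have m3 : measurable_fun setT (fun p : (d.-tuple R * d.-tuple R) * d.-tuple R =>
    K (shift dl x p.1.1) (shift dl p.1.2 p.2)).
  apply: measurable_KK => //; apply: measurable_shift => //.
    by apply: measurableT_comp.
  by apply: measurableT_comp.
transitivity (\int[Unifd R d]_u \int[P']_y \int[Unifd R d]_v
    K (shift dl x u) (shift dl y v)).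
  by apply: eq_integral => u _; rewrite HS'.
rewrite (fubini_tonelli (fun p => \int[Unifd R d]_v
    K (shift dl x p.1) (shift dl p.2 v)))/=; last 2 first.
- exact: (measurable_fun_fubini_tonelli_F _ m3).
- by move=> p; exact: integral_ge0.
apply: eq_integral => y _; rewrite /noise2K.
rewrite (fubini_tonelli (fun p => K (shift dl x p.1) (shift dl y p.2)))//=.
apply: measurable_KK => //; apply: measurable_shift => //.
Qed.

Lemma JJ_mixture P P' M (a b c : R) :
  (forall f : d.-tuple R -> \bar R, measurable_fun setT f -> (forall x, 0 <= f x) ->
    \int[M]_x f x = 2^-1%:E * (\int[P]_x f x + \int[P']_x f x)) ->
  JJ P P = a%:E -> JJ P P' = b%:E -> JJ P' P' = c%:E ->
  JJ M M = ((a + c + 2 * b) / 4)%:E.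
Proof.
move=> HM Ja Jb Jc.
have K0 := KK_ge0 Q0 KQ.
have i0 (S : probability (d.-tuple R) R) x : 0 <= \int[S]_y K x y by exact: integral_ge0.
rewrite {1}/JJ HM; [|exact: measurable_intK|exact: i0].
have E (S : probability (d.-tuple R) R) : \int[S]_x \int[M]_y K x y =
    2^-1%:E * (JJ S P + JJ S P').
  transitivity (\int[S]_x (2^-1%:E * (\int[P]_y K x y + \int[P']_y K x y))).
    by apply: eq_integral => x _; rewrite HM.
  rewrite ge0_integralZl//; last 2 first.
  - by apply: emeasurable_funD; exact: measurable_intK.
  - by move=> x _; rewrite adde_ge0.
  by rewrite ge0_integralD//; exact: measurable_intK.
rewrite !E (JJC P' P) Ja Jb Jc; congr EFin => /=; by field.
Qed.

End energy.

(** * Gaussian mixture of the logarithm *)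

Section cauchy_density.
Context (R : realType).

(** The Cauchy density up to the factor pi, serving as an explicit integrable majorant. *)
Definition cauchy (x : R) : R := (1 + x ^+ 2)^-1.

Lemma cauchy_ge0 x : 0 <= cauchy x.
Proof. by rewrite invr_ge0 addr_ge0// sqr_ge0. Qed.

Lemma measurable_inv : measurable_fun setT (fun x : R => x^-1).
Proof.
(* The square makes the base nonnegative, where this power is the inverse; the factor [x] restores
   the sign, and both sides vanish at 0. *)
rewrite (_ : (fun x => _) = fun x : R => x * (x ^+ 2) `^ (-1)).
  apply: measurable_funM => //.
  by apply: (@measurableT_comp _ _ _ _ _ _ (fun x : R => x `^ (-1)) _ (fun x : R => x ^+ 2)) => //; exact: measurable_powR.
apply/funext => x; rewrite powR_inv1 ?sqr_ge0//.
by have [->|x0] := eqVneq x 0; [rewrite invr0 mul0r|field].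
Qed.

Lemma measurable_cauchy : measurable_fun setT cauchy.
Proof.
apply: (measurableT_comp measurable_inv); apply: measurable_funD => //.
Qed.

Lemma integral_cauchy : (\int[Leb1 R]_x (cauchy x)%:E < +oo)%E.
Proof.
have mc : measurable_fun setT (EFin \o cauchy) by apply/measurable_EFinP; exact: measurable_cauchy.
have c0 x : (0 <= (EFin \o cauchy) x)%E by rewrite lee_fin cauchy_ge0.
rewrite ge0_integral_onR//.
have int0y : (\int[lebesgue_measure]_(x in `[0%R, +oo[) (cauchy x)%:E = (pi / 2)%:E)%E.
  exact: integral0y_oneDsqr.
have intNy0 : (\int[lebesgue_measure]_(x in `]-oo, 0%R]) (cauchy x)%:E = (pi / 2)%:E)%E.
  rewrite -int0y (ge0_integration_by_substitution0 (f := EFin \o cauchy))//.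
  by apply: eq_integral => x _; rewrite /= /cauchy sqrrN.
apply: (@le_lt_trans _ _ ((pi / 2)%:E + (pi / 2)%:E)%E); last by rewrite -EFinD ltry.
rewrite -{1}int0y -intNy0 [X in (_ <= X + _)%E]integral_mkcond.
rewrite [X in (_ <= _ + X)%E]integral_mkcond -ge0_integralD//; last 4 first.
- by move=> x _; rewrite patchE; case: ifP => // _; exact: c0.
- by apply/measurable_restrict => //; exact: measurable_funTS.
- by move=> x _; rewrite patchE; case: ifP => // _; exact: c0.
- by apply/measurable_restrict => //; exact: measurable_funTS.
apply: ge0_le_integral => //.
- by move=> x _; exact: c0.
- by apply: emeasurable_funD; apply/measurable_restrict => //; exact: measurable_funTS.
move=> x _; rewrite !patchE !mem_setE !in_itv/= andbT.
have [x0|x0] := leP 0 x.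
  by rewrite leeDl//; case: ifP => // _; exact: c0.
by rewrite (ltW x0) add0e.
Qed.

End cauchy_density.

(* [- ln sqrt a] is, up to a constant, the integral of [exp (- t a) / (2 t)] over
   [t >= 1] minus that of [(1 - exp (- t a)) / (2 t)] over [t < 1]. *)
Section frullani.
Context (R : realType).
Local Notation L := (Leb1 R).

Definition w1 (t : R) : R := if 1 <= t then (2 * t)^-1 else 0.
Definition w0 (t : R) : R := if 0 <= t < 1 then (2 * t)^-1 else 0.

Lemma w1_ge0 t : 0 <= w1 t.
Proof. by rewrite /w1; case: ifP => // t1; rewrite invr_ge0; lra. Qed.

Lemma w0_ge0 t : 0 <= w0 t.
Proof. by rewrite /w0; case: ifP => // /andP[t0 _]; rewrite invr_ge0; lra. Qed.

Lemma measurable_invD (dS : measure_display) (S : measurableType dS) (f : S -> R) :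
  measurable_fun setT f -> measurable_fun setT (fun s => (f s)^-1).
Proof. exact: (measurableT_comp (@measurable_inv R)). Qed.

Let m2t : measurable_fun setT (fun t : R => (2 * t)^-1).
Proof. by apply: measurable_invD; exact: measurable_funM. Qed.

Lemma measurable_w1 : measurable_fun setT w1.
Proof. by apply: measurable_fun_ifT => //; exact: measurable_fun_ler. Qed.

Lemma measurable_w0 : measurable_fun setT w0.
Proof.
apply: measurable_fun_ifT => //; apply: measurable_and; first exact: measurable_fun_ler.
exact: measurable_fun_ltr.
Qed.

Definition pfun (a : R) : \bar R := (\int[L]_t (w1 t * expR (- (t * a)))%:E)%E.
Definition rfun (a : R) : \bar R := (\int[L]_t (w0 t * (1 - expR (- (t * a))))%:E)%E.

(** After the substitution s = t a, the parameter enters only as an endpoint: [g] and [q] are the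
    rescaled integrands of [pfun] and [rfun], and [m] is the mass between two endpoints. *)
Let g (a s : R) : R := if a <= s then (2 * s)^-1 * expR (- s) else 0.
Let q (a s : R) : R := if 0 <= s < a then (2 * s)^-1 * (1 - expR (- s)) else 0.
Let m (a b s : R) : R := if a <= s < b then (2 * s)^-1 else 0.

Lemma measurable_expRN (dS : measure_display) (S : measurableType dS) (f : S -> R) :
  measurable_fun setT f -> measurable_fun setT (fun s => expR (- f s)).
Proof.
move=> mf; apply: (measurableT_comp (@measurable_expR R)).
exact: (measurableT_comp (@oppr_measurable R setT)).
Qed.

Let mexp : measurable_fun setT (fun s : R => expR (- s)).
Proof. exact: measurable_expRN. Qed.

Let mP (a : R) : measurable_fun setT (fun t => (w1 t * expR (- (t * a)))%:E).
Proof.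
apply/measurable_EFinP; apply: measurable_funM; first exact: measurable_w1.
by apply: measurable_expRN; exact: measurable_funM.
Qed.

Let mR (a : R) : measurable_fun setT (fun t => (w0 t * (1 - expR (- (t * a))))%:E).
Proof.
apply/measurable_EFinP; apply: measurable_funM; first exact: measurable_w0.
by apply: measurable_funB => //; apply: measurable_expRN; exact: measurable_funM.
Qed.

Let mg a : measurable_fun setT (g a).
Proof.
apply: measurable_fun_ifT => //; first exact: measurable_fun_ler.
exact: measurable_funM.
Qed.

Let mq a : measurable_fun setT (q a).
Proof.
apply: measurable_fun_ifT => //.
  by apply: measurable_and; [exact: measurable_fun_ler|exact: measurable_fun_ltr].
by apply: measurable_funM => //; exact: measurable_funB.
Qed.

Let mm a b : measurable_fun setT (m a b).
Proof.
apply: measurable_fun_ifT => //.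
by apply: measurable_and; [exact: measurable_fun_ler|exact: measurable_fun_ltr].
Qed.

Let expR_le1' (s : R) : 0 <= s -> 0 <= 1 - expR (- s).
Proof. by move=> s0; rewrite subr_ge0 expR_le1; lra. Qed.

Let g_ge0 a s : 0 < a -> 0 <= g a s.
Proof.
move=> a0; rewrite /g; case: ifP => // as_.
by rewrite mulr_ge0 ?expR_ge0// invr_ge0; lra.
Qed.

Let q_ge0 a s : 0 <= q a s.
Proof.
rewrite /q; case: ifP => // /andP[s0 _].
by rewrite mulr_ge0 ?expR_le1'// invr_ge0; lra.
Qed.

Let m_ge0 a b s : 0 < a -> 0 <= m a b s.
Proof. by move=> a0; rewrite /m; case: ifP => // /andP[h _]; rewrite invr_ge0; lra. Qed.

Let int_m a b : 0 < a -> a <= b ->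
  (\int[L]_s (m a b s)%:E = (2^-1 * (ln b - ln a))%:E)%E.
Proof.
move=> a0 ab.
rewrite ge0_integral_onR; last 2 first.
- exact/measurable_EFinP.
- by move=> t; rewrite lee_fin m_ge0.
transitivity (\int[lebesgue_measure]_(s in `[a, b[) (2^-1 * s^-1)%:E)%E.
  rewrite [RHS]integral_mkcond; apply: eq_integral => s _.
  by rewrite patchE mem_setE in_itv/= /m; case: ifP => // _; rewrite invfM.
have minv D : measurable_fun D (fun s : R => (s^-1)%:E).
  by apply: measurable_funTS; apply/measurable_EFinP; exact: measurable_inv.
rewrite integral_itv_bndo_bndc; last first.
  apply: measurable_funTS; apply/measurable_EFinP.
  by apply: measurable_funM => //; exact: measurable_inv.
under eq_integral do rewrite EFinM.
rewrite ge0_integralZl//; last 2 first.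
- exact: minv.
- by move=> s /=; rewrite in_itv/= => /andP[h _]; rewrite lee_fin invr_ge0; lra.
by rewrite integral_inv// -EFinM.
Qed.

Let R0 a t : 0 <= a -> (0 <= (w0 t * (1 - expR (- (t * a))))%:E)%E.
Proof.
move=> a0; rewrite lee_fin /w0; case: ifP => [/andP[t0 _]|_]; last by rewrite mul0r.
by rewrite mulr_ge0 ?expR_le1' ?mulr_ge0// invr_ge0; lra.
Qed.

Let p_scale a : 0 < a -> pfun a = (\int[L]_s (g a s)%:E)%E.
Proof.
move=> a0.
have P0 t : (0 <= (w1 t * expR (- (t * a)))%:E)%E.
  by rewrite lee_fin mulr_ge0 ?w1_ge0 ?expR_ge0.
have mG : measurable_fun setT (fun s => (g a s)%:E) by exact/measurable_EFinP.
have G0 s : (0 <= (g a s)%:E)%E by rewrite lee_fin g_ge0.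
rewrite /pfun !ge0_integral_onR//.
rewrite -(ge0_integral_affine (f := fun s => (g a s)%:E) 0 a0)//.
rewrite -ge0_integralZl//; last 2 first.
- apply: (measurable_EFinP _ _).2; apply: (measurableT_comp (mg a)).
  by apply: measurable_funD => //; exact: measurable_funM.
- by rewrite lee_fin ltW.
apply: eq_integral => t _; rewrite -EFinM addr0 /w1 /g ler_pMr//.
case: ifP => t1; last by rewrite mul0r mulr0.
by congr EFin; rewrite (mulrC t a); field; rewrite !gt_eqF//; lra.
Qed.

Let r_scale a : 0 < a -> rfun a = (\int[L]_s (q a s)%:E)%E.
Proof.
move=> a0.
have P0 t := R0 t (ltW a0).
have mG : measurable_fun setT (fun s => (q a s)%:E) by exact/measurable_EFinP.
have G0 s : (0 <= (q a s)%:E)%E by rewrite lee_fin q_ge0.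
rewrite /rfun !ge0_integral_onR//.
rewrite -(ge0_integral_affine (f := fun s => (q a s)%:E) 0 a0)//.
rewrite -ge0_integralZl//; last 2 first.
- apply: (measurable_EFinP _ _).2; apply: (measurableT_comp (mq a)).
  by apply: measurable_funD => //; exact: measurable_funM.
- by rewrite lee_fin ltW.
apply: eq_integral => t _; rewrite -EFinM addr0 /w0 /q pmulr_rge0// gtr_pMr//.
case: ifP => t1; last by rewrite mul0r mulr0.
have [->|t0] := eqVneq t 0; first by rewrite !(mulr0, mul0r) oppr0 expR0 subrr !mulr0.
by congr EFin; rewrite (mulrC t a); field; rewrite t0 gt_eqF.
Qed.

Lemma le_pfun a b : a <= b -> (pfun b <= pfun a)%E.
Proof.
move=> ab; apply: ge0_le_integral => //.
- by move=> t _; rewrite lee_fin mulr_ge0 ?w1_ge0 ?expR_ge0.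
move=> t _; rewrite lee_fin /w1; case: ifPn => [t1|_]; last by rewrite !mul0r.
have t0 : 0 <= t by lra.
by rewrite ler_wpM2l ?invr_ge0 ?mulr_ge0// ler_expR lerN2 ler_wpM2l.
Qed.

Lemma le_rfun a b : 0 <= a -> a <= b -> (rfun a <= rfun b)%E.
Proof.
move=> a0 ab; apply: ge0_le_integral => //.
- by move=> t _; exact: R0.
move=> t _; rewrite lee_fin /w0; case: ifPn => [/andP[t0 _]|_]; last by rewrite !mul0r.
by rewrite ler_wpM2l ?invr_ge0 ?mulr_ge0// lerD2l lerN2 ler_expR lerN2 ler_wpM2l.
Qed.

(** On [a, b) the densities exp(-s)/(2s) and (1 - exp(-s))/(2s) add up to 1/(2s); elsewhere the two
    sides coincide. *)
Let split_pr a b : 0 < a -> a <= b ->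
  (pfun a + rfun b = pfun b + rfun a + (2^-1 * (ln b - ln a))%:E)%E.
Proof.
move=> a0 ab; have b0 : 0 < b by exact: lt_le_trans ab.
rewrite !p_scale// !r_scale// -int_m//.
rewrite -!ge0_integralD//=; last 12 first.
all: try by move=> s _; rewrite ?adde_ge0// lee_fin ?g_ge0 ?q_ge0 ?m_ge0.
all: try by apply/measurable_EFinP.
all: try by apply: emeasurable_funD; exact/measurable_EFinP.
apply: eq_integral => s _; rewrite -!EFinD; congr EFin; rewrite /g /q /m.
have [s0|s0] := leP 0 s; last first.
  by rewrite !leNgt (lt_trans s0 a0) (lt_trans s0 b0)/= !addr0.
have [sa|sa] := ltP s a.
  have sb : s < b by exact: lt_le_trans ab.
  by rewrite !leNgt sb/= addr0 add0r.
have [sb|sb] := ltP s b.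
  by rewrite /= !add0r mulrBr mulr1 addrC subrK.
by rewrite /= !addr0.
Qed.

Lemma pfun_ge0 a : (0 <= pfun a)%E.
Proof. by apply: integral_ge0 => t _; rewrite lee_fin mulr_ge0 ?w1_ge0 ?expR_ge0. Qed.

Lemma rfun_ge0 a : 0 <= a -> (0 <= rfun a)%E.
Proof.
by move=> a0; apply: integral_ge0 => t _; exact: R0.
Qed.

Lemma pfun1_fin : pfun 1 \is a fin_num.
Proof.
rewrite ge0_fin_numE ?pfun_ge0//; apply: le_lt_trans (integral_cauchy R).
apply: ge0_le_integral => //.
- by move=> t _; rewrite lee_fin mulr_ge0 ?w1_ge0 ?expR_ge0.
- by apply/measurable_EFinP; exact: measurable_cauchy.
move=> t _; rewrite lee_fin /w1 mulr1; case: ifP => t1; last by rewrite mul0r cauchy_ge0.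
have t0 : 0 < t by lra.
have h : 1 + t ^+ 2 <= 2 * expR t.
  by have := @expR_ge1Dxn R t 1 (ltW t0); rewrite /= (_ : 2`!%:R = 2 :> R)//; lra.
rewrite expRN -invfM /cauchy lef_pV2 ?posrE ?mulr_gt0 ?expR_gt0//; last first.
  by have := sqr_ge0 t; lra.
apply: le_trans h _; rewrite ler_wpM2r ?expR_ge0//; lra.
Qed.

Lemma rfun1_fin : rfun 1 \is a fin_num.
Proof.
rewrite ge0_fin_numE ?rfun_ge0//.
apply: (@le_lt_trans _ _ (\int[L]_t (cauchy t)%:E)%E); last exact: integral_cauchy.
apply: ge0_le_integral => //.
- by move=> t _; exact: R0.
- by apply/measurable_EFinP; exact: measurable_cauchy.
move=> t _; rewrite lee_fin /w0 mulr1; case: ifP => [/andP[t0 t1]|_]; last by rewrite mul0r cauchy_ge0.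
have [->|tn0] := eqVneq t 0; first by rewrite mulr0 invr0 mul0r cauchy_ge0.
have tgt : 0 < t by rewrite lt0r tn0.
have h1 : 1 - expR (- t) <= t by have := @expR_ge1Dx R (- t); lra.
apply: (@le_trans _ _ ((2 * t)^-1 * t)).
  by rewrite ler_wpM2l// invr_ge0; lra.
rewrite (_ : (2 * t)^-1 * t = 2^-1); last by field.
by rewrite /cauchy lef_pV2 ?posrE; [nra|lra|nra].
Qed.

(** Comparison with a = 1 fixes the constant. The term [rfun a] stays on the left so that the
    identity also makes sense at [a = 0], where both sides are [+oo]. *)
Lemma frullani_split : exists c : R, forall a : R, 0 <= a ->
  ((if (a == 0)%R then +oo else (- (2^-1 * ln a))%:E) + rfun a = pfun a + c%:E)%E.
Proof.
exists (fine (rfun 1) - fine (pfun 1)) => a; rewrite le_eqVlt.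
have key b : 0 < b -> ((- (2^-1 * ln b))%:E + rfun b =
    pfun b + (fine (rfun 1) - fine (pfun 1))%:E)%E.
  move=> b0; have rb0 := rfun_ge0 (ltW b0); have pb0 := pfun_ge0 b.
  have [b1|b1] := leP b 1.
    have := split_pr b0 b1; rewrite -(fineK pfun1_fin) -(fineK rfun1_fin) ln1 /=.
    case: (pfun b) pb0 => [x| |]//; case: (rfun b) rb0 => [y| |]// _ _.
    by rewrite -!EFinD => -[h]; congr EFin; lra.
  have := split_pr ltr01 (ltW b1); rewrite -(fineK pfun1_fin) -(fineK rfun1_fin) ln1 /=.
  case: (pfun b) pb0 => [x| |]//; case: (rfun b) rb0 => [y| |]// _ _.
  by rewrite -!EFinD => -[h]; congr EFin; lra.
case/predU1P => [<-|a0]; last by rewrite gt_eqF// key.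
rewrite eqxx addye; last by rewrite gt_eqF// (lt_le_trans _ (rfun_ge0 _)) ?ltNy0.
apply/esym/eqyP => A A0.
(* At exp(-2A) the logarithmic term equals [A]; since [pfun] is nonincreasing, its value at 0 plus
   the constant is at least [A]. *)
have e0 := expR_gt0 (- (2 * A)).
apply: (@le_trans _ _ (pfun (expR (- (2 * A))) + (fine (rfun 1) - fine (pfun 1))%:E)%E).
  rewrite -key// expRK (_ : - (2^-1 * - (2 * A)) = A); last by field.
  by rewrite leeDl// rfun_ge0// ltW.
by apply: leeD => //; apply: le_pfun; exact: ltW.
Qed.

End frullani.

(** * Gaussian convolution *)

Section gauss1.
Context (R : realType) (s : R).
Hypothesis s0 : 0 < s.
Local Notation L := (Leb1 R).
Local Notation pdf a := (normal_pdf a s).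

Let sn0 : s != 0. Proof. by rewrite gt_eqF. Qed.

Let pdfE (a r z : R) : 0 < r ->
  normal_pdf a r z = normal_peak r * expR (- (z - a) ^+ 2 / (r ^+ 2 *+ 2)).
Proof. by move=> r0; rewrite normal_pdfE ?gt_eqF. Qed.

Lemma integral_pdf (a : R) : (\int[L]_z (pdf a z)%:E = 1)%E.
Proof.
rewrite ge0_integral_onR.
- exact: integral_normal_pdf.
- by apply/measurable_EFinP; exact: measurable_normal_pdf.
- by move=> t; rewrite lee_fin normal_pdf_ge0.
Qed.

(** The factor left when two Gaussian densities of deviation [s] are multiplied: the Gaussian part
    of the product is centred at the midpoint, with deviation s / sqrt 2. *)
Definition kap : R := normal_peak s ^+ 2 / normal_peak (s / Num.sqrt 2).

Let sq2 : 0 < Num.sqrt (2 : R). Proof. by rewrite sqrtr_gt0. Qed.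
Let s2 : 0 < s / Num.sqrt 2. Proof. by rewrite divr_gt0. Qed.

Lemma kap_gt0 : 0 < kap.
Proof. by rewrite divr_gt0 ?exprn_gt0 ?normal_peak_gt0 ?gt_eqF. Qed.

Lemma integral_pdf_mul (a b : R) :
  (\int[L]_z (pdf a z * pdf b z)%:E =
    (kap * expR (- ((a - b) ^+ 2 / (4 * s ^+ 2))))%:E)%E.
Proof.
have e z : pdf a z * pdf b z = kap * expR (- ((a - b) ^+ 2 / (4 * s ^+ 2))) *
    normal_pdf ((a + b) / 2) (s / Num.sqrt 2) z.
  rewrite !pdfE// /kap.
  have -> : (s / Num.sqrt 2) ^+ 2 *+ 2 = s ^+ 2.
    rewrite expr_div_n sqr_sqrtr// -mulr_natr divfK//.
  rewrite [RHS](_ : _ = normal_peak s ^+ 2 *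
     (expR (- ((a - b) ^+ 2 / (4 * s ^+ 2))) * expR (- (z - (a + b) / 2) ^+ 2 / s ^+ 2))).
    rewrite -expRD mulrACA -expRD expr2; congr (_ * expR _).
    by rewrite -mulr_natr; field.
  have p0 := normal_peak_gt0 (lt0r_neq0 s2).
  by field; rewrite gt_eqF.
under eq_integral do rewrite e EFinM.
rewrite ge0_integralZl//.
- rewrite ge0_integral_onR.
  + by rewrite integral_normal_pdf mule1.
  + by apply/measurable_EFinP; exact: measurable_normal_pdf.
  + by move=> t; rewrite lee_fin normal_pdf_ge0.
- by apply/measurable_EFinP; exact: measurable_normal_pdf.
- by move=> z _; rewrite lee_fin normal_pdf_ge0.
- by rewrite lee_fin mulr_ge0 ?expR_ge0 ?(ltW kap_gt0).
Qed.

Lemma normal_peak_le : normal_peak s <= s^-1.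
Proof.
have pi2 := @pi_ge2 R.
rewrite /normal_peak lef_pV2 ?posrE// ?sqrtr_gt0 ?pmulrn_lgt0 ?mulr_gt0 ?exprn_gt0 ?pi_gt0//.
rewrite -[leLHS]ger0_norm ?(ltW s0)// -sqrtr_sqr ler_wsqrtr//.
rewrite -mulrnAr ler_peMr ?sqr_ge0// -mulr_natr; lra.
Qed.

(** At equal centres [kap] is the integral of the squared density, which is at most the peak. *)
Lemma kap_le : kap <= s^-1.
Proof.
apply: le_trans normal_peak_le.
rewrite -lee_fin.
have := integral_pdf_mul 0 0; rewrite subrr expr0n/= mul0r oppr0 expR0 mulr1 => <-.
apply: (@le_trans _ _ (\int[L]_z ((normal_peak s)%:E * (pdf 0 z)%:E))%E).
  apply: ge0_le_integral => //.
  - by move=> z _; rewrite lee_fin mulr_ge0 ?normal_pdf_ge0.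
  - by apply/measurable_EFinP; apply: measurable_funM; exact: measurable_normal_pdf.
  - by apply: measurable_funeM; apply/measurable_EFinP; exact: measurable_normal_pdf.
  by move=> z _; rewrite -EFinM lee_fin ler_wpM2r ?normal_pdf_ge0 ?normal_pdf_ub.
rewrite ge0_integralZl//.
- by rewrite integral_pdf mule1.
- by apply/measurable_EFinP; exact: measurable_normal_pdf.
- by move=> z _; rewrite lee_fin normal_pdf_ge0.
- by rewrite lee_fin normal_peak_ge0.
Qed.

(** The moment is absorbed by doubling the variance: |a - z| <= s exp(((z - a)/(2s))^2), and
    multiplying by this exponential gives, up to a factor, a Gaussian density of deviation s sqrt
    2. *)
Lemma integral_pdf_abs (a : R) : (\int[L]_z (pdf a z * `|a - z|)%:E <= (2 * s)%:E)%E.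
Proof.
pose r := s * Num.sqrt 2.
have r0 : 0 < r by rewrite mulr_gt0.
have rr : r ^+ 2 = s ^+ 2 *+ 2 by rewrite exprMn sqr_sqrtr// mulr_natr.
have prs : normal_peak s = Num.sqrt 2 * normal_peak r.
  rewrite /normal_peak rr -[X in _ = _ * (Num.sqrt X)^-1]mulr_natl.
  rewrite (mulrnAl (s ^+ 2)) sqrtrM// invfM mulrA divff ?mul1r// gt_eqF.
have b z : pdf a z * `|a - z| <= (s * Num.sqrt 2) * normal_pdf a r z.
  rewrite !pdfE// prs rr.
  set E := expR (- (z - a) ^+ 2 / (s ^+ 2 *+ 2)).
  have -> : expR (- (z - a) ^+ 2 / (s ^+ 2 *+ 2 *+ 2)) =
      E * expR (((z - a) / (2 * s)) ^+ 2).
    by rewrite /E -expRD; congr expR; field.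
  have h : `|a - z| <= s * expR (((z - a) / (2 * s)) ^+ 2).
    have h1 := @expR_ge1Dx R (((z - a) / (2 * s)) ^+ 2).
    apply: le_trans (ler_wpM2l (ltW s0) h1).
    have -> : s * (1 + ((z - a) / (2 * s)) ^+ 2) = s + `|a - z| ^+ 2 / (4 * s).
      by rewrite real_normK ?num_real//; field.
    have : 0 <= (`|a - z| - 2 * s) ^+ 2 / (4 * s) by rewrite divr_ge0 ?sqr_ge0// mulr_ge0 ?(ltW s0).
    have -> : (`|a - z| - 2 * s) ^+ 2 / (4 * s) = s + `|a - z| ^+ 2 / (4 * s) - `|a - z|.
      by field.
    by lra.
  have -> : s * Num.sqrt 2 * (normal_peak r * (E * expR (((z - a) / (2 * s)) ^+ 2))) =
    Num.sqrt 2 * normal_peak r * E * (s * expR (((z - a) / (2 * s)) ^+ 2)) by ring.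
  apply: ler_wpM2l h.
  by rewrite !mulr_ge0 ?normal_peak_ge0 ?expR_ge0 ?(ltW sq2).
apply: (@le_trans _ _ (\int[L]_z ((s * Num.sqrt 2)%:E * (normal_pdf a r z)%:E))%E).
  apply: ge0_le_integral => //.
  - by move=> z _; rewrite lee_fin mulr_ge0 ?normal_pdf_ge0.
  - apply/measurable_EFinP; apply: measurable_funM; first exact: measurable_normal_pdf.
    by apply: measurableT_comp => //; exact: measurable_funB.
  - by apply: measurable_funeM; apply/measurable_EFinP; exact: measurable_normal_pdf.
  by move=> z _; rewrite -EFinM lee_fin.
rewrite ge0_integralZl//.
- rewrite ge0_integral_onR.
  + rewrite integral_normal_pdf mule1 lee_fin mulrC ler_wpM2r ?(ltW s0)//.
    by rewrite -[leRHS]ger0_norm// -sqrtr_sqr ler_wsqrtr//; lra.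
  + by apply/measurable_EFinP; exact: measurable_normal_pdf.
  + by move=> t; rewrite lee_fin normal_pdf_ge0.
- by apply/measurable_EFinP; exact: measurable_normal_pdf.
- by move=> z _; rewrite lee_fin normal_pdf_ge0.
- by rewrite lee_fin mulr_ge0 ?(ltW s0) ?(ltW sq2).
Qed.

End gauss1.

Section gauss.
Context (R : realType) (d : nat) (s : R).
Hypothesis s0 : 0 < s.
Local Notation E := (d.-tuple R).

Definition gk (x z : E) : R := \prod_(i < d) normal_pdf (tnth x i) s (tnth z i).

Lemma gk_ge0 x z : 0 <= gk x z.
Proof. by apply: prodr_ge0 => i _; exact: normal_pdf_ge0. Qed.

Lemma gk_le x z : gk x z <= normal_peak s ^+ d.
Proof.
rewrite /gk -[X in _ <= _ ^+ X](card_ord d) -prodr_const; apply: ler_prod => i _.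
by rewrite normal_pdf_ge0 normal_pdf_ub ?gt_eqF.
Qed.

Lemma measurable_gk dS (S : measurableType dS) (f g : S -> E) :
  measurable_fun setT f -> measurable_fun setT g ->
  measurable_fun setT (fun t => gk (f t) (g t)).
Proof.
move=> mf mg; rewrite /gk; apply: measurable_prod => i _.
rewrite (_ : (fun t => _) = fun t => normal_pdf 0 s (tnth (g t) i - tnth (f t) i)).
  apply: (measurableT_comp (measurable_normal_pdf 0 s)).
  by apply: measurable_funB; apply: (measurableT_comp (measurable_tnth i)).
by apply/funext => t; rewrite !normal_pdfE ?gt_eqF// /normal_fun subr0.
Qed.

Let mpdf (a : R) : measurable_fun setT (fun z : R => (normal_pdf a s z)%:E).
Proof. by apply/measurable_EFinP; exact: measurable_normal_pdf. Qed.

Lemma integral_gk x : (\int[Lebd R d]_z (gk x z)%:E = 1)%E.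
Proof.
under eq_integral => z _.
  rewrite /gk -prodEFin; under eq_bigr => i _ do rewrite (tnth_nth 0 x).
  over.
rewrite (@ge0_integral_prod _ _ _ (Leb1 R) d (fun i z => (normal_pdf (nth 0 x i) s z)%:E)).
- by apply: big1 => i _; exact: integral_pdf.
- by move=> i; exact: mpdf.
- by move=> i t; rewrite lee_fin normal_pdf_ge0.
Qed.

(** Two Gaussians of deviation [s] overlap in a Gaussian function of |x - y|; this is the kernel
    exp(-t |x - y|^2) with t = 1/(4 s^2). *)
Lemma integral_gk_mul x y :
  (\int[Lebd R d]_z (gk x z * gk y z)%:E =
    (kap s ^+ d * expR (- (edist x y ^+ 2 / (4 * s ^+ 2))))%:E)%E.
Proof.
under eq_integral => z _.
  rewrite /gk -big_split/= -prodEFin.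
  under eq_bigr => i _ do rewrite (tnth_nth 0 x) (tnth_nth 0 y).
  over.
rewrite (@ge0_integral_prod _ _ _ (Leb1 R) d
  (fun i z => (normal_pdf (nth 0 x i) s z * normal_pdf (nth 0 y i) s z)%:E)).
- under eq_bigr do rewrite (integral_pdf_mul s0).
  rewrite prodEFin big_split/= prodr_const card_ord; congr (_ * _)%:E.
  rewrite /edist sqr_sqrtr; last by apply: sumr_ge0 => i _; exact: sqr_ge0.
  rewrite mulr_suml -sumrN expR_sum; apply: eq_bigr => i _.
  by rewrite !(tnth_nth 0).
- by move=> i; apply/measurable_EFinP; apply: measurable_funM; exact: measurable_normal_pdf.
- by move=> i t; rewrite lee_fin mulr_ge0 ?normal_pdf_ge0.
Qed.

(** The distance is at most the sum of the coordinate differences, and each summand factorises over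
    the coordinates. *)
Lemma integral_gk_edist x :
  (\int[Lebd R d]_z (gk x z * edist x z)%:E <= (d%:R * (2 * s))%:E)%E.
Proof.
pose h (i j : nat) (z : R) : R := normal_pdf (nth 0 x j) s z *
  (if j == i then `|nth 0 x i - z| else 1).
have h0 i j z : 0 <= h i j z by rewrite mulr_ge0 ?normal_pdf_ge0//; case: ifP.
have mh i j : measurable_fun setT (EFin \o h i j).
  apply/measurable_EFinP; apply: measurable_funM; first exact: measurable_normal_pdf.
  by case: (j == i) => //; apply: measurableT_comp => //; exact: measurable_funB.
have mH i : measurable_fun setT (fun z : E => (\prod_(j < d) (h i j (tnth z j))%:E)%E).
  apply: emeasurable_prod => j.
  exact: (measurableT_comp (mh i j) (measurable_tnth j)).
apply: (@le_trans _ _ (\int[Lebd R d]_z \sum_(i < d) \prod_(j < d) (h i j (tnth z j))%:E)%E).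
  apply: ge0_le_integral => //.
  - by move=> z _; rewrite lee_fin mulr_ge0 ?gk_ge0 ?edist_ge0.
  - apply/measurable_EFinP; apply: measurable_funM; first exact: measurable_gk.
    exact: measurable_edist.
  - by apply: emeasurable_sum => i; exact: mH.
  move=> z _; under eq_bigr do rewrite prodEFin.
  rewrite sumEFin lee_fin.
  apply: (le_trans (ler_wpM2l (gk_ge0 x z) (edist_le_sum x z))).
  rewrite mulr_sumr; apply: ler_sum => i _.
  rewrite big_split/= (eq_bigr (fun j => normal_pdf (tnth x j) s (tnth z j))); last first.
    by move=> j _; rewrite (tnth_nth 0 x).
  rewrite [X in _ <= _ * X](bigD1 i)//= eqxx [X in _ <= _ * (_ * X)]big1 ?mulr1 -?tnth_nth//.
  by move=> j ji; rewrite ifF//; apply/negbTE.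
rewrite ge0_integral_sum//; last first.
  by move=> i z _; apply: prode_ge0 => j _; rewrite lee_fin.
apply: (@le_trans _ _ (\sum_(i < d) (2 * s)%:E)%E); last first.
  by rewrite sumEFin lee_fin sumr_const card_ord [leRHS]mulr_natl.
apply: lee_sum => i _.
rewrite (@ge0_integral_prod _ _ _ (Leb1 R) d (fun j z => (h i j z)%:E)); last 2 first.
- exact: mh.
- by move=> j t; rewrite lee_fin.
rewrite (bigD1 i)//= big1 ?mule1; last first.
  move=> j ji; rewrite -(integral_pdf s (nth 0 x j)); apply: eq_integral => z _.
  by rewrite /h ifF ?mulr1//; apply/negbTE.
rewrite /h eqxx; exact: integral_pdf_abs.
Qed.

End gauss.

Section fubini3.
Context (d1 d2 d3 : measure_display) (T1 : measurableType d1) (T2 : measurableType d2)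
  (T3 : measurableType d3) (R : realType).
Context (m1 : {sigma_finite_measure set T1 -> \bar R})
  (m2 : {sigma_finite_measure set T2 -> \bar R})
  (m3 : {sigma_finite_measure set T3 -> \bar R}).
Variable F : T1 -> T2 -> T3 -> \bar R.
Hypothesis mF : measurable_fun setT (fun p : (T1 * T2) * T3 => F p.1.1 p.1.2 p.2).
Hypothesis F0 : forall x y z, (0 <= F x y z)%E.

Let mG : measurable_fun setT (fun p : T1 * T3 => \int[m2]_y F p.1 y p.2)%E.
Proof.
apply: (measurable_fun_fubini_tonelli_F (fun p => F p.1.1 p.2 p.1.2)) => //.
have m : measurable_fun setT (fun p : (T1 * T3) * T2 => ((p.1.1, p.2), p.1.2)).
  apply/measurable_fun_pair => /=; last exact: (measurableT_comp measurable_snd measurable_fst).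
  by apply/measurable_fun_pair => //=; exact: (measurableT_comp measurable_fst measurable_fst).
exact: (measurableT_comp mF m).
Qed.

Lemma fubini_tonelli3 :
  (\int[m1]_x \int[m2]_y \int[m3]_z F x y z = \int[m3]_z \int[m1]_x \int[m2]_y F x y z)%E.
Proof.
rewrite -(fubini_tonelli (fun p => \int[m2]_y F p.1 y p.2)%E)//; last first.
  by move=> p; exact: integral_ge0.
apply: eq_integral => x _; rewrite (fubini_tonelli (fun p => F x p.1 p.2))//.
have m : measurable_fun setT (fun p : T2 * T3 => ((x, p.1), p.2)).
  by apply/measurable_fun_pair => //=; apply/measurable_fun_pair => //=.
exact: (measurableT_comp mF m).
Qed.

Lemma measurable_fubini_tonelli3 :
  measurable_fun setT (fun z => \int[m1]_x \int[m2]_y F x y z)%E.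
Proof.
apply: (measurable_fun_fubini_tonelli_G (fun p => \int[m2]_y F p.1 y p.2)%E) => //.
by move=> p; exact: integral_ge0.
Qed.

End fubini3.

Section gauss_energy.
Context (R : realType) (d : nat).
Local Notation E := (d.-tuple R).
Local Notation L := (Leb1 R).
Implicit Types P S : probability E R.

Let k (t : R) (x y : E) : R := expR (- (`|t| * edist x y ^+ 2)).

Let k_ge0 t x y : 0 <= k t x y. Proof. exact: expR_ge0. Qed.

Let k_le1 t x y : k t x y <= 1.
Proof. by rewrite /k expR_le1 oppr_le0 mulr_ge0 ?sqr_ge0. Qed.

Let mk (dS : measure_display) (S : measurableType dS) (h : S -> R) (f g : S -> E) :
  measurable_fun setT h -> measurable_fun setT f -> measurable_fun setT g ->
  measurable_fun setT (fun s => k (h s) (f s) (g s)).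
Proof.
move=> mh mf mg; apply: measurable_expRN; apply: measurable_funM.
  exact: (measurableT_comp (@normr_measurable R setT)).
by apply: measurable_funX; exact: measurable_edist.
Qed.

(** The absolute value keeps the kernel in [0, 1] for all real [t], so that the energy is finite and
    measurable on the whole line. *)
Definition gauss_energy (t : R) P S : R :=
  fine (\int[P]_x \int[S]_y (expR (- (`|t| * edist x y ^+ 2)))%:E).

Let intk t P S : (\int[P]_x \int[S]_y (k t x y)%:E <= 1)%E.
Proof.
rewrite -(probability_integral_cst P 1); apply: ge0_le_integral => //.
- by move=> x _; apply: integral_ge0 => y _; rewrite lee_fin.
- apply: (measurable_fun_fubini_tonelli_F (fun p => (k t p.1 p.2)%:E)); last first.
    by move=> p; rewrite lee_fin.
  by apply/measurable_EFinP; exact: mk.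
move=> x _; rewrite -(probability_integral_cst S 1); apply: ge0_le_integral => //.
- by move=> y _; rewrite lee_fin.
- by apply/measurable_EFinP; apply: mk => //; exact: measurable_cst.
by move=> y _; rewrite lee_fin.
Qed.

Lemma gauss_energyE t P S :
  (gauss_energy t P S)%:E = (\int[P]_x \int[S]_y (expR (- (`|t| * edist x y ^+ 2)))%:E)%E.
Proof.
rewrite fineK// ge0_fin_numE; first exact: (le_lt_trans (intk t P S) (ltry 1)).
by apply: integral_ge0 => x _; apply: integral_ge0 => y _; rewrite lee_fin.
Qed.

Lemma gauss_energy_le1 t P S : gauss_energy t P S <= 1.
Proof. by rewrite -lee_fin gauss_energyE; exact: intk. Qed.

Lemma gauss_energy_ge0 t P S : 0 <= gauss_energy t P S.
Proof.
rewrite -lee_fin gauss_energyE.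
by apply: integral_ge0 => x _; apply: integral_ge0 => y _; rewrite lee_fin.
Qed.

Let mkk : measurable_fun setT (fun p : (E * E) * R => (k p.2 p.1.1 p.1.2)%:E).
Proof.
apply/measurable_EFinP; apply: mk => //.
- exact: (measurableT_comp measurable_fst measurable_fst).
- exact: (measurableT_comp measurable_snd measurable_fst).
Qed.

Lemma measurable_gauss_energy P S : measurable_fun setT (fun t => gauss_energy t P S).
Proof.
apply/measurable_EFinP.
rewrite (_ : _ \o _ = fun t => \int[P]_x \int[S]_y (k t x y)%:E)%E; last first.
  by apply/funext => t /=; rewrite gauss_energyE.
by apply: (measurable_fubini_tonelli3 P S mkk) => *; rewrite lee_fin.
Qed.

(** The Gaussian energy of the signed measure P - S. *)
Definition gauss_gap (t : R) P S : R :=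
  gauss_energy t P P + gauss_energy t S S - 2 * gauss_energy t P S.

Lemma measurable_gauss_gap P S : measurable_fun setT (fun t => gauss_gap t P S).
Proof.
apply: measurable_funB; last by apply: measurable_funM => //; exact: measurable_gauss_energy.
by apply: measurable_funD; exact: measurable_gauss_energy.
Qed.

Section at_scale.
Variables (s t : R).
Hypotheses (s0 : 0 < s) (st : `|t| = (4 * s ^+ 2)^-1).
Local Notation g := (@gk R d s).

Let dens P (z : E) : \bar R := (\int[P]_x (g x z)%:E)%E.
Let den P (z : E) : R := fine (dens P z).

Let mg1 z : measurable_fun setT (fun x => (g x z)%:E).
Proof. by apply/measurable_EFinP; apply: measurable_gk => //; exact: measurable_cst. Qed.

Let mg2 : measurable_fun setT (fun p : E * E => (g p.1 p.2)%:E).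
Proof. by apply/measurable_EFinP; apply: measurable_gk. Qed.

Let g0 x z : (0 <= (g x z)%:E)%E. Proof. by rewrite lee_fin gk_ge0. Qed.

Let dens_ge0 P z : (0 <= dens P z)%E. Proof. exact: integral_ge0. Qed.

Let den_ge0 P z : 0 <= den P z. Proof. by rewrite fine_ge0. Qed.

Let densE P z : dens P z = (den P z)%:E.
Proof.
rewrite fineK// ge0_fin_numE//; apply: (@le_lt_trans _ _ (normal_peak s ^+ d)%:E); last exact: ltry.
rewrite -(probability_integral_cst P (_ ^+ _)%:E); apply: ge0_le_integral => //.
by move=> x _; rewrite lee_fin gk_le.
Qed.

Let mdens P : measurable_fun setT (dens P).
Proof. by apply: (measurable_fun_fubini_tonelli_G (fun p => (g p.1 p.2)%:E)) => // p; exact: g0. Qed.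

Let mden P : measurable_fun setT (den P).
Proof.
apply/measurable_EFinP; rewrite (_ : _ \o _ = dens P) //.
by apply/funext => z; rewrite densE.
Qed.

Let int_den P S : (\int[Lebd R d]_z (den P z * den S z)%:E =
  (kap s ^+ d * gauss_energy t P S)%:E)%E.
Proof.
transitivity (\int[Lebd R d]_z \int[P]_x \int[S]_y (g x z * g y z)%:E)%E.
  apply: eq_integral => z _; rewrite EFinM -!densE.
  rewrite {1}/dens -ge0_integralZr//.
  apply: eq_integral => x _; rewrite /dens -ge0_integralZl//.
rewrite -fubini_tonelli3; last 2 first.
- apply/measurable_EFinP; apply: measurable_funM; apply: measurable_gk => //.
  + exact: (measurableT_comp measurable_fst measurable_fst).
  + exact: (measurableT_comp measurable_snd measurable_fst).
- by move=> x y z; rewrite lee_fin mulr_ge0 ?gk_ge0.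
rewrite EFinM gauss_energyE -ge0_integralZl//; last 3 first.
- apply: (measurable_fun_fubini_tonelli_F (fun p => (k t p.1 p.2)%:E)); last first.
    by move=> p; rewrite lee_fin.
  by apply/measurable_EFinP; exact: mk.
- by move=> x _; apply: integral_ge0 => y _; rewrite lee_fin.
- by rewrite lee_fin exprn_ge0// ltW ?kap_gt0.
apply: eq_integral => x _; rewrite -ge0_integralZl//; last 2 first.
- by apply/measurable_EFinP; apply: mk => //; exact: measurable_cst.
- by rewrite lee_fin exprn_ge0// ltW ?kap_gt0.
by apply: eq_integral => y _; rewrite integral_gk_mul// -EFinM st (mulrC (edist x y ^+ 2)).
Qed.

(** The gap is the squared L^2 distance of the two smoothed densities, up to [kap s ^+ d]; hence its
    sign. *)
Let int_sq P S : (\int[Lebd R d]_z ((den P z - den S z) ^+ 2)%:E =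
  (kap s ^+ d * gauss_gap t P S)%:E)%E.
Proof.
have e : (\int[Lebd R d]_z ((den P z - den S z) ^+ 2)%:E +
    2%:E * (kap s ^+ d * gauss_energy t P S)%:E =
    (kap s ^+ d * (gauss_energy t P P + gauss_energy t S S))%:E)%E.
  have mD : measurable_fun setT (fun z => ((den P z - den S z) ^+ 2)%:E).
    by apply/measurable_EFinP; apply: measurable_funX; exact: measurable_funB.
  have mM (P' S' : probability E R) : measurable_fun setT (fun z => (den P' z * den S' z)%:E).
    by apply/measurable_EFinP; exact: measurable_funM.
  have M0 (P' S' : probability E R) z : (0 <= (den P' z * den S' z)%:E)%E.
    by rewrite lee_fin mulr_ge0.
  rewrite mulrDr (EFinD (_ * _)) -!int_den -ge0_integralZl//.
  rewrite -!ge0_integralD//.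
  - by apply: eq_integral => z _; rewrite -!EFinM -!EFinD; congr EFin; ring.
  - by move=> z _; rewrite lee_fin sqr_ge0.
  - by move=> z _; rewrite mule_ge0.
  - by apply: measurable_funeM.
move: e; have : (0 <= \int[Lebd R d]_z ((den P z - den S z) ^+ 2)%:E)%E.
  by apply: integral_ge0 => z _; rewrite lee_fin sqr_ge0.
case: (\int[_]_z _)%E => [r| |]//.
by rewrite /gauss_gap -EFinM -EFinD => _ [h]; congr EFin; lra.
Qed.

Lemma gauss_gap_ge0 P S : 0 <= gauss_gap t P S.
Proof.
have : (0 <= (kap s ^+ d * gauss_gap t P S)%:E)%E.
  by rewrite -int_sq; apply: integral_ge0 => z _; rewrite lee_fin sqr_ge0.
by rewrite lee_fin pmulr_rge0// exprn_gt0// kap_gt0.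
Qed.

(* After smoothing both measures at scale [s], their integrals of [f] are compared
   through [p <= q + th + (p - q)^2 / (4 th)] for the two smoothed densities. *)
Lemma gauss_gap_bound P S (f : E -> R) (M D V th : R) :
  measurable_fun setT f -> (forall x, 0 <= f x <= M) ->
  0 <= D -> (forall x y, f x <= f y + D * edist x y) ->
  (\int[Lebd R d]_z (f z)%:E <= V%:E)%E -> 0 < th ->
  (\int[P]_x (f x)%:E <= \int[S]_x (f x)%:E +
    (2 * (D * (d%:R * (2 * s))) + th * V + M / (4 * th) * (kap s ^+ d * gauss_gap t P S))%:E)%E.
Proof.
move=> mf fM D0 fL fV th0.
have f0 x : 0 <= f x by case/andP: (fM x).
have M0 : 0 <= M by case/andP: (fM [tuple of nseq d 0]) => + h; move/le_trans; apply.
have mF : measurable_fun setT (EFin \o f) by exact/measurable_EFinP.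
have mgf x : measurable_fun setT (fun z => (g x z * f z)%:E).
  by apply/measurable_EFinP; apply: measurable_funM => //; apply: measurable_gk => //; exact: measurable_cst.
have mgx x : measurable_fun setT (fun z => (g x z)%:E).
  by apply/measurable_EFinP; apply: measurable_gk => //; exact: measurable_cst.
have mge x : measurable_fun setT (fun z => (g x z * edist x z)%:E).
  apply/measurable_EFinP; apply: measurable_funM; first by apply: measurable_gk => //; exact: measurable_cst.
  by apply: measurable_edist => //; exact: measurable_cst.
have gf0 x z : (0 <= (g x z * f z)%:E)%E by rewrite lee_fin mulr_ge0 ?gk_ge0.
have gd0 x z : (0 <= (g x z * edist x z)%:E)%E by rewrite lee_fin mulr_ge0 ?gk_ge0 ?edist_ge0.
have err x : (D%:E * \int[Lebd R d]_z (g x z * edist x z)%:E <= (D * (d%:R * (2 * s)))%:E)%E.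
  by rewrite EFinM lee_wpmul2l ?lee_fin// integral_gk_edist.
(* By the Lipschitz bound, replacing [f] by its Gaussian average costs at most [D] times the mean
   displacement. *)
have up x : ((f x)%:E <= \int[Lebd R d]_z (g x z * f z)%:E + (D * (d%:R * (2 * s)))%:E)%E.
  apply: le_trans (leeD2l _ (err x)).
  rewrite -ge0_integralZl// -ge0_integralD//; last 2 first.
  - by move=> z _; rewrite mule_ge0.
  - exact: measurable_funeM.
  rewrite -[leLHS]mule1 -(integral_gk s x) -ge0_integralZl//; last by rewrite lee_fin.
  apply: ge0_le_integral => //.
  - by move=> z _; rewrite mule_ge0// lee_fin.
  - exact: measurable_funeM.
  - by apply: emeasurable_funD => //; exact: measurable_funeM.
  move=> z _; rewrite -!EFinM -EFinD lee_fin.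
  have := ler_wpM2l (gk_ge0 s x z) (fL x z); rewrite mulrDr (mulrC (f x)); lra.
have dn x : (\int[Lebd R d]_z (g x z * f z)%:E <= (f x)%:E + (D * (d%:R * (2 * s)))%:E)%E.
  apply: le_trans (leeD2l _ (err x)).
  rewrite -ge0_integralZl// -[X in (_ <= X + _)%E]mule1 -(integral_gk s x).
  rewrite -ge0_integralZl//; last by rewrite lee_fin.
  rewrite -ge0_integralD//; last 4 first.
  - by move=> z _; rewrite mule_ge0// lee_fin.
  - exact: measurable_funeM.
  - by move=> z _; rewrite mule_ge0.
  - exact: measurable_funeM.
  apply: ge0_le_integral => //.
  - by apply: emeasurable_funD => //; exact: measurable_funeM.
  move=> z _; rewrite -!EFinM -EFinD lee_fin.
  by have := ler_wpM2l (gk_ge0 s x z) (fL z x); rewrite edistC mulrDr (mulrC (f x)); lra.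
have swap P' : (\int[P']_x \int[Lebd R d]_z (g x z * f z)%:E =
    \int[Lebd R d]_z (f z * den P' z)%:E)%E.
  rewrite (fubini_tonelli (fun p => (g p.1 p.2 * f p.2)%:E))/=; last 2 first.
  - apply/measurable_EFinP; apply: measurable_funM; first exact: measurable_gk.
    exact: measurableT_comp.
  - by move=> p; exact: gf0.
  apply: eq_integral => z _; rewrite mulrC EFinM -densE -ge0_integralZr//.
  by rewrite lee_fin.
have mint : measurable_fun setT (fun x => \int[Lebd R d]_z (g x z * f z)%:E)%E.
  apply: (measurable_fun_fubini_tonelli_F (fun p => (g p.1 p.2 * f p.2)%:E)); last by move=> p; exact: gf0.
  apply/measurable_EFinP; apply: measurable_funM; first exact: measurable_gk.
  exact: measurableT_comp.
have c0 : 0 <= D * (d%:R * (2 * s)) by rewrite !mulr_ge0 ?(ltW s0).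
have int0 x : (0 <= \int[Lebd R d]_z (g x z * f z)%:E)%E by exact: integral_ge0.
have stepP : (\int[P]_x (f x)%:E <= \int[Lebd R d]_z (f z * den P z)%:E + (D * (d%:R * (2 * s)))%:E)%E.
  rewrite -swap -(integralDr_cst P mint c0); last by move=> x; rewrite adde_ge0// lee_fin.
  apply: ge0_le_integral => //.
  - by move=> x _; rewrite lee_fin.
  - exact: emeasurable_funD.
have stepS : (\int[Lebd R d]_z (f z * den S z)%:E <= \int[S]_x (f x)%:E + (D * (d%:R * (2 * s)))%:E)%E.
  rewrite -swap -(integralDr_cst S mF c0); last by move=> x; rewrite adde_ge0// lee_fin.
  apply: ge0_le_integral => //.
  - exact: emeasurable_funD.
have c1 : 0 <= M / (4 * th) by rewrite divr_ge0// mulr_ge0 ?(ltW th0).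
(* [f z] is kept in front of [th], where it integrates to at most [V], and replaced by [M] in front
   of the square. *)
have mid : (\int[Lebd R d]_z (f z * den P z)%:E <= \int[Lebd R d]_z (f z * den S z)%:E +
    (th * V + M / (4 * th) * (kap s ^+ d * gauss_gap t P S))%:E)%E.
  apply: (@le_trans _ _ (\int[Lebd R d]_z (f z * den S z)%:E +
     (th%:E * \int[Lebd R d]_z (f z)%:E +
      (M / (4 * th))%:E * \int[Lebd R d]_z ((den P z - den S z) ^+ 2)%:E))%E); last first.
    rewrite leeD2l// EFinD; apply: leeD; first by rewrite EFinM lee_wpmul2l// lee_fin ltW.
    by rewrite int_sq -EFinM.
  have mD : measurable_fun setT (fun z => ((den P z - den S z) ^+ 2)%:E).
    by apply/measurable_EFinP; apply: measurable_funX; exact: measurable_funB.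
  have mfd P' : measurable_fun setT (fun z => (f z * den P' z)%:E).
    by apply/measurable_EFinP; exact: measurable_funM.
  have D0' z : (0 <= ((den P z - den S z) ^+ 2)%:E)%E by rewrite lee_fin sqr_ge0.
  have m1 : measurable_fun setT (fun z => th%:E * (f z)%:E)%E by exact: measurable_funeM.
  have m2 : measurable_fun setT (fun z => (M / (4 * th))%:E * ((den P z - den S z) ^+ 2)%:E)%E.
    exact: measurable_funeM.
  have th0' : (0 <= th%:E)%E by rewrite lee_fin ltW.
  have a1 z : (0 <= th%:E * (f z)%:E)%E by rewrite mule_ge0// lee_fin.
  have a2 z : (0 <= (M / (4 * th))%:E * ((den P z - den S z) ^+ 2)%:E)%E by rewrite mule_ge0// lee_fin.
  have a3 z : (0 <= (f z * den S z)%:E)%E by rewrite lee_fin mulr_ge0.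
  rewrite -!ge0_integralZl//; last by move=> z _; rewrite lee_fin.
  rewrite -ge0_integralD// -ge0_integralD//; last 2 first.
  - by move=> z _; exact: adde_ge0.
  - exact: emeasurable_funD.
  apply: ge0_le_integral => //.
  - by move=> z _; rewrite lee_fin mulr_ge0.
  - by apply: emeasurable_funD => //; exact: emeasurable_funD.
  move=> z _; rewrite -!EFinM -!EFinD lee_fin.
  set p := den P z; set q := den S z; set c := M / (4 * th).
  have h1 : p - q <= th + (p - q) ^+ 2 / (4 * th).
    have h : 0 <= (p - q - 2 * th) ^+ 2 / (4 * th) by rewrite divr_ge0 ?sqr_ge0// mulr_ge0 ?(ltW th0).
    have e : (p - q - 2 * th) ^+ 2 / (4 * th) = (p - q) ^+ 2 / (4 * th) - (p - q) + th.
      by field; rewrite gt_eqF.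
    by lra.
  have h2 := ler_wpM2l (f0 z) h1.
  have h3 : f z * ((p - q) ^+ 2 / (4 * th)) <= c * (p - q) ^+ 2.
    rewrite (_ : c * _ = M * ((p - q) ^+ 2 / (4 * th))); last by rewrite /c mulrAC mulrA.
    apply: ler_wpM2r; last by case/andP: (fM z).
    by rewrite divr_ge0 ?sqr_ge0// mulr_ge0 ?(ltW th0).
  by rewrite !mulrDr mulrN in h2; lra.
apply: (le_trans stepP); apply: (@le_trans _ _ (\int[Lebd R d]_z (f z * den S z)%:E +
    (th * V + M / (4 * th) * (kap s ^+ d * gauss_gap t P S))%:E + (D * (d%:R * (2 * s)))%:E)%E).
  by rewrite leeD2r.
apply: (@le_trans _ _ (\int[S]_x (f x)%:E + (D * (d%:R * (2 * s)))%:E +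
    (th * V + M / (4 * th) * (kap s ^+ d * gauss_gap t P S))%:E + (D * (d%:R * (2 * s)))%:E)%E).
  by rewrite !leeD2r.
move: (\int[S]_x (f x)%:E)%E => I; rewrite -!addeA; apply: leeD2l.
by rewrite -!EFinD lee_fin; lra.
Qed.

End at_scale.
End gauss_energy.

(** * Comparison with the equilibrium measure *)

Section integral_sums.
Context (dT : measure_display) (T : measurableType dT) (R : realType).
Context (m : {measure set T -> \bar R}).
Implicit Types f g h k : T -> \bar R.
Local Open Scope ereal_scope.

(** The integrals may be [+oo], so the gap is expressed by sums on both sides. *)
Lemma integralD_gap f g h k :
  measurable_fun setT f -> measurable_fun setT g ->
  measurable_fun setT h -> measurable_fun setT k ->
  (forall x, 0 <= f x) -> (forall x, 0 <= g x) ->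
  (forall x, 0 <= h x) -> (forall x, 0 <= k x) ->
  (forall x, f x + g x = h x + h x + k x) ->
  \int[m]_x f x + \int[m]_x g x = \int[m]_x h x + \int[m]_x h x + \int[m]_x k x.
Proof.
move=> mf mg mh mk f0 g0 h0 k0 e.
rewrite -ge0_integralD// -ge0_integralD// -ge0_integralD//; last 2 first.
- by move=> x _; rewrite adde_ge0.
- exact: emeasurable_funD.
by apply: eq_integral => x _; exact: e.
Qed.

Lemma le_integralD f g h :
  measurable_fun setT f -> measurable_fun setT g -> measurable_fun setT h ->
  (forall x, 0 <= f x) -> (forall x, 0 <= g x) -> (forall x, 0 <= h x) ->
  (forall x, f x + g x <= h x + h x) ->
  \int[m]_x f x + \int[m]_x g x <= \int[m]_x h x + \int[m]_x h x.
Proof.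
move=> mf mg mh f0 g0 h0 e; rewrite -ge0_integralD// -ge0_integralD//.
apply: ge0_le_integral => //.
- by move=> x _; rewrite adde_ge0.
- exact: emeasurable_funD.
- exact: emeasurable_funD.
Qed.

End integral_sums.

Section energy_gap.
Context (R : realType) (d : nat) (Q : d.-tuple R -> R) (C0 c : R).
Local Notation E := (d.-tuple R).
Local Notation L := (Leb1 R).
Hypothesis Q0 : forall x, 0 <= Q x.
Hypothesis cQ : continuous_Rd Q.
Hypothesis C00 : 0 <= C0.
Hypothesis KQ : forall x y, x != y ->
  (Q x + Q y) / 4 <= - ln (edist x y) + Q x / 2 + Q y / 2 + C0.
Hypothesis frullani : forall a : R, 0 <= a ->
  ((if (a == 0)%R then +oo else (- (2^-1 * ln a))%:E) + rfun a = pfun a + c%:E)%E.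
Hypothesis cC : 0 <= c + C0.
Implicit Types P S : probability E R.
Local Notation K := (KK Q C0).

Let mpk : measurable_fun setT (fun p : (E * E) * R =>
  (w1 p.2 * expR (- (`|p.2| * edist p.1.1 p.1.2 ^+ 2)))%:E).
Proof.
apply/measurable_EFinP; apply: measurable_funM.
  exact: (measurableT_comp (@measurable_w1 R) measurable_snd).
apply: measurable_expRN; apply: measurable_funM.
  exact: (measurableT_comp (@normr_measurable R setT) measurable_snd).
apply: measurable_funX; apply: measurable_edist.
  exact: (measurableT_comp measurable_fst measurable_fst).
exact: (measurableT_comp measurable_snd measurable_fst).
Qed.

Let mrk : measurable_fun setT (fun p : (E * E) * R =>
  (w0 p.2 * (1 - expR (- (`|p.2| * edist p.1.1 p.1.2 ^+ 2))))%:E).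
Proof.
apply/measurable_EFinP; apply: measurable_funM.
  exact: (measurableT_comp (@measurable_w0 R) measurable_snd).
apply: measurable_funB => //; apply: measurable_expRN; apply: measurable_funM.
  exact: (measurableT_comp (@normr_measurable R setT) measurable_snd).
apply: measurable_funX; apply: measurable_edist.
  exact: (measurableT_comp measurable_fst measurable_fst).
exact: (measurableT_comp measurable_snd measurable_fst).
Qed.

Let pk0 (x y : E) t : (0 <= (w1 t * expR (- (`|t| * edist x y ^+ 2)))%:E)%E.
Proof. by rewrite lee_fin mulr_ge0 ?w1_ge0 ?expR_ge0. Qed.

Let e1 (t : R) (x y : E) : 0 <= 1 - expR (- (`|t| * edist x y ^+ 2)).
Proof. by rewrite subr_ge0 expR_le1 oppr_le0 mulr_ge0 ?sqr_ge0. Qed.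

Let rk0 (x y : E) t : (0 <= (w0 t * (1 - expR (- (`|t| * edist x y ^+ 2))))%:E)%E.
Proof. by rewrite lee_fin mulr_ge0 ?w0_ge0. Qed.

Let pE (a : R) : pfun a = (\int[L]_t (w1 t * expR (- (`|t| * a)))%:E)%E.
Proof.
apply: eq_integral => t _; rewrite /w1; case: ifPn => [t1|_]; last by rewrite !mul0r.
by rewrite ger0_norm//; lra.
Qed.

Let rE (a : R) : rfun a = (\int[L]_t (w0 t * (1 - expR (- (`|t| * a))))%:E)%E.
Proof.
apply: eq_integral => t _; rewrite /w0; case: ifPn => [/andP[t0 _]|_]; last by rewrite !mul0r.
by rewrite ger0_norm.
Qed.

Let mp2 : measurable_fun setT (fun p : E * E => pfun (edist p.1 p.2 ^+ 2)).
Proof.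
rewrite (_ : (fun p => _) = fun p : E * E =>
    \int[L]_t (w1 t * expR (- (`|t| * edist p.1 p.2 ^+ 2)))%:E)%E; last first.
  by apply/funext => p; rewrite pE.
exact: (measurable_fun_fubini_tonelli_F _ mpk).
Qed.

Let mr2 : measurable_fun setT (fun p : E * E => rfun (edist p.1 p.2 ^+ 2)).
Proof.
rewrite (_ : (fun p => _) = fun p : E * E =>
    \int[L]_t (w0 t * (1 - expR (- (`|t| * edist p.1 p.2 ^+ 2))))%:E)%E; last first.
  by apply/funext => p; rewrite rE.
exact: (measurable_fun_fubini_tonelli_F _ mrk).
Qed.

Let p0 (x y : E) : (0 <= pfun (edist x y ^+ 2))%E. Proof. exact: pfun_ge0. Qed.

Let r0 (x y : E) : (0 <= rfun (edist x y ^+ 2))%E.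
Proof. by rewrite rfun_ge0// sqr_ge0. Qed.

Let mexp (t : R) : measurable_fun setT (fun p : E * E => (expR (- (`|t| * edist p.1 p.2 ^+ 2)))%:E).
Proof.
apply/measurable_EFinP; apply: measurable_expRN; apply: measurable_funM => //.
by apply: measurable_funX; exact: measurable_edist.
Qed.

Let int_pfun P S : (\int[P]_x \int[S]_y pfun (edist x y ^+ 2) =
  \int[L]_t (w1 t * gauss_energy t P S)%:E)%E.
Proof.
under eq_integral do under eq_integral do rewrite pE.
rewrite (fubini_tonelli3 P S L mpk pk0); apply: eq_integral => t _.
rewrite EFinM gauss_energyE -ge0_integralZl//; last 3 first.
- apply: (measurable_fun_fubini_tonelli_F _ (mexp t)) => p.
  by rewrite lee_fin expR_ge0.
- by move=> x _; apply: integral_ge0 => y _; rewrite lee_fin expR_ge0.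
- by rewrite lee_fin w1_ge0.
apply: eq_integral => x _; rewrite -ge0_integralZl//.
- exact: (measurableT_comp (mexp t) (pair1_measurable x)).
- by rewrite lee_fin w1_ge0.
Qed.

Let int_1exp t P S : (\int[P]_x \int[S]_y (1 - expR (- (`|t| * edist x y ^+ 2)))%:E =
  (1 - gauss_energy t P S)%:E)%E.
Proof.
have m1e : measurable_fun setT (fun p : E * E => (1 - expR (- (`|t| * edist p.1 p.2 ^+ 2)))%:E).
  apply/measurable_EFinP; apply: measurable_funB => //; exact: (measurable_EFinP _ _).1 (mexp t).
have : (\int[P]_x \int[S]_y (1 - expR (- (`|t| * edist x y ^+ 2)))%:E + (gauss_energy t P S)%:E = 1)%E.
  rewrite gauss_energyE -ge0_integralD//; last 4 first.
  - by move=> x _; apply: integral_ge0 => y _; rewrite lee_fin.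
  - by apply: (measurable_fun_fubini_tonelli_F _ m1e) => p; rewrite lee_fin.
  - by move=> x _; apply: integral_ge0 => y _; rewrite lee_fin expR_ge0.
  - by apply: (measurable_fun_fubini_tonelli_F _ (mexp t)) => p; rewrite lee_fin expR_ge0.
  rewrite -[RHS](probability_integral_cst P); apply: eq_integral => x _.
  rewrite -ge0_integralD//; last 3 first.
  - by move=> y _; rewrite lee_fin.
  - exact: (measurableT_comp m1e (pair1_measurable x)).
  - exact: (measurableT_comp (mexp t) (pair1_measurable x)).
  rewrite -[RHS](probability_integral_cst S); apply: eq_integral => y _.
  by rewrite -EFinD subrK.
case: (\int[P]_x _)%E => [r| |]//; rewrite -EFinD => -[h]; congr EFin; lra.
Qed.

Let int_rfun P S : (\int[P]_x \int[S]_y rfun (edist x y ^+ 2) =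
  \int[L]_t (w0 t * (1 - gauss_energy t P S))%:E)%E.
Proof.
have m1e (t : R) : measurable_fun setT (fun p : E * E => (1 - expR (- (`|t| * edist p.1 p.2 ^+ 2)))%:E).
  apply/measurable_EFinP; apply: measurable_funB => //; exact: (measurable_EFinP _ _).1 (mexp t).
under eq_integral do under eq_integral do rewrite rE.
rewrite (fubini_tonelli3 P S L mrk rk0); apply: eq_integral => t _.
rewrite EFinM -int_1exp -ge0_integralZl//; last 3 first.
- by apply: (measurable_fun_fubini_tonelli_F _ (m1e t)) => p; rewrite lee_fin.
- by move=> x _; apply: integral_ge0 => y _; rewrite lee_fin.
- by rewrite lee_fin w0_ge0.
apply: eq_integral => x _; rewrite -ge0_integralZl//.
- exact: (measurableT_comp (m1e t) (pair1_measurable x)).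
- by move=> y _; rewrite lee_fin.
- by rewrite lee_fin w0_ge0.
Qed.

(** Frullani's identity at a = |x - y|^2. The constant c + C0 is shared equally by the two one-body
    terms, which are then nonnegative. *)
Let KK_split (x y : E) : (K x y + rfun (edist x y ^+ 2) =
  pfun (edist x y ^+ 2) + ((Q x + c + C0) / 2 + (Q y + c + C0) / 2)%:E)%E.
Proof.
rewrite (_ : (Q x + c + C0) / 2 + (Q y + c + C0) / 2 = c + (Q x / 2 + Q y / 2 + C0)); last by field.
rewrite (EFinD c) [RHS]addeA -frullani ?sqr_ge0// sqrf_eq0.
have [->|xy] := eqVneq x y.
  rewrite edistxx eqxx KKxx !addye//.
  by have := r0 y y; rewrite edistxx => h; rewrite gt_eqF// (lt_le_trans ltNy0 h).
have e0 : 0 < edist x y by rewrite edist_gt0.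
rewrite (gt_eqF e0) KKE// lnXn// addeAC -EFinD; congr (EFin _ + _)%E.
by rewrite -mulr_natr; field.
Qed.

Let U P : \bar R := (\int[P]_x ((Q x + c + C0) / 2)%:E)%E.

Let mQ : measurable_fun setT Q. Proof. exact: continuous_Rd_measurable. Qed.

Let mU : measurable_fun setT (fun x => ((Q x + c + C0) / 2)%:E).
Proof. by apply/measurable_EFinP; apply: measurable_funM => //; apply: measurable_funD => //; exact: measurable_funD. Qed.

Let U0 x : (0 <= ((Q x + c + C0) / 2)%:E)%E.
Proof. by rewrite lee_fin divr_ge0// -addrA addr_ge0. Qed.

Let mK x : measurable_fun setT (K x).
Proof. exact: (measurable_KK C0 cQ (measurable_cst x) (@measurable_id _ _ _)). Qed.

Let K0 x y : (0 <= K x y)%E. Proof. exact: KK_ge0. Qed.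

Let integralD3 S (f u : E -> \bar R) (a : \bar R) :
  measurable_fun setT f -> measurable_fun setT u ->
  (forall x, 0 <= f x)%E -> (forall x, 0 <= u x)%E -> (0 <= a)%E ->
  (\int[S]_x (f x + (a + u x)) = \int[S]_x f x + (a + \int[S]_x u x))%E.
Proof.
move=> mf mu f0 u0 a0; rewrite ge0_integralD//; last 2 first.
- by move=> y _; rewrite adde_ge0.
- by apply: emeasurable_funD => //; exact: measurable_cst.
by rewrite ge0_integralD// probability_integral_cst.
Qed.

(** The one-body terms enter additively, so they cancel in the combination of energies that forms
    the gap. *)
Let JJ_split P S :
  (JJ Q C0 P S + \int[P]_x \int[S]_y rfun (edist x y ^+ 2) =
   \int[P]_x \int[S]_y pfun (edist x y ^+ 2) + (U P + U S))%E.
Proof.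
have mp1 (x : E) : measurable_fun setT (fun y => pfun (edist x y ^+ 2)).
  exact: (measurableT_comp mp2 (pair1_measurable x)).
have mr1 (x : E) : measurable_fun setT (fun y => rfun (edist x y ^+ 2)).
  exact: (measurableT_comp mr2 (pair1_measurable x)).
have mpi : measurable_fun setT (fun x => \int[S]_y pfun (edist x y ^+ 2))%E.
  by apply: (measurable_fun_fubini_tonelli_F _ mp2).
have mri : measurable_fun setT (fun x => \int[S]_y rfun (edist x y ^+ 2))%E.
  by apply: (measurable_fun_fubini_tonelli_F _ mr2) => p; exact: r0.
have U0' : (0 <= U S)%E by exact: integral_ge0.
rewrite /JJ -ge0_integralD//; last 3 first.
- by move=> x _; exact: integral_ge0.
- exact: measurable_intK.
- by move=> x _; exact: integral_ge0.
transitivity (\int[P]_x (\int[S]_y pfun (edist x y ^+ 2) + (U S + ((Q x + c + C0) / 2)%:E)))%E.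
  apply: eq_integral => x _; rewrite -ge0_integralD//.
  under eq_integral do rewrite KK_split EFinD.
  by rewrite (addeC (U S)); exact: integralD3.
have ip0 x : (0 <= \int[S]_y pfun (edist x y ^+ 2))%E by exact: integral_ge0.
by rewrite (addeC (U P)); exact: (integralD3 P mpi mU ip0 U0 U0').
Qed.

(** [rfun] grows at most like the logarithm of the distance, which [Q] dominates; for measures of
    finite energy the [rfun] energy is then finite and may be cancelled. *)
Let rfun_le (x y : E) : (rfun (edist x y ^+ 2) <= (fine (rfun 1%R) + C0 + (Q x + Q y) / 4)%:E)%E.
Proof.
have Qxy : 0 <= (Q x + Q y) / 4 by rewrite divr_ge0// addr_ge0.
have rf := fineK (rfun1_fin R); have pf := fineK (pfun1_fin R).
have C := C00.
have [e1'|e1'] := leP (edist x y ^+ 2) 1.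
  apply: (@le_trans _ _ (rfun 1%R)); last by rewrite -{1}rf lee_fin; lra.
  by apply: le_rfun => //; exact: sqr_ge0.
have xy : x != y by apply: contraTneq e1' => ->; rewrite edistxx expr0n/= -leNgt.
have e0 : 0 < edist x y by rewrite edist_gt0.
have pl1 : (pfun (edist x y ^+ 2) <= pfun 1%R)%E by apply: le_pfun; exact: ltW.
have h1 := frullani ler01; rewrite oner_eq0 ln1 mulr0 oppr0 add0e -rf -pf in h1.
have h2 := frullani (sqr_ge0 (edist x y)).
rewrite sqrf_eq0 (gt_eqF e0) lnXn// -(mulr_natl (ln _)) mulrA mulVf// mul1r in h2.
have hK := KQ xy.
move: h1 => -[h1]; rewrite -pf in pl1; move: h2 pl1 (p0 x y) (r0 x y).
case: (pfun _) => [p| |]//; case: (rfun _) => [r| |]//.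
by rewrite -!EFinD => -[h2]; rewrite !lee_fin => h3 _ _; lra.
Qed.

(** [JJ_split] for P, P and S, S minus twice that for P, S. The [rfun] parts leave a nonnegative
    term, because the Gaussian gap is nonnegative at each [t]; it is dropped, and only the scales t
    >= 1 remain. *)
Lemma energy_gap P S (a b c' : R) : JJ Q C0 P P = a%:E -> JJ Q C0 P S = b%:E ->
  JJ Q C0 S S = c'%:E ->
  (\int[L]_t (w1 t * gauss_gap t P S)%:E <= (a + c' - 2 * b)%:E)%E.
Proof.
move=> Ja Jb Jc.
have gap0 t : 0 < t -> 0 <= gauss_gap t P S.
  move=> t0; have s0 : 0 < (Num.sqrt (4 * t))^-1 by rewrite invr_gt0 sqrtr_gt0 mulr_gt0.
  apply: (gauss_gap_ge0 s0); rewrite exprVn sqr_sqrtr ?mulr_ge0 ?(ltW t0)//.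
  by rewrite gtr0_norm//; field; rewrite gt_eqF.
have mge P' S' : measurable_fun setT (fun t => (w1 t * gauss_energy t P' S')%:E).
  apply/measurable_EFinP; apply: measurable_funM; first exact: measurable_w1.
  exact: measurable_gauss_energy.
have mgr P' S' : measurable_fun setT (fun t => (w0 t * (1 - gauss_energy t P' S'))%:E).
  apply/measurable_EFinP; apply: measurable_funM; first exact: measurable_w0.
  by apply: measurable_funB => //; exact: measurable_gauss_energy.
have w1g0 P' S' t : (0 <= (w1 t * gauss_energy t P' S')%:E)%E.
  by rewrite lee_fin mulr_ge0 ?w1_ge0 ?gauss_energy_ge0.
have w0g0 P' S' t : (0 <= (w0 t * (1 - gauss_energy t P' S'))%:E)%E.
  by rewrite lee_fin mulr_ge0 ?w0_ge0// subr_ge0 gauss_energy_le1.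
have w1gap t : (0 <= (w1 t * gauss_gap t P S)%:E)%E.
  rewrite lee_fin /w1; case: ifPn => [t1|]; last by rewrite mul0r.
  have t0 : 0 < t by lra.
  by rewrite mulr_ge0 ?gap0// invr_ge0 mulr_ge0 ?(ltW t0).
have mw1gap : measurable_fun setT (fun t => (w1 t * gauss_gap t P S)%:E).
  apply/measurable_EFinP; apply: measurable_funM; first exact: measurable_w1.
  exact: measurable_gauss_gap.
have pgap : (\int[L]_t (w1 t * gauss_energy t P P)%:E + \int[L]_t (w1 t * gauss_energy t S S)%:E =
    \int[L]_t (w1 t * gauss_energy t P S)%:E + \int[L]_t (w1 t * gauss_energy t P S)%:E +
    \int[L]_t (w1 t * gauss_gap t P S)%:E)%E.
  apply: integralD_gap => // t.
  by rewrite -!EFinD /gauss_gap; congr EFin; ring.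
have rgap : (\int[L]_t (w0 t * (1 - gauss_energy t P P))%:E +
      \int[L]_t (w0 t * (1 - gauss_energy t S S))%:E <=
    \int[L]_t (w0 t * (1 - gauss_energy t P S))%:E +
      \int[L]_t (w0 t * (1 - gauss_energy t P S))%:E)%E.
  apply: le_integralD => // t.
  rewrite -!EFinD lee_fin -!mulrDr /w0.
  case: ifPn => [/andP[t0 _]|]; last by rewrite !mul0r.
  have [->|tn0] := eqVneq t 0; first by rewrite mulr0 invr0 !mul0r.
  rewrite ler_wpM2l ?invr_ge0 ?mulr_ge0//.
  have : 0 <= gauss_gap t P S by rewrite gap0// lt0r tn0.
  by rewrite /gauss_gap; lra.
have JP := JJ_split P P; have JS := JJ_split S S; have JPS := JJ_split P S.
rewrite int_rfun int_pfun Ja in JP; rewrite int_rfun int_pfun Jc in JS.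
rewrite int_rfun int_pfun Jb in JPS.
have fQ P' (x : R) : JJ Q C0 P' P' = x%:E -> exists2 q : R, 0 <= q & (\int[P']_x (Q x / 4)%:E = q%:E)%E.
  move=> Jx; have := Q_le_JJ Q0 cQ KQ P'; rewrite Jx.
  have : (0 <= \int[P']_x (Q x / 4)%:E)%E by apply: integral_ge0 => y _; rewrite lee_fin divr_ge0.
  by case: (\int[_]_x _)%E => [q| |]// q0 _; exists q.
have [q1 q10 Q1] := fQ P a Ja; have [q2 q20 Q2] := fQ S c' Jc.
have mQ4 : measurable_fun setT (fun x => (Q x / 4)%:E) by apply/measurable_EFinP; exact: measurable_funM.
have Q40 x : (0 <= (Q x / 4)%:E)%E by rewrite lee_fin divr_ge0.
have cC2 : 0 <= (c + C0) / 2 by rewrite divr_ge0.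
have fU P' q : (\int[P']_x (Q x / 4)%:E = q%:E)%E -> U P' = (2 * q + (c + C0) / 2)%:E.
  move=> h; rewrite EFinD EFinM -h -ge0_integralZl// -(integralDr_cst P' _ cC2); last 2 first.
  - exact: measurable_funeM.
  - by move=> x; rewrite -EFinM lee_fin addr_ge0// mulr_ge0// divr_ge0.
  by apply: eq_integral => x _; rewrite -EFinM -EFinD; congr EFin; field.
rewrite (fU _ _ Q1) in JP JPS; rewrite (fU _ _ Q2) in JS JPS.
have r1 : 0 <= fine (rfun (1 : R)) + C0 by rewrite addr_ge0// fine_ge0// rfun_ge0.
(* Finiteness of the mixed [rfun] energy propagates through [rgap], the three identities and [pgap]
   to the other integrals. *)
have fr : (\int[L]_t (w0 t * (1 - gauss_energy t P S))%:E < +oo)%E.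
  rewrite -int_rfun.
  apply: (@le_lt_trans _ _ (\int[P]_x ((Q x / 4)%:E + (fine (rfun (1%R : R)) + C0 + q2)%:E))%E); last first.
    rewrite integralDr_cst//; first by rewrite Q1 -EFinD ltry.
      exact: addr_ge0 r1 q20.
    by move=> x; rewrite adde_ge0// lee_fin (addr_ge0 r1).
  apply: ge0_le_integral => //.
  - by move=> x _; apply: integral_ge0.
  - by apply: (measurable_fun_fubini_tonelli_F _ mr2) => p; exact: r0.
  - by apply: emeasurable_funD => //; exact: measurable_cst.
  have xr0 x : 0 <= Q x / 4 + (fine (rfun (1%R : R)) + C0) by rewrite addr_ge0// divr_ge0.
  move=> x _; rewrite (_ : (_ + _)%E =
      \int[S]_y ((Q y / 4)%:E + (Q x / 4 + (fine (rfun (1%R : R)) + C0))%:E))%E; last first.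
    rewrite integralDr_cst//; first by rewrite Q2 -!EFinD; congr EFin; lra.
    by move=> y; rewrite adde_ge0// lee_fin.
  apply: ge0_le_integral => //.
  - exact: (measurableT_comp mr2 (pair1_measurable x)).
  - by apply: emeasurable_funD => //; exact: measurable_cst.
  move=> y _; apply: (le_trans (rfun_le x y)); rewrite -EFinD lee_fin; lra.
have i0 (f : R -> \bar R) : (forall t, 0 <= f t)%E -> (0 <= \int[L]_t f t)%E.
  by move=> f0; exact: integral_ge0.
have := i0 _ (w1g0 P P); have := i0 _ (w1g0 S S); have := i0 _ (w1g0 P S).
have := i0 _ (w0g0 P P); have := i0 _ (w0g0 S S); have := i0 _ (w0g0 P S).
have := i0 _ w1gap.
move: JP JS JPS fr pgap rgap.
move: (\int[L]_t (w1 t * gauss_energy t P P)%:E)%E (\int[L]_t (w1 t * gauss_energy t S S)%:E)%E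
  (\int[L]_t (w1 t * gauss_energy t P S)%:E)%E (\int[L]_t (w0 t * (1 - gauss_energy t P P))%:E)%E
  (\int[L]_t (w0 t * (1 - gauss_energy t S S))%:E)%E (\int[L]_t (w0 t * (1 - gauss_energy t P S))%:E)%E
  (\int[L]_t (w1 t * gauss_gap t P S)%:E)%E.
move=> pp ss ps rp rs rps G.
case: rps => [rps| |]//; case: rp => [rp| |]//; case: rs => [rs| |]//;
  case: pp => [pp| |]//; case: ss => [ss| |]//; case: ps => [ps| |]//; case: G => [G| |]//.
by rewrite -!EFinD !lee_fin => -[h1] [h2] [h3] _ [h4] h5 _ _ _ _ _ _ _; lra.
Qed.

(** Minimality against the midpoint reads a <= (a + c' + 2b)/4, which eliminates the mixed energy
    [b]. *)
Lemma energy_gap_min P S (a b c' : R) : is_equilibrium_measure Q P ->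
  JJ Q C0 P P = a%:E -> JJ Q C0 P S = b%:E -> JJ Q C0 S S = c'%:E ->
  (\int[L]_t (w1 t * gauss_gap t P S)%:E <= (2 * (c' - a))%:E)%E.
Proof.
move=> Pmin Ja Jb Jc; apply: (le_trans (energy_gap Ja Jb Jc)).
have [M HM] := probability_mixture P S.
have := JJ_min Q0 cQ C00 KQ M Pmin.
by rewrite Ja (JJ_mixture Q0 cQ KQ HM Ja Jb Jc) !lee_fin; lra.
Qed.

(** Only an integral over scales is controlled, so a good scale is found by averaging: on [T, 2T]
    the weight is at least 1/(4T), a mass of at least 1/4 whatever [T]. The term [zeta] makes the
    contradiction strict. *)
Lemma gauss_gap_small P S (a b c' T zeta : R) : is_equilibrium_measure Q P ->
  JJ Q C0 P P = a%:E -> JJ Q C0 P S = b%:E -> JJ Q C0 S S = c'%:E ->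
  1 <= T -> 0 < zeta ->
  exists2 t, T <= t <= 2 * T & gauss_gap t P S <= 8 * (c' - a) + zeta.
Proof.
move=> Pmin Ja Jb Jc T1 z0; apply: contrapT => H.
have T0 : 0 < T by lra.
set B := 8 * (c' - a) + zeta.
have ac : a <= c' by have := JJ_min Q0 cQ C00 KQ S Pmin; rewrite Ja Jc lee_fin.
have B0 : 0 < B by rewrite /B; lra.
have big t : T <= t <= 2 * T -> B <= gauss_gap t P S.
  by move=> tT; rewrite leNgt; apply/negP => h; apply: H; exists t => //; exact: ltW.
have gap0 t : 0 < t -> 0 <= gauss_gap t P S.
  move=> t0; have s0 : 0 < (Num.sqrt (4 * t))^-1 by rewrite invr_gt0 sqrtr_gt0 mulr_gt0.
  apply: (gauss_gap_ge0 s0); rewrite exprVn sqr_sqrtr ?mulr_ge0 ?(ltW t0)//.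
  by rewrite gtr0_norm//; field; rewrite gt_eqF.
have := energy_gap_min Pmin Ja Jb Jc; apply/negP; rewrite -ltNge.
apply: (@lt_le_trans _ _ (B / 4)%:E); first by rewrite lte_fin /B; lra.
have -> : (B / 4)%:E = (\int[lebesgue_measure]_(t in `[T, (2 * T)%R]) ((4 * T)^-1 * B)%:E)%E.
  rewrite integral_cst//= lebesgue_measure_itv/= lte_fin.
  have -> : T < 2 * T by lra.
  by rewrite -EFinB -EFinM; congr EFin; field; rewrite gt_eqF.
rewrite ge0_integral_onR; last 2 first.
- apply/measurable_EFinP; apply: measurable_funM; first exact: measurable_w1.
  exact: measurable_gauss_gap.
- move=> t; rewrite lee_fin /w1; case: ifPn => [t1|]; last by rewrite mul0r.
  have t0 : 0 < t by lra.
  by rewrite mulr_ge0 ?gap0// invr_ge0 mulr_ge0 ?(ltW t0).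
rewrite integral_mkcond; apply: ge0_le_integral => //.
- move=> t _; rewrite patchE; case: ifP => // _.
  by rewrite lee_fin mulr_ge0 ?(ltW B0)// invr_ge0 mulr_ge0 ?(ltW T0).
- by apply/measurable_restrict => //; exact: measurable_cst.
- apply/measurable_EFinP; apply: measurable_funM; first exact: measurable_w1.
  exact: measurable_gauss_gap.
move=> t _; rewrite patchE mem_setE in_itv/=; case: ifPn => [tT|_]; last first.
  rewrite lee_fin /w1; case: ifPn => [t1|]; last by rewrite mul0r.
  have t0 : 0 < t by lra.
  by rewrite mulr_ge0 ?gap0// invr_ge0 mulr_ge0 ?(ltW t0).
rewrite lee_fin /w1; have /andP[tT1 tT2] := tT.
have -> : 1 <= t by lra.
apply: ler_pM; rewrite ?invr_ge0 ?mulr_ge0 ?(ltW T0) ?(ltW B0) ?big//.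
by rewrite lef_pV2 ?posrE; lra.
Qed.

End energy_gap.

(** * The Gibbs weight *)

Section weight_as_gibbs.
Context (R : realType) (d : nat) (Q : d.-tuple R -> R) (C0 : R).
Local Notation E := (d.-tuple R).
Hypothesis Q0 : forall x, 0 <= Q x.
Hypothesis cQ : continuous_Rd Q.
Hypothesis KQ : forall x y, x != y ->
  (Q x + Q y) / 4 <= - ln (edist x y) + Q x / 2 + Q y / 2 + C0.
Local Notation K := (KK Q C0).
Local Notation x0 := ([tuple of nseq d 0] : E).

Let K0 x y : (0 <= K x y)%E. Proof. exact: KK_ge0. Qed.

Definition vdm (s : seq E) : R :=
  \prod_(i < size s) \prod_(j < size s | (i < j)%N) edist (nth x0 s i) (nth x0 s j).

Lemma vdm_cons x s : vdm (x :: s) = (\prod_(y <- s) edist x y) * vdm s.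
Proof.
rewrite /vdm /= big_ord_recl/=; congr (_ * _).
  rewrite big_mkcond big_ord_recl/= mul1r (big_nth x0) big_mkord.
  by apply: eq_bigr => j _.
by apply: eq_bigr => i _; rewrite big_mkcond big_ord_recl/= mul1r -big_mkcond.
Qed.

(** [expeR] vanishes at [-oo], as does the distance of a point to itself, so the identity also holds
    on the diagonal. *)
Let expeR_NK x y : expeR (- K x y) = (edist x y * expR (- (Q x / 2 + Q y / 2 + C0)))%:E.
Proof.
have [->|xy] := eqVneq x y; first by rewrite KKxx edistxx mul0r.
rewrite KKE//= -[X in (X * _)%:E](@lnK R) ?posrE ?edist_gt0// -expRD.
by congr (expR _)%:E; ring.
Qed.

Let sumK0 x s : (0 <= \sum_(y <- s) K x y)%E. Proof. exact: sume_ge0. Qed.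

Let expeR_Nsum x s : expeR (- (\sum_(y <- s) K x y)%E) =
  ((\prod_(y <- s) edist x y) *
   expR (- ((size s)%:R * (Q x / 2 + C0) + (\sum_(y <- s) Q y) / 2)))%:E.
Proof.
elim: s => [|y s IH].
  by rewrite !big_nil/= oppr0 !mul0r addr0 oppr0 expR0 mulr1.
rewrite !big_cons oppeD ?ge0_adde_def ?inE// expeRD IH expeR_NK -EFinM/= mulrACA -expRD.
by rewrite -natr1; congr (_ * expR _)%:E; field.
Qed.

Let expeR_Npairsum s : expeR (- pairsum K s) =
  (vdm s * expR (- (((size s)%:R - 1) * ((\sum_(y <- s) Q y) / 2 + (size s)%:R * C0 / 2))))%:E.
Proof.
elim: s => [|x s IH].
  by rewrite /vdm/= !big_ord0 big_nil !mul0r addr0 mulr0 oppr0 expR0 mulr1.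
rewrite /= oppeD; last by rewrite ge0_adde_def ?inE ?pairsum_ge0.
rewrite expeRD IH expeR_Nsum -EFinM/= mulrACA -expRD vdm_cons big_cons -natr1.
by congr (_ * expR _)%:E; field.
Qed.

(** Each point lies in n - 1 pairs, each giving it Q/2 and counted twice, so the pairs carry n - 1
    times the sum of [Q]. The separate sum completes this to the factor [n] of the weight, and
    supplies an integrable factor exp(-Q) per particle. *)
Definition ham (s : seq E) : \bar R :=
  ((\sum_(y <- s) Q y)%:E + (pairsum K s + pairsum K s))%E.

Lemma ham_ge0 s : (0 <= ham s)%E.
Proof. by rewrite /ham !adde_ge0 ?pairsum_ge0// lee_fin sumr_ge0. Qed.

(** Compensates the constant [C0] of the n(n - 1)/2 pairs, each counted twice. *)
Definition wcst (n : nat) : R := expR (n%:R * (n%:R - 1) * C0).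

Lemma weightE n s : size s = n -> (weight Q n s)%:E = ((wcst n)%:E * expeR (- ham s))%E.
Proof.
move=> <-; rewrite /ham oppeD; last by rewrite ge0_adde_def ?inE ?lee_fin ?sumr_ge0// adde_ge0 ?pairsum_ge0.
rewrite oppeD; last by rewrite ge0_adde_def ?inE ?pairsum_ge0.
rewrite !expeRD expeR_Npairsum /= -!EFinM; congr EFin; rewrite /weight.
have -> : \prod_(i < size s) \prod_(j < size s | (i < j)%N)
    edist (nth x0 s i) (nth x0 s j) ^+ 2 = vdm s * vdm s.
  rewrite /vdm -expr2 -prodrXl; apply: eq_bigr => i _; exact: prodrXl.
have -> : expR (- ((size s)%:R * \sum_(y <- s) Q y)) = wcst (size s) * expR (- \sum_(y <- s) Q y) *
    (expR (- (((size s)%:R - 1) * ((\sum_(y <- s) Q y) / 2 + (size s)%:R * C0 / 2))) *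
     expR (- (((size s)%:R - 1) * ((\sum_(y <- s) Q y) / 2 + (size s)%:R * C0 / 2)))).
  by rewrite /wcst -!expRD; congr expR; field.
ring.
Qed.

Lemma weight_ge0 n s : 0 <= weight Q n s.
Proof.
rewrite mulr_ge0 ?expR_ge0//; apply: prodr_ge0 => i _; apply: prodr_ge0 => j _.
exact: sqr_ge0.
Qed.

Lemma wcst_gt0 n : 0 < wcst n. Proof. exact: expR_gt0. Qed.

Lemma weight_le n s (a : R) : size s = n -> (a%:E <= pairsum K s + pairsum K s)%E ->
  weight Q n s <= wcst n * expR (- a) * \prod_(y <- s) expR (- Q y).
Proof.
move=> sn aK; rewrite -lee_fin (weightE sn) -mulrA EFinM lee_wpmul2l ?lee_fin ?expR_ge0//.
have -> : (expR (- a) * \prod_(y <- s) expR (- Q y))%:E = expeR (- (a%:E + (\sum_(y <- s) Q y)%:E)).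
  by rewrite /= opprD expRD -sumrN expR_sum.
by rewrite lee_expeR leeN2 /ham addeC leeD2l.
Qed.

(** The tangent to the exponential at [- h]. Integrated against a law under which the mean of [ham]
    is at most [h], it gives Jensen's lower bound. *)
Lemma weight_jensen n s (h : R) : size s = n ->
  ((wcst n * expR (- h) * (1 + h))%:E <=
    (weight Q n s)%:E + (wcst n * expR (- h))%:E * ham s)%E.
Proof.
move=> sn; rewrite (weightE sn); have := ham_ge0 s.
have c0 : 0 < wcst n * expR (- h) by rewrite mulr_gt0 ?wcst_gt0 ?expR_gt0.
case: (ham s) => [r| |]//; last by rewrite /= mule0 add0e gt0_muley ?lte_fin// !leey.
rewrite !lee_fin => r0.
rewrite -!mulrA -mulrDr ler_wpM2l ?(ltW (wcst_gt0 _))//.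
have -> : - r = - h + (h - r) by ring.
rewrite expRD -mulrDr ler_wpM2l ?expR_ge0//.
by have := @expR_ge1Dx R (h - r); lra.
Qed.

Lemma pairsum_insert (f : E -> E -> \bar R) s1 t s2 : (forall x y, f x y = f y x) ->
  (pairsum f (s1 ++ t :: s2) = \sum_(y <- s1 ++ s2) f t y + pairsum f (s1 ++ s2))%E.
Proof.
move=> fC; elim: s1 => //= x s1 ->.
rewrite !big_cat/= !big_cons (fC t x) !big_cat/=.
by rewrite (addeCA (\sum_(i <- s1) f x i)%E) addeACA.
Qed.

Lemma weight_insert n i t (v : seq E) : (size v).+1 = n ->
  weight Q n (take i v ++ t :: drop i v) = weight Q n (t :: v).
Proof.
move=> vn.
have s1 : size (take i v ++ t :: drop i v) = n.
  by rewrite size_cat/= addnS -size_cat cat_take_drop.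
apply/EFin_inj; rewrite (weightE s1) (weightE (s := t :: v) vn); congr (_ * expeR (- _))%E.
have ps : pairsum K (take i v ++ t :: drop i v) = pairsum K (t :: v).
  by rewrite pairsum_insert ?cat_take_drop// => x y; exact: KKC.
rewrite /ham ps; congr (EFin _ + _)%E.
by rewrite big_cat/= !big_cons addrCA -big_cat cat_take_drop.
Qed.

Lemma measurable_weight n m : measurable_fun setT (fun v : m.-tuple E => weight Q n v).
Proof.
have mQ : measurable_fun setT Q by exact: continuous_Rd_measurable.
rewrite (_ : (fun v => _) = fun v : m.-tuple E => expR (- (n%:R * \sum_(i < m) Q (tnth v i))) *
    \prod_(i < m) \prod_(j < m) (if (i < j)%N then edist (tnth v i) (tnth v j) ^+ 2 else 1)).
  apply: measurable_funM.
    apply: measurable_expRN; apply: measurable_funM => //.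
    apply: measurable_sum => i; exact: (measurableT_comp mQ (measurable_tnth i)).
  apply: measurable_prod => i _; apply: measurable_prod => j _.
  case: (i < j)%N => //; apply: measurable_funX.
  by apply: measurable_edist; exact: measurable_tnth.
apply/funext => v; rewrite /weight size_tuple big_tuple; congr (_ * _).
apply: eq_bigr => i _; rewrite -big_mkcond; apply: eq_bigr => j _.
by rewrite -!tnth_nth.
Qed.

End weight_as_gibbs.

(** * Lower bound for the partition function *)

Lemma ex_natr_ge (R : realType) (x : R) : exists N : nat, forall n, (N <= n)%N -> x <= n%:R.
Proof. by have [N _ HN] := nbhs_infty_ger x; exists N => n Nn; exact: HN. Qed.

Section prod_cauchy.
Context (R : realType) (d : nat).

Lemma measurable_prod_cauchy :
  measurable_fun setT (fun v : d.-tuple R => \prod_(i < d) cauchy (tnth v i)).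
Proof.
apply: measurable_prod => i _; exact: (measurableT_comp (@measurable_cauchy R) (measurable_tnth i)).
Qed.

Lemma integral_prod_cauchy :
  (\int[Lebd R d]_x (\prod_(i < d) cauchy (tnth x i))%:E < +oo)%E.
Proof.
have mc (i : nat) : measurable_fun setT (fun t : R => (cauchy t)%:E).
  by apply/measurable_EFinP; exact: measurable_cauchy.
have c0 t : (0 <= (cauchy t : R)%:E)%E by rewrite lee_fin cauchy_ge0.
under eq_integral do rewrite -prodEFin.
rewrite (@ge0_integral_prod _ _ _ (Leb1 R) d (fun _ t => (cauchy t)%:E))//.
have := integral_cauchy R; have := @integral_ge0 _ _ _ (Leb1 R) setT _ (fun x _ => c0 x).
case: (\int[_]_x _)%E => [r| |]// _ _.
by rewrite prodEFin ltry.
Qed.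

End prod_cauchy.

Section exp_potential.
Context (R : realType) (d : nat) (Q : d.-tuple R -> R).
Hypothesis cQ : continuous_Rd Q.
Hypothesis lnQ : forall th, 0 < th ->
  exists2 C : R, 0 <= C & forall x, ln (1 + enorm x) <= th * Q x + C.

Lemma expNQ_le : exists2 C : R, 0 <= C & forall x : d.-tuple R,
  expR (- Q x) <= C * \prod_(i < d) cauchy (tnth x i).
Proof.
(* 2d powers of 1 + |x| dominate the product of the 1 + x_i^2; the successor keeps [N] positive in
   every dimension. *)
pose N := (2 * d).+1; have N0 : 0 < N%:R :> R by rewrite ltr0n.
have [C C0 HC] := @lnQ N%:R^-1 ltac:(by rewrite invr_gt0).
exists (expR (N%:R * C)) => [|x]; first exact: expR_ge0.
have r0 := enorm_ge0 x; have r1 : 0 < 1 + enorm x by lra.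
have h1 : (1 + enorm x) ^+ N <= expR (Q x + N%:R * C).
  rewrite -[X in X ^+ _](@lnK R) ?posrE// -expRM_natl ler_expR.
  have := ler_wpM2l (ltW N0) (HC x).
  by rewrite mulrDr mulrA divff ?gt_eqF// mul1r mulr_natl.
have h2 : \prod_(i < d) (1 + (tnth x i) ^+ 2) <= (1 + enorm x) ^+ N.
  apply: (@le_trans _ _ (\prod_(i < d) (1 + enorm x) ^+ 2)); last first.
    rewrite prodr_const card_ord -exprM /N exprS ler_peMl ?exprn_ge0 ?(ltW r1)//.
    by rewrite lerDl.
  apply: ler_prod => i _; rewrite addr_ge0 ?sqr_ge0//=.
  have xi : `|tnth x i| <= enorm x.
    rewrite enormE; apply: le_trans (coord_le_edist _ _ i).
    by rewrite (tnth_nth 0 [tuple of nseq d 0])/= nth_nseq if_same subr0.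
  rewrite -real_normK ?num_real//.
  have := ler_pM (normr_ge0 _) (normr_ge0 _) xi xi; rewrite -!expr2; lra.
rewrite /cauchy prodfV.
have p0 : 0 < \prod_(i < d) (1 + (tnth x i) ^+ 2).
  by apply: prodr_gt0 => i _; rewrite ltr_pwDl// sqr_ge0.
rewrite ler_pdivlMr//.
apply: (@le_trans _ _ (expR (- Q x) * expR (Q x + N%:R * C))).
  by rewrite ler_wpM2l ?expR_ge0// (le_trans h2).
by rewrite -expRD addKr.
Qed.

Lemma measurable_expNQ : measurable_fun setT (fun x => expR (- Q x)).
Proof. by apply: measurable_expRN; exact: continuous_Rd_measurable. Qed.

Lemma integral_expNQ : (\int[Lebd R d]_x (expR (- Q x))%:E < +oo)%E.
Proof.
have [C C0 HC] := expNQ_le.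
apply: (@le_lt_trans _ _ (\int[Lebd R d]_x (C%:E * (\prod_(i < d) cauchy (tnth x i))%:E))%E).
  apply: ge0_le_integral => //.
  - by apply/measurable_EFinP; exact: measurable_expNQ.
  - by apply: measurable_funeM; apply/measurable_EFinP; exact: measurable_prod_cauchy.
  by move=> x _; rewrite -EFinM lee_fin.
have p0 (x : d.-tuple R) : (0 <= (\prod_(i < d) cauchy (tnth x i))%:E)%E.
  by rewrite lee_fin prodr_ge0// => i _; exact: cauchy_ge0.
rewrite ge0_integralZl//; last by apply/measurable_EFinP; exact: measurable_prod_cauchy.
have := integral_prod_cauchy R d; have : (0 <= \int[Lebd R d]_x (\prod_(i < d) cauchy (tnth x i))%:E)%E.
  exact: integral_ge0.
by case: (\int[_]_x _)%E => [r| |]// _ _; rewrite -EFinM ltry.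
Qed.

End exp_potential.

Section partition_function.
Context (R : realType) (d : nat) (Q : d.-tuple R -> R) (C0 : R).
Local Notation E := (d.-tuple R).
Hypothesis Q0 : forall x, 0 <= Q x.
Hypothesis cQ : continuous_Rd Q.
Hypothesis C00 : 0 <= C0.
Hypothesis KQ : forall x y, x != y ->
  (Q x + Q y) / 4 <= - ln (edist x y) + Q x / 2 + Q y / 2 + C0.
Hypothesis QS : forall e, 0 < e ->
  exists2 dl : R, 0 < dl & forall x y, edist x y <= dl -> Q y <= (1 + e) * Q x + e.
Hypothesis d0 : (0 < d)%N.
Hypothesis intQ : (\int[Lebd R d]_x (expR (- Q x))%:E < +oo)%E.
Variable mu : probability E R.
Hypothesis muQ : is_equilibrium_measure Q mu.
Local Notation K := (KK Q C0).
Local Notation J := (JJ Q C0).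

Let K0 x y : (0 <= K x y)%E. Proof. exact: KK_ge0. Qed.

Let mQ : measurable_fun setT Q. Proof. exact: continuous_Rd_measurable. Qed.

(** Minimality by itself would allow infinite energy; a smeared point mass is a competitor of finite
    energy. *)
Lemma JJ_equilibrium_fin : J mu mu \is a fin_num.
Proof.
have [dl0 /andP[dl00 dl01] [HQ _]] := noise2_KK Q0 cQ C00 KQ QS d0 (@ltr01 R).
pose x0 : E := [tuple of nseq d 0].
have [P HP] := @probability_empirical _ _ R 1 [tuple x0] isT.
have [S HS] := probability_smear P dl0.
rewrite ge0_fin_numE ?JJ_ge0//; apply: le_lt_trans (JJ_min Q0 cQ C00 KQ S muQ) _.
rewrite (JJ_smear Q0 cQ KQ HS HS).
have mU := measurable_noise2K Q0 cQ KQ dl0.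
have U0 := noise2K_ge0 Q0 KQ dl0.
have e x : (\int[P]_y noise2K Q C0 dl0 x y = noise2K Q C0 dl0 x x0)%E.
  rewrite HP//; first by rewrite invr1 mul1e big_seq1.
  exact: (measurableT_comp mU (pair1_measurable x)).
under eq_integral do rewrite e.
rewrite HP//; last exact: (measurableT_comp mU (pair2_measurable x0)).
rewrite invr1 mul1e big_seq1.
by apply: le_lt_trans (noise2_KK_le Q0 cQ C00 KQ d0 ltr01 dl00 dl01 HQ _ _) (ltry _).
Qed.

Let j : R := fine (J mu mu).

Let jE : J mu mu = j%:E. Proof. by rewrite fineK// JJ_equilibrium_fin. Qed.

Lemma JJ_smear_le (P S : probability E R) (e dl : R) : 0 < e ->
  (forall x y, (noise2K Q C0 dl x y <= (1 + e)%:E * K x y + e%:E)%E) ->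
  is_smear P dl S ->
  (J S S <= (1 + e)%:E * J P P + e%:E)%E.
Proof.
move=> e0 He HS; rewrite (JJ_smear Q0 cQ KQ HS HS).
have e1 : (0 <= (1 + e)%:E)%E by rewrite lee_fin; lra.
have mK : measurable_fun setT (fun p : E * E => K p.1 p.2) by exact: measurable_KK.
have mKx x : measurable_fun setT (K x) by exact: (measurableT_comp mK (pair1_measurable x)).
have mU := measurable_noise2K Q0 cQ KQ dl.
have U0 := noise2K_ge0 Q0 KQ dl.
rewrite /JJ -ge0_integralZl//; last 2 first.
- exact: measurable_intK.
- by move=> x _; exact: integral_ge0.
have mi : measurable_fun setT (fun x => (1 + e)%:E * \int[P]_y K x y)%E.
  by apply: measurable_funeM; exact: measurable_intK.
have i0 x : (0 <= (1 + e)%:E * \int[P]_y K x y)%E by rewrite mule_ge0// integral_ge0.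
rewrite -(integralDr_cst P mi (ltW e0)); last by move=> x; rewrite adde_ge0// lee_fin ltW.
apply: ge0_le_integral => //.
- by move=> x _; exact: integral_ge0.
- by apply: (measurable_fun_fubini_tonelli_F _ mU) => p; exact: U0.
- by apply: emeasurable_funD => //; exact: measurable_cst.
move=> x _; rewrite -ge0_integralZl// -(integralDr_cst P _ (ltW e0)); last 2 first.
- exact: measurable_funeM.
- by move=> y; rewrite adde_ge0 ?mule_ge0// lee_fin ltW.
apply: ge0_le_integral => //.
- exact: (measurableT_comp mU (pair1_measurable x)).
- by apply: emeasurable_funD; [exact: measurable_funeM|exact: measurable_cst].
Qed.

Local Notation Ln n := (tpm (Lebd R d) n).

Let mW n m : measurable_fun setT (fun v : m.-tuple E => (weight Q n v)%:E).
Proof. by apply/measurable_EFinP; exact: measurable_weight. Qed.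

Let W0 n v : (0 <= (weight Q n v)%:E)%E. Proof. by rewrite lee_fin weight_ge0. Qed.

(** Jensen's inequality for [n] independent points of law [S]: in [h], the mean of each [Q] is at
    most 4s by [Q_le_JJ], and the pairs counted twice number at most n^2. *)
Let lower_trial (S : probability E R) (s : R) n : J S S = s%:E ->
  ((wcst C0 n * expR (- (4 * n%:R * s + n%:R ^+ 2 * s)))%:E <=
    \int[tpm S n]_v (weight Q n v)%:E)%E.
Proof.
move=> Js; set h := _ + _.
have s0 : 0 <= s by rewrite -lee_fin -Js JJ_ge0.
have S1 : (S : {sigma_finite_measure set E -> \bar R}) setT = 1%E by exact: probability_setT.
have mK : measurable_fun setT (fun p : E * E => K p.1 p.2) by exact: measurable_KK.
have mE : measurable_fun setT (EFin \o Q) by exact/measurable_EFinP.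
have mps : measurable_fun setT (fun v : n.-tuple E => pairsum K v) by exact: measurable_pairsum.
have mpp : measurable_fun setT (fun v : n.-tuple E => pairsum K v + pairsum K v)%E.
  exact: emeasurable_funD.
have ps0 (v : seq E) : (0 <= pairsum K v)%E by exact: pairsum_ge0.
have msq : measurable_fun setT (fun v : n.-tuple E => (\sum_(y <- v) Q y)%:E).
  rewrite (_ : (fun v => _) = fun v : n.-tuple E => (\sum_(y <- v) (Q y)%:E)%E).
    exact: measurable_sum_tuple.
  by apply/funext => v; rewrite sumEFin.
have sq0 (v : seq E) : (0 <= (\sum_(y <- v) Q y)%:E)%E by rewrite lee_fin sumr_ge0.
have mham : measurable_fun setT (fun v : n.-tuple E => ham Q C0 v) by exact: emeasurable_funD.
have hS : (\int[tpm S n]_v ham Q C0 v <= h%:E)%E.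
  rewrite /ham ge0_integralD//; last by move=> v _; rewrite adde_ge0.
  rewrite ge0_integralD// (ge0_integral_pairsum S1)//.
  under eq_integral do rewrite -sumEFin.
  rewrite (@ge0_integral_sum_tuple _ _ _ _ S1 n (EFin \o Q))//=.
  rewrite -[X in (_ + (_ * X + _))%E]/(J S S) -[X in (_ + (_ + _ * X))%E]/(J S S) Js.
  have Q4 : (\int[S]_x (Q x)%:E <= (4 * s)%:E)%E.
    rewrite EFinM -Js (_ : \int[S]_x _ = 4%:E * \int[S]_x (Q x / 4)%:E)%E.
      by rewrite lee_wpmul2l ?lee_fin// Q_le_JJ.
    rewrite -ge0_integralZl//.
    - by apply: eq_integral => x _; rewrite -EFinM; congr EFin; field.
    - by apply/measurable_EFinP; exact: measurable_funM.
    - by move=> x _; rewrite lee_fin divr_ge0.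
  rewrite /h EFinD; apply: leeD.
    by rewrite (mulrC 4) -mulrA EFinM lee_wpmul2l// lee_fin.
  rewrite -!EFinM -EFinD lee_fin -mulrDl ler_wpM2r// -natrD -natrX ler_nat bin2; lia.
have h0 : 0 <= h by rewrite /h addr_ge0 ?mulr_ge0 ?sqr_ge0.
set c := wcst C0 n * expR (- h).
have c0 : 0 <= c by rewrite mulr_ge0 ?expR_ge0// ltW ?wcst_gt0.
have int : ((c * (1 + h))%:E <= \int[tpm S n]_v (weight Q n v)%:E + c%:E * \int[tpm S n]_v ham Q C0 v)%E.
  rewrite -ge0_integralZl//; last by move=> v _; exact: ham_ge0.
  have ch0 v : (0 <= c%:E * ham Q C0 v)%E by rewrite mule_ge0 ?lee_fin// ham_ge0.
  rewrite -ge0_integralD//; last 2 first.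
  - exact: mW.
  - exact: measurable_funeM.
  rewrite -[leLHS]mule1 -(tpm_setT S1 n) -integral_cst//.
  apply: ge0_le_integral => //.
  - by move=> v _; rewrite lee_fin mulr_ge0// addr_ge0.
  - by apply: emeasurable_funD; [exact: mW|exact: measurable_funeM].
  by move=> v _; apply: weight_jensen => //; rewrite size_tuple.
have := le_trans int (leeD2l _ (lee_wpmul2l _ hS)); rewrite lee_fin => /(_ c0).
case: (\int[_]_v _)%E => [r| |]//; last by move=> _; exact: leey.
by rewrite -EFinM -EFinD !lee_fin mulrDr mulr1 lerD2r.
Qed.

Lemma partition_lower (eta : R) : 0 < eta -> exists N, forall n, (N <= n)%N ->
  ((wcst C0 n * expR (- (n%:R ^+ 2 * (j + eta))))%:E <= \int[Ln n]_v (weight Q n v)%:E)%E.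
Proof.
move=> eta0.
have j0 : 0 <= j by rewrite -lee_fin -jE JJ_ge0.
(* Chosen so that (1 + e) j + e = j + eta/2; the other half of [eta] pays for the terms linear in
   [n], namely 4 n s and the logarithm of the density factor. *)
pose e := eta / 2 / (j + 1).
have e0 : 0 < e by rewrite /e divr_gt0//; lra.
have ej : e * j + e = eta / 2 by rewrite /e; field; rewrite gt_eqF//; lra.
have [dl /andP[dl0 dl1] [_ Hdl]] := noise2_KK Q0 cQ C00 KQ QS d0 e0.
have [S HS] := probability_smear mu dl.
have Hdl' := Hdl dl; rewrite dl0 lexx/= in Hdl'.
have := JJ_smear_le e0 (Hdl' isT) HS; rewrite jE -EFinM -EFinD => Sle.
have [s Js s0] : exists2 s, J S S = s%:E & 0 <= s.
  have := JJ_ge0 Q0 KQ S S; move: Sle; case: (J S S) => [s| |]// _.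
  by rewrite lee_fin => s0; exists s.
have sle : s <= j + eta / 2 by move: Sle; rewrite Js lee_fin; lra.
have dom n := @tpm_dominated _ _ _ S (Lebd R d) (dl ^+ d) n.
have [N HN] := ex_natr_ge (2 * (4 * s - ln (dl ^+ d)) / eta).
exists N => n Nn.
have c0 : 0 < dl ^+ d by rewrite exprn_gt0.
have D : (((dl ^+ d) ^+ n)%:E * \int[tpm S n]_v (weight Q n v)%:E <= \int[Ln n]_v (weight Q n v)%:E)%E.
  refine (dom n (fun v => (weight Q n v)%:E) (ltW c0) _ (@mW n n) (fun v => W0 n v)).
  move=> G mG G0; rewrite HS// -ge0_integralZl//; last 3 first.
  - apply: (measurable_fun_fubini_tonelli_F (fun p => G (shift dl p.1 p.2))) => //.
    by apply: (measurableT_comp mG); exact: measurable_shift.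
  - by move=> x _; exact: integral_ge0.
  - by rewrite lee_fin ltW.
  rewrite -[leRHS](probability_integral_cst mu); apply: ge0_le_integral => //.
  - by move=> x _; rewrite mule_ge0 ?lee_fin ?(ltW c0)// integral_ge0.
  - apply: measurable_funeM.
    apply: (measurable_fun_fubini_tonelli_F (fun p => G (shift dl p.1 p.2))) => //.
    by apply: (measurableT_comp mG); exact: measurable_shift.
  by move=> x _; exact: noise_dom.
apply: le_trans _ D.
apply: (@le_trans _ _ (((dl ^+ d) ^+ n)%:E *
    (wcst C0 n * expR (- (4 * n%:R * s + n%:R ^+ 2 * s)))%:E)%E); last first.
  apply: lee_wpmul2l; first by rewrite lee_fin exprn_ge0// ltW.
  exact: lower_trial.
rewrite -EFinM lee_fin mulrCA ler_wpM2l ?(ltW (wcst_gt0 _ _))//.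
rewrite -[X in X ^+ n](@lnK R) ?posrE// -expRM_natl -expRD ler_expR.
have := HN n Nn; rewrite ler_pdivrMr// => hN.
have n0 : 0 <= n%:R :> R by [].
have := ler_wpM2l n0 hN; have := ler_wpM2l (mulr_ge0 n0 n0) sle.
by rewrite -mulr_natl; nra.
Qed.

Let B : R := fine (\int[Lebd R d]_x (expR (- Q x))%:E).

Let BE : (\int[Lebd R d]_x (expR (- Q x))%:E)%E = B%:E.
Proof. by rewrite fineK// ge0_fin_numE// integral_ge0// => x _; rewrite lee_fin expR_ge0. Qed.

Let B0 : 0 <= B.
Proof. by rewrite -lee_fin -BE integral_ge0// => x _; rewrite lee_fin expR_ge0. Qed.

Let mexpQ : measurable_fun setT (fun x => (expR (- Q x))%:E).
Proof. by apply/measurable_EFinP; exact: measurable_expNQ. Qed.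

Let mprod n : measurable_fun setT (fun v : n.-tuple E => (\prod_(y <- v) expR (- Q y))%:E).
Proof.
rewrite (_ : (fun v => _) = fun v : n.-tuple E => (\prod_(i < n) (expR (- Q (tnth v i)))%:E)%E).
  by apply: emeasurable_prod => i; exact: (measurableT_comp mexpQ (measurable_tnth i)).
by apply/funext => v; rewrite prodEFin big_tuple.
Qed.

Let int_prod n : (\int[Ln n]_v (\prod_(y <- v) expR (- Q y))%:E = (B ^+ n)%:E)%E.
Proof.
under eq_integral do rewrite big_tuple -prodEFin.
rewrite (@ge0_integral_prod _ _ _ (Lebd R d) n (fun _ x => (expR (- Q x))%:E))//.
by rewrite BE prodEFin prodr_const card_ord.
Qed.

Lemma partition_fin n : (\int[Ln n]_v (weight Q n v)%:E < +oo)%E.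
Proof.
apply: (@le_lt_trans _ _ (\int[Ln n]_v ((wcst C0 n)%:E * (\prod_(y <- v) expR (- Q y))%:E))%E).
  apply: ge0_le_integral => //.
  - exact: mW.
  - apply: measurable_funeM; exact: mprod.
  move=> v _; rewrite -EFinM lee_fin.
  have := @weight_le _ _ _ _ Q0 KQ n v 0; rewrite size_tuple oppr0 expR0 mulr1; apply=> //.
  by rewrite adde_ge0// pairsum_ge0.
rewrite ge0_integralZl//.
- by rewrite int_prod -EFinM ltry.
- exact: mprod.
- by move=> v _; rewrite lee_fin prodr_ge0// => y _; exact: expR_ge0.
- by rewrite lee_fin ltW ?wcst_gt0.
Qed.

(** Phrased as a comparison of [G] and [G'] rather than as the probability of an event: on bad
    configurations [weight_le] bounds the weight, and the loss is measured directly against the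
    partition function. *)
Lemma partition_conc (eta kappa : R) : 0 < eta -> 0 < kappa ->
  exists N, forall n, (N <= n)%N -> forall (G G' : n.-tuple E -> R) (M : R),
  measurable_fun setT G -> measurable_fun setT G' ->
  (forall v, 0 <= G v <= M) -> (forall v, 0 <= G' v) ->
  (forall v : n.-tuple E,
    (pairsum K v + pairsum K v < (n%:R ^+ 2 * (j + 2 * eta))%:E)%E -> G v <= G' v) ->
  (\int[Ln n]_v (G v * weight Q n v)%:E <= \int[Ln n]_v (G' v * weight Q n v)%:E +
    (M * kappa)%:E * \int[Ln n]_v (weight Q n v)%:E)%E.
Proof.
move=> eta0 k0; have [N1 HN1] := partition_lower eta0.
(* For these [n], B^n exp(-n^2 eta) is at most exp(-n), which [N3] makes at most [kappa]. *)
have [N2 HN2] := ex_natr_ge ((B + 1) / eta).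
have [N3 HN3] := ex_natr_ge kappa^-1.
exists (maxn N1 (maxn N2 N3)) => n; rewrite !geq_max => /andP[n1 /andP[n2 n3]].
move=> G G' M mG mG' GM G'0 GG'.
have M0 : 0 <= M by have /andP[g0] := GM [tuple of nseq n [tuple of nseq d 0]]; exact: le_trans.
set a := n%:R ^+ 2 * (j + 2 * eta).
set c := wcst C0 n * expR (- a).
have c0 : 0 <= c by rewrite mulr_ge0 ?expR_ge0// ltW ?wcst_gt0.
have small : c * B ^+ n <= kappa * (wcst C0 n * expR (- (n%:R ^+ 2 * (j + eta)))).
  rewrite /c mulrCA -mulrA ler_wpM2l ?(ltW (wcst_gt0 _ _))//.
  have Bn : B ^+ n <= expR (n%:R * B).
    rewrite mulrC expRM_natr lerXn2r ?nnegrE ?expR_ge0//.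
    by have := @expR_ge1Dx R B; lra.
  apply: (le_trans (ler_wpM2l (expR_ge0 _) Bn)).
  have kn : expR (- n%:R) <= kappa.
    have nk := HN3 n n3.
    have e1 := @expR_ge1Dx R n%:R.
    rewrite expRN -[leRHS]invrK lef_pV2 ?posrE ?expR_gt0 ?invr_gt0//; lra.
  apply: le_trans (ler_wpM2r (expR_ge0 _) kn).
  rewrite -!expRD ler_expR /a.
  have := HN2 n n2; rewrite ler_pdivrMr// => h2.
  have n0 : 0 <= n%:R :> R by [].
  by have := ler_wpM2l n0 h2; rewrite expr2; lra.
have pr0 (v : seq E) : 0 <= \prod_(y <- v) expR (- Q y).
  by apply: prodr_ge0 => y _; exact: expR_ge0.
have mGw (F : n.-tuple E -> R) : measurable_fun setT F ->
    measurable_fun setT (fun v => (F v * weight Q n v)%:E).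
  by move=> mF; apply/measurable_EFinP; apply: measurable_funM => //; exact: measurable_weight.
apply: (@le_trans _ _ (\int[Ln n]_v ((G' v * weight Q n v)%:E +
    (M * c)%:E * (\prod_(y <- v) expR (- Q y))%:E))%E).
  apply: ge0_le_integral => //.
  - by move=> v _; rewrite lee_fin mulr_ge0 ?weight_ge0//; case/andP: (GM v).
  - exact: mGw.
  - by apply: emeasurable_funD; [exact: mGw|apply: measurable_funeM; exact: mprod].
  move=> v _; rewrite -EFinM -EFinD lee_fin.
  have Mc0 : 0 <= M * c * \prod_(y <- v) expR (- Q y) by exact: mulr_ge0 (mulr_ge0 M0 c0) (pr0 v).
  have [good|bad] := ltP (pairsum K v + pairsum K v)%E a%:E.
    have := ler_wpM2r (weight_ge0 Q n v) (GG' v good); lra.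
  have sn : size v = n by rewrite size_tuple.
  have := ler_pM _ (weight_ge0 Q n v) _ (weight_le Q0 KQ sn bad).
  case/andP: (GM v) => g0 gM => /(_ _ _ g0 gM).
  have := mulr_ge0 (G'0 v) (weight_ge0 Q n v); rewrite -/c mulrA; lra.
rewrite ge0_integralD//; last 4 first.
- by move=> v _; rewrite lee_fin mulr_ge0 ?weight_ge0.
- exact: mGw.
- by move=> v _; rewrite mule_ge0// lee_fin// mulr_ge0.
- apply: measurable_funeM; exact: mprod.
apply: leeD2l; rewrite ge0_integralZl//; last 3 first.
- exact: mprod.
- by move=> v _; rewrite lee_fin.
- by rewrite lee_fin mulr_ge0.
rewrite int_prod !EFinM -!muleA lee_wpmul2l ?lee_fin//.
apply: (@le_trans _ _ (kappa%:E * (wcst C0 n * expR (- (n%:R ^+ 2 * (j + eta))))%:E)%E).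
  by rewrite -!EFinM lee_fin mulrA.
by rewrite lee_wpmul2l ?lee_fin ?(ltW k0)// HN1.
Qed.

End partition_function.

(** * Energy of empirical measures *)

Lemma bin2_le n : ('C(n, 2) * 2 <= n ^ 2)%N.
Proof. by rewrite bin2; lia. Qed.

Section empirical.
Context (R : realType) (d : nat) (Q : d.-tuple R -> R) (C0 c : R).
Local Notation E := (d.-tuple R).
Local Notation L := (Leb1 R).
Hypothesis Q0 : forall x, 0 <= Q x.
Hypothesis cQ : continuous_Rd Q.
Hypothesis C00 : 0 <= C0.
Hypothesis KQ : forall x y, x != y ->
  (Q x + Q y) / 4 <= - ln (edist x y) + Q x / 2 + Q y / 2 + C0.
Hypothesis QS : forall e, 0 < e ->
  exists2 dl : R, 0 < dl & forall x y, edist x y <= dl -> Q y <= (1 + e) * Q x + e.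
Hypothesis d0 : (0 < d)%N.
Hypothesis frullani : forall a : R, 0 <= a ->
  ((if (a == 0)%R then +oo else (- (2^-1 * ln a))%:E) + rfun a = pfun a + c%:E)%E.
Hypothesis cC : 0 <= c + C0.
Variable mu : probability E R.
Hypothesis muQ : is_equilibrium_measure Q mu.
Local Notation K := (KK Q C0).
Local Notation J := (JJ Q C0).

Let K0 x y : (0 <= K x y)%E. Proof. exact: KK_ge0. Qed.

(** [U] is not assumed symmetric, hence the two orders. *)
Lemma double_sum_pairsum (U : E -> E -> \bar R) (s : seq E) :
  (\sum_(x <- s) \sum_(y <- s) U x y = \sum_(x <- s) U x x +
    (pairsum U s + pairsum (fun x y => U y x) s))%E.
Proof.
elim: s => [|t s IH]; first by rewrite /= !big_nil !adde0.
rewrite !big_cons /=.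
have -> : (\sum_(x <- s) \sum_(y <- t :: s) U x y =
    \sum_(x <- s) U x t + \sum_(x <- s) \sum_(y <- s) U x y)%E.
  by rewrite -big_split/=; apply: eq_bigr => x _; rewrite big_cons.
rewrite IH (addeCA (\sum_(x <- s) U x t)%E) addeACA; congr (_ + _)%E.
by rewrite addeA addeACA.
Qed.

Lemma pairsum_le (U : E -> E -> \bar R) (s : seq E) (e : R) : 0 <= e ->
  (forall x y, U x y <= (1 + e)%:E * K x y + e%:E)%E ->
  (pairsum U s <= (1 + e)%:E * pairsum K s + ('C(size s, 2)%:R * e)%:E)%E.
Proof.
move=> e0 Ue; have e1 : (0 <= (1 + e)%:E)%E by rewrite lee_fin; lra.
elim: s => [|t s IH] /=; first by rewrite mule0 mul0r add0e.
have S1 : (\sum_(y <- s) U t y <= (1 + e)%:E * \sum_(y <- s) K t y + ((size s)%:R * e)%:E)%E.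
  elim: {IH} s => [|y s IH] /=; first by rewrite !big_nil mule0 mul0r add0e.
  rewrite !big_cons ge0_muleDr ?sume_ge0// -natr1 mulrDl mul1r (EFinD (_ * e)).
  by rewrite (addeC (_ * e)%:E) addeACA; exact: leeD.
rewrite ge0_muleDr ?sume_ge0 ?pairsum_ge0// binS bin1 natrD mulrDl (EFinD (_ * e)).
by rewrite (addeC (_ * e)%:E) addeACA; exact: leeD.
Qed.

(** Each point belongs to n - 1 pairs, and [KK_ge] gives it Q/4 in each. *)
Lemma sumQ_le_pairsum (s : seq E) :
  ((((size s)%:R - 1) / 4 * \sum_(y <- s) Q y)%:E <= pairsum K s)%E.
Proof.
elim: s => [|t s IH] /=; first by rewrite big_nil mulr0.
have S1 : ((((size s)%:R * Q t + \sum_(y <- s) Q y) / 4)%:E <= \sum_(y <- s) K t y)%E.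
  elim: {IH} s => [|y s IH] /=; first by rewrite !big_nil mul0r addr0 mul0r.
  rewrite !big_cons.
  apply: (@le_trans _ _ (((Q t + Q y) / 4)%:E + (((size s)%:R * Q t + \sum_(y <- s) Q y) / 4)%:E)%E); last first.
    by apply: leeD IH; exact: KK_ge.
  by rewrite -EFinD lee_fin -natr1; lra.
apply: (le_trans _ (leeD S1 IH)); rewrite -EFinD lee_fin big_cons -natr1.
by rewrite le_eqVlt; apply/orP; left; apply/eqP; field.
Qed.

Let mK : measurable_fun setT (fun p : E * E => K p.1 p.2). Proof. exact: measurable_KK. Qed.

Local Notation U := (noise2K Q C0).

Let U0 dl x y : (0 <= U dl x y)%E. Proof. exact: noise2K_ge0. Qed.

Let mU dl : measurable_fun setT (fun p : E * E => U dl p.1 p.2).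
Proof. exact: measurable_noise2K. Qed.

Let measurable_smear dl (f : E -> \bar R) : measurable_fun setT f ->
  (forall x, 0 <= f x)%E ->
  measurable_fun setT (fun x => \int[Unifd R d]_u f (shift dl x u))%E.
Proof.
move=> mf f0; apply: (measurable_fun_fubini_tonelli_F (fun p => f (shift dl p.1 p.2))) => //.
by apply: (measurableT_comp mf); exact: measurable_shift.
Qed.

Let avg_le n (y : n.-tuple E) (f : E -> \bar R) (b : E -> R) : (0 < n)%N ->
  (forall x, f x <= (b x)%:E)%E ->
  (n%:R^-1%:E * \sum_(x <- y) f x <= (n%:R^-1 * \sum_(x <- y) b x)%:E)%E.
Proof.
move=> n0 fb; rewrite EFinM lee_wpmul2l ?lee_fin ?invr_ge0// -sumEFin.
by apply: lee_sum.
Qed.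

(* Smearing an empirical measure makes its energy finite; the diagonal terms
   cost only [O(1/n)]. *)
Let empirical_energy n (y : n.-tuple E) (P S : probability E R) (e dl A : R) :
  (1 < n)%N -> 0 < e -> 0 < dl -> dl <= 1 -> 0 <= A ->
  (forall x y, edist x y <= d%:R * dl -> Q y <= (1 + e) * Q x + e) ->
  (forall x y, (U dl x y <= (1 + e)%:E * K x y + e%:E)%E) ->
  (forall f : E -> \bar R, measurable_fun setT f -> (forall x, 0 <= f x)%E ->
    (\int[P]_x f x = n%:R^-1%:E * \sum_(x <- y) f x)%E) ->
  is_smear P dl S ->
  (pairsum K y + pairsum K y < (n%:R ^+ 2 * A)%:E)%E ->
  (J S S <= ((1 + e) * A + e +
    n%:R^-1 * (2 - ln dl + e + C0 + (1 + e) * (4 * A)))%:E)%E.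
Proof.
move=> n1 e0 dl0 dl1 A0 HQ He HP HS yA.
have n0 : (0 < n)%N by exact: ltnW.
have nR : 2 <= n%:R :> R by rewrite ler_nat.
have nV : (0 <= n%:R^-1%:E :> \bar R)%E by rewrite lee_fin invr_ge0.
rewrite (JJ_smear Q0 cQ KQ HS HS).
rewrite [X in (X <= _)%E](_ : _ = (n%:R^-1%:E * (n%:R^-1%:E * \sum_(x <- y) \sum_(z <- y) U dl x z))%E); last first.
  rewrite HP; last 2 first.
  - by apply: (measurable_fun_fubini_tonelli_F _ (mU dl)) => p; exact: U0.
  - by move=> x; apply: integral_ge0 => z _; exact: U0.
  congr (_ * _)%E; rewrite ge0_sume_distrr; last by move=> x _; apply: sume_ge0 => z _; exact: U0.
  apply: eq_bigr => x _; rewrite HP//.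
  exact: (measurableT_comp (mU dl) (pair1_measurable x)).
have [pK pKE] : exists p : R, pairsum K y = p%:E.
  have := pairsum_ge0 (y : seq E) K0; move: yA.
  by case: (pairsum K y) => [p| |]// _ _; exists p.
have p0 : 0 <= pK by rewrite -lee_fin -pKE pairsum_ge0.
move: yA; rewrite pKE -EFinD lte_fin => yA.
set s := \sum_(x <- y) Q x.
have s0 : 0 <= s by apply: sumr_ge0.
(* Here [n >= 2] enters, as n^2 <= 2 n (n - 1): the sum of [Q] is of order [n], and so is the
   diagonal sum. *)
have sB : s <= 4 * n%:R * A.
  have := sumQ_le_pairsum y; rewrite pKE lee_fin size_tuple -/s => h.
  have n1' : 0 < n%:R - 1 :> R by lra.
  have h2 : (n%:R - 1) * s <= (n%:R - 1) * (4 * n%:R * A).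
    have : 0 <= A * (n%:R * (n%:R - 2)) by rewrite !mulr_ge0//; lra.
    by rewrite expr2 in yA; nra.
  by rewrite -(ler_pM2l n1').
have diag : (\sum_(x <- y) U dl x x <= (n%:R * (2 - ln dl + e + C0) + (1 + e) * s)%:E)%E.
  apply: (@le_trans _ _ (\sum_(x <- y) (2 - ln dl + (1 + e) * (Q x + Q x) / 2 + e + C0)%:E)%E).
    by apply: lee_sum => x _; exact: noise2_KK_le.
  rewrite sumEFin lee_fin (eq_bigr (fun x => (2 - ln dl + e + C0) + (1 + e) * Q x)); last first.
    by move=> x _; field.
  rewrite big_split/= -mulr_sumr -/s big_const_seq count_predT size_tuple iter_addr_0.
  by rewrite mulr_natl.
have off (V : E -> E -> \bar R) : (forall x z, V x z <= (1 + e)%:E * K x z + e%:E)%E ->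
    (pairsum V y <= ((1 + e) * pK + n%:R ^+ 2 / 2 * e)%:E)%E.
  move=> Ve; apply: (le_trans (pairsum_le y (ltW e0) Ve)).
  rewrite pKE size_tuple -EFinM -EFinD lee_fin lerD2l ler_wpM2r ?(ltW e0)//.
  by rewrite ler_pdivlMr// -natrM -natrX ler_nat bin2_le.
have offT : (pairsum (fun x z => U dl z x) y <= ((1 + e) * pK + n%:R ^+ 2 / 2 * e)%:E)%E.
  by apply: off => x z; rewrite KKC; exact: He.
rewrite double_sum_pairsum muleA -EFinM.
have nn : (0 <= (n%:R^-1 * n%:R^-1)%:E :> \bar R)%E by rewrite lee_fin mulr_ge0 ?invr_ge0.
apply: (le_trans (lee_wpmul2l nn (leeD diag (leeD (off _ (He)) offT)))).
rewrite -!EFinD -EFinM lee_fin.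
set ni := n%:R^-1; have ni0 : 0 < ni by rewrite invr_gt0; lra.
have nni : ni * n%:R = 1 by rewrite mulVf// gt_eqF//; lra.
have h1 : ni * ni * (pK + pK) <= A.
  have -> : A = ni * ni * (n%:R ^+ 2 * A).
    by rewrite expr2 !mulrA -(mulrA ni ni) nni mulr1 nni mul1r.
  by rewrite ler_wpM2l ?mulr_ge0 ?(ltW ni0)// ltW.
have h2 : ni * ni * s <= ni * (4 * A).
  have -> : ni * (4 * A) = ni * ni * (4 * n%:R * A).
    rewrite (_ : ni * ni * (4 * n%:R * A) = ni * (ni * n%:R) * (4 * A)); last by ring.
    by rewrite nni mulr1.
  by rewrite ler_wpM2l// mulr_ge0// ltW.
have h3 : ni * ni * n%:R ^+ 2 = 1 by rewrite expr2 mulrACA nni mulr1.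
have h4 : ni * ni * n%:R = ni by rewrite -mulrA nni mulr1.
have e1 : 0 <= 1 + e by lra.
rewrite [leLHS](_ : _ = ni * ni * n%:R * (2 - ln dl + e + C0) + (1 + e) * (ni * ni * s) +
   ((1 + e) * (ni * ni * (pK + pK)) + ni * ni * n%:R ^+ 2 * e)); last by field.
rewrite h3 h4.
have := ler_wpM2l e1 h1; have := ler_wpM2l e1 h2.
lra.
Qed.

(** [eta] and [N] depend on [f] only through [M], [D] and [V], because in the induction on marginals
    the test function is a section that varies with the configuration. Of [kappa], one quarter pays
    for the smearing of [f] and one eighth for each error term of [gauss_gap_bound]. *)
Lemma empirical_bound (M D V kappa : R) : 0 <= M -> 0 <= D -> 0 <= V -> 0 < kappa ->
  exists2 eta : R, 0 < eta & exists N, forall n, (N <= n)%N ->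
  forall y : n.-tuple E,
  (pairsum K y + pairsum K y < (n%:R ^+ 2 * (fine (J mu mu) + 2 * eta))%:E)%E ->
  forall f : E -> R, measurable_fun setT f -> (forall x, 0 <= f x <= M) ->
  (forall x z, f x <= f z + D * edist x z) ->
  (\int[Lebd R d]_z (f z)%:E <= V%:E)%E ->
  (\int[mu]_x (f x)%:E <= (n%:R^-1 * \sum_(x <- y) f x + kappa)%:E)%E.
Proof.
move=> M0 D0 V0 k0.
have jf := JJ_equilibrium_fin Q0 cQ C00 KQ QS d0 muQ.
set j := fine (J mu mu); have jE : J mu mu = j%:E by rewrite fineK.
have j0 : 0 <= j by rewrite -lee_fin -jE JJ_ge0.
have dR : 0 <= d%:R :> R by [].
(* With s <= 1/(1 + A) the Gaussian displacement error 4 D d s is at most kappa/8, and t >= T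
   ensures this. *)
pose A := 32 * D * d%:R / kappa.
have A0 : 0 <= A by rewrite /A divr_ge0 ?mulr_ge0 ?(ltW k0).
pose T := (1 + A) ^+ 2.
have T1 : 1 <= T by rewrite /T; have := mulr_ge0 A0 A0; rewrite expr2; nra.
have T0 : 0 < T by lra.
pose th := kappa / (8 * (V + 1)).
have th0 : 0 < th by rewrite /th divr_gt0//; lra.
have thV : th * V <= kappa / 8.
  rewrite /th (_ : kappa / (8 * (V + 1)) * V = kappa / 8 * (V / (V + 1))); last by field; rewrite gt_eqF//; lra.
  by rewrite ler_piMr ?divr_ge0 ?(ltW k0)// ler_pdivrMr; lra.
(* Bounds [kap s ^+ d] for all [t] in [T, 2T], because the scale is found only later. *)
pose Kc := Num.sqrt (8 * T) ^+ d.
have Kc0 : 0 <= Kc by rewrite exprn_ge0.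
pose W := M / (4 * th) * Kc.
have W0 : 0 <= W by rewrite /W mulr_ge0// divr_ge0// mulr_ge0// ltW.
pose g0 := kappa / 8 / (W + 1).
have g00 : 0 < g0 by rewrite /g0 !divr_gt0//; lra.
have Wg : W * g0 <= kappa / 8.
  rewrite /g0 mulrCA ler_piMr ?divr_ge0 ?(ltW k0)// ler_pdivrMr; lra.
(* An energy excess [xi] allows a gap 8 xi + g0/2 = g0. It is made of 2 eta = xi/4 from the
   configuration, xi/4 from [e], and xi/2 from the terms in 1/n. *)
pose xi := g0 / 16; have xi0 : 0 < xi by rewrite /xi divr_gt0.
pose eta := xi / 8; have eta0 : 0 < eta by rewrite /eta divr_gt0.
pose j' := j + 2 * eta; have j'0 : 0 <= j' by rewrite /j'; lra.
pose e := xi / 4 / (j' + 1).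
have e0 : 0 < e by rewrite /e !divr_gt0//; lra.
have ej : (1 + e) * j' + e = j' + xi / 4 by rewrite /e; field; rewrite gt_eqF//; lra.
have [dl0 /andP[dl00 dl01] [HQ0 He0]] := noise2_KK Q0 cQ C00 KQ QS d0 e0.
pose dl := Num.min dl0 (kappa / 4 / (D * d%:R + 1)).
have Dd0 : 0 <= D * d%:R by rewrite mulr_ge0.
have dlgt0 : 0 < dl by rewrite lt_min dl00 !divr_gt0//; lra.
have dlle : dl <= dl0 by rewrite ge_min lexx.
have dl1 : dl <= 1 by exact: le_trans dl01.
have Ddl : D * (d%:R * dl) <= kappa / 4.
  have : dl <= kappa / 4 / (D * d%:R + 1) by rewrite ge_min lexx orbT.
  rewrite ler_pdivlMr; last lra.
  by move=> h; apply: le_trans h; rewrite mulrA mulrC ler_wpM2l ?(ltW dlgt0)//; lra.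
have HQ x y : edist x y <= d%:R * dl -> Q y <= (1 + e) * Q x + e.
  by move=> h; apply: HQ0; apply: le_trans h _; rewrite ler_wpM2l.
have He x y : (U dl x y <= (1 + e)%:E * K x y + e%:E)%E.
  by apply: He0; rewrite dlgt0.
pose Y := 2 - ln dl + e + C0 + (1 + e) * (4 * j').
have [N HN] := ex_natr_ge (2 * Y / xi).
exists eta => //; exists (maxn 2 N) => n; rewrite geq_max => /andP[n2 Nn] y yA f mf fM fL fV.
have n0 : (0 < n)%N by exact: leq_trans n2.
have nR : 0 < n%:R :> R by rewrite ltr0n.
have [P HP] := probability_empirical R y n0.
have [S HS] := probability_smear P dl.
have mF : measurable_fun setT (EFin \o f) by exact/measurable_EFinP.
have f0 x : (0 <= (f x)%:E)%E by rewrite lee_fin; case/andP: (fM x).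
have mshift x : measurable_fun setT (fun u => (f (shift dl x u))%:E).
  apply: (measurableT_comp mF); exact: measurable_shift.
have Sf : (\int[S]_x (f x)%:E <= (n%:R^-1 * \sum_(x <- y) f x + kappa / 4)%:E)%E.
  rewrite HS// HP; last 2 first.
  - exact: (measurable_smear dl mF f0).
  - by move=> x; apply: integral_ge0 => u _; exact: f0.
  apply: (le_trans (avg_le y (b := fun x => f x + kappa / 4) n0 _)) => [x|].
    rewrite -(int_Unifd_cst d (f x + _)%:E); apply: ge0_le_integral => //.
    by move=> u _; rewrite lee_fin; apply: (le_trans (fL _ x)); rewrite lerD2l;
      apply: le_trans Ddl; rewrite ler_wpM2l// edistC edist_shift// ltW.
  rewrite lee_fin big_split/= mulrDr lerD2l big_const_seq count_predT size_tuple iter_addr_0.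
  by rewrite -[X in _ * X]mulr_natl mulKf ?gt_eqF.
have [s0' Js] : exists2 b, J S S = b%:E & b <= j + xi.
  have := empirical_energy n2 e0 dlgt0 dl1 j'0 HQ He HP HS yA; rewrite -/Y.
  have := JJ_ge0 Q0 KQ S S; case: (J S S) => [b| |]// _.
  rewrite lee_fin ej => h; exists b => //; apply: (le_trans h).
  have : n%:R^-1 * Y <= xi / 2.
    have := HN n Nn; rewrite ler_pdivrMr// => hY; rewrite mulrC ler_pdivrMr//; lra.
  by rewrite /j' /eta; lra.
(* The mixed energy enters [gauss_gap_small] only through its finiteness, which smearing one
   argument provides. *)
have [b Jb] : exists b, J mu S = b%:E.
  have mi : measurable_fun setT (fun x => \int[mu]_z K x z)%E.
    by apply: (measurable_fun_fubini_tonelli_F _ mK) => p; exact: K0.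
  have i0 x : (0 <= \int[mu]_z K x z)%E by exact: integral_ge0.
  have [q qE q0] : exists2 q, (\int[mu]_x (Q x / 4)%:E = q%:E)%E & 0 <= q.
    have := Q_le_JJ Q0 cQ KQ mu; rewrite jE.
    have : (0 <= \int[mu]_x (Q x / 4)%:E)%E by apply: integral_ge0 => x _; rewrite lee_fin divr_ge0.
    by case: (\int[_]_x _)%E => [q| |]//; rewrite lee_fin => q0 _; exists q.
  pose bb x : R := 2 * q + (2 - ln dl + ((1 + e) * Q x + e) / 2 + C0).
  have bbx x : (\int[Unifd R d]_u \int[mu]_z K (shift dl x u) z <= (bb x)%:E)%E.
    rewrite (fubini_tonelli (fun p => K (shift dl x p.1) p.2))//; last first.
      apply: measurable_KK => //; apply: measurable_shift => //.
    have lndl : ln dl <= 0 by exact: ln_le0.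
    have cst0 : 0 <= 2 - ln dl + ((1 + e) * Q x + e) / 2 + C0.
      have := Q0 x; have := C00; have : 0 <= (1 + e) * Q x by rewrite mulr_ge0//; lra.
      lra.
    apply: (@le_trans _ _ (\int[mu]_z (2%:E * (Q z / 4)%:E + (2 - ln dl + ((1 + e) * Q x + e) / 2 + C0)%:E))%E).
      apply: ge0_le_integral => //.
      - by move=> z _; exact: integral_ge0.
      - apply: (measurable_fun_fubini_tonelli_G (fun p => K (shift dl x p.1) p.2)) => //.
        by apply: measurable_KK => //; apply: measurable_shift => //.
      - apply: emeasurable_funD; last exact: measurable_cst.
        apply: measurable_funeM; apply/measurable_EFinP; apply: measurable_funM => //.
        exact: continuous_Rd_measurable.
      move=> z _; apply: (le_trans (noise_KK_le Q0 cQ C00 KQ d0 e0 dlgt0 dl1 HQ x z)).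
      by rewrite -EFinM -EFinD lee_fin; lra.
    have mq : measurable_fun setT (fun z => (Q z / 4)%:E).
      by apply/measurable_EFinP; apply: measurable_funM => //; exact: continuous_Rd_measurable.
    rewrite integralDr_cst//; last 2 first.
    - exact: measurable_funeM.
    - by move=> z; rewrite adde_ge0 ?mule_ge0 ?lee_fin ?divr_ge0.
    rewrite ge0_integralZl//; last by move=> z _; rewrite lee_fin divr_ge0.
    by rewrite qE -EFinM -EFinD.
  have : (J mu S < +oo)%E.
    rewrite JJC// /JJ HS// HP; last 2 first.
    - exact: (measurable_smear dl mi i0).
    - by move=> x; exact: integral_ge0.
    exact: le_lt_trans (avg_le y n0 bbx) (ltry _).
  by have := JJ_ge0 Q0 KQ mu S; case: (J mu S) => [b| |]// _ _; exists b.
move=> sle.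
have z0 : 0 < g0 / 2 by rewrite divr_gt0.
have [t /andP[tT1 tT2] gap] := gauss_gap_small Q0 cQ C00 KQ frullani cC muQ jE Jb Js T1 z0.
have gapg : gauss_gap t mu S <= g0 by move: gap; rewrite /xi in sle; lra.
have t0 : 0 < t by lra.
pose s := (Num.sqrt (4 * t))^-1.
have sq0 : 0 < Num.sqrt (4 * t) by rewrite sqrtr_gt0; lra.
have s0 : 0 < s by rewrite invr_gt0.
have st : `|t| = (4 * s ^+ 2)^-1.
  by rewrite /s exprVn sqr_sqrtr ?gtr0_norm ?mulr_ge0 ?(ltW t0)//; field; rewrite gt_eqF.
have sA : s <= (1 + A)^-1.
  rewrite lef_pV2 ?posrE//; last lra.
  rewrite -[leLHS]ger0_norm -?sqrtr_sqr; last lra.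
  by apply: ler_wsqrtr; rewrite -/T; lra.
have DA : 2 * (D * (d%:R * (2 * s))) <= kappa / 8.
  have -> : 2 * (D * (d%:R * (2 * s))) = kappa / 8 * (A * s) by rewrite /A; field; rewrite gt_eqF.
  rewrite ler_piMr ?divr_ge0 ?(ltW k0)//.
  apply: (le_trans (ler_wpM2l A0 sA)); rewrite ler_pdivrMr; lra.
have kK : kap s ^+ d <= Kc.
  rewrite /Kc lerXn2r ?nnegrE ?sqrtr_ge0 ?(ltW (kap_gt0 s0))//.
  apply: (le_trans (kap_le s0)); rewrite /s invrK ler_wsqrtr//; lra.
have gap0 := gauss_gap_ge0 s0 st mu S.
have := gauss_gap_bound s0 st mu S mf fM D0 fL fV th0.
move/le_trans; apply; apply: (le_trans (leeD2r _ Sf)); rewrite -EFinD lee_fin.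
have : M / (4 * th) * (kap s ^+ d * gauss_gap t mu S) <= kappa / 8.
  have k1 : 0 <= kap s ^+ d by rewrite exprn_ge0// ltW// kap_gt0.
  have w0 : 0 <= M / (4 * th) by apply: divr_ge0 => //; apply: mulr_ge0 => //; exact: ltW.
  have h := ler_wpM2l w0 (ler_pM k1 gap0 kK gapg).
  by apply: (le_trans h); rewrite mulrA.
by lra.
Qed.

End empirical.

(** * Convergence of marginals *)

Section marginals.
Context (R : realType) (d : nat) (Q : d.-tuple R -> R) (C0 c : R).
Local Notation E := (d.-tuple R).
Hypothesis Q0 : forall x, 0 <= Q x.
Hypothesis cQ : continuous_Rd Q.
Hypothesis C00 : 0 <= C0.
Hypothesis KQ : forall x y, x != y ->
  (Q x + Q y) / 4 <= - ln (edist x y) + Q x / 2 + Q y / 2 + C0.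
Hypothesis QS : forall e, 0 < e ->
  exists2 dl : R, 0 < dl & forall x y, edist x y <= dl -> Q y <= (1 + e) * Q x + e.
Hypothesis d0 : (0 < d)%N.
Hypothesis frullani : forall a : R, 0 <= a ->
  ((if (a == 0)%R then +oo else (- (2^-1 * ln a))%:E) + rfun a = pfun a + c%:E)%E.
Hypothesis cC : 0 <= c + C0.
Hypothesis intQ : (\int[Lebd R d]_x (expR (- Q x))%:E < +oo)%E.
Variable mu : probability E R.
Hypothesis muQ : is_equilibrium_measure Q mu.
Local Notation x0 := ([tuple of nseq d 0] : E).
Local Notation Ln n := (tpm (Lebd R d) n).

Definition sdist (s t : seq E) : R := \sum_(p <- zip s t) edist p.1 p.2.

(** Test functions live on sequences, so that prefixes and added heads need no cast. Integrating out
    the head preserves the bounds with the same constants, on which the induction on [k] relies. *)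
Record bump (k : nat) (M D b : R) (psi : seq E -> R) : Prop := Bump {
  bump_bound : forall s, size s = k -> 0 <= psi s <= M;
  bump_lip : forall s t, size s = k -> size t = k -> psi s <= psi t + D * sdist s t;
  bump_supp : forall s x, x \in s -> b <= enorm x -> psi s = 0 }.

Lemma sdistE k (v w : k.-tuple E) : sdist v w = \sum_(i < k) edist (tnth v i) (tnth w i).
Proof.
rewrite /sdist (big_nth (x0, x0)) size_zip !size_tuple minnn big_mkord.
by apply: eq_bigr => i _; rewrite nth_zip ?size_tuple//= -!tnth_nth.
Qed.

Lemma sdist_ge0 s t : 0 <= sdist s t.
Proof. by apply: sumr_ge0 => p _; exact: edist_ge0. Qed.

Lemma sdistss s : sdist s s = 0.
Proof. by elim: s => [|x s IH]; rewrite /sdist/= ?big_nil// big_cons edistxx add0r. Qed.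

Lemma sdistC s t : sdist s t = sdist t s.
Proof.
elim: s t => [|x s IH] [|y t]; rewrite /sdist/= ?big_nil//.
by rewrite !big_cons/= edistC; congr (_ + _); exact: IH.
Qed.

Lemma sdist_cons x y s t : sdist (x :: s) (y :: t) = edist x y + sdist s t.
Proof. by rewrite /sdist/= big_cons. Qed.

Lemma bump_measurable k M D b psi : 0 <= D -> bump k M D b psi ->
  measurable_fun setT (fun v : k.-tuple E => psi v).
Proof.
move=> D0 [_ lip _]; apply: continuous_Rdk_measurable => v e e0.
have D'0 : 0 < D * k%:R + 1 by rewrite ltr_pwDr// mulr_ge0.
exists (e / (D * k%:R + 1)); first by rewrite divr_gt0.
move=> w vw.
have sd : D * sdist v w < e.
  have h1 : sdist v w <= k%:R * (e / (D * k%:R + 1)).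
    rewrite sdistE mulr_natl -[X in _ *+ X]card_ord -sumr_const.
    by apply: ler_sum => i _; exact: ltW.
  apply: (le_lt_trans (ler_wpM2l D0 h1)).
  by rewrite !mulrA ltr_pdivrMr//; lra.
have h1 := lip v w (size_tuple v) (size_tuple w).
have h2 := lip w v (size_tuple w) (size_tuple v).
by rewrite sdistC in h2; rewrite ltr_norml; apply/andP; split; lra.
Qed.

Lemma measurable_nths k n (js : k.-tuple nat) :
  measurable_fun setT (fun v : n.-tuple E => [tuple nth x0 v (tnth js j) | j < k]).
Proof.
apply/measurable_fun_tnthP => j.
rewrite (_ : _ \o _ = fun v : n.-tuple E => nth x0 v (tnth js j)); last first.
  by apply/funext => v /=; rewrite tnth_mktuple.
have [jn|jn] := ltnP (tnth js j) n.
  rewrite (_ : (fun v => _) = fun v : n.-tuple E => tnth v (Ordinal jn)).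
    exact: measurable_tnth.
  by apply/funext => v; rewrite (tnth_nth x0).
rewrite (_ : (fun v => _) = fun=> x0); first exact: measurable_cst.
by apply/funext => v; rewrite nth_default// size_tuple.
Qed.

Lemma bump_measurable_nths k M D b psi n (js : k.-tuple nat) : 0 <= D -> bump k M D b psi ->
  measurable_fun setT (fun v : n.-tuple E => psi [seq nth x0 v i | i <- js]).
Proof.
move=> D0 Hp.
rewrite (_ : (fun v => _) = fun v : n.-tuple E => psi [tuple nth x0 v (tnth js j) | j < k]).
  exact: (measurableT_comp (bump_measurable D0 Hp) (measurable_nths js)).
apply/funext => v; congr psi; apply: (@eq_from_nth _ x0); first by rewrite size_map !size_tuple.
move=> i; rewrite size_map size_tuple => ik.
by rewrite (nth_map 0%N) ?size_tuple// (nth_mktuple _ _ (Ordinal ik)) (tnth_nth 0%N).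
Qed.

Lemma bump_measurable_take k M D b psi n : (k <= n)%N -> 0 <= D -> bump k M D b psi ->
  measurable_fun setT (fun v : n.-tuple E => psi (take k v)).
Proof.
move=> kn D0 Hp; rewrite (_ : (fun v => _) =
    fun v : n.-tuple E => psi [seq nth x0 v i | i <- [tuple of iota 0 k]]).
  exact: bump_measurable_nths D0 Hp.
by apply/funext => v; rewrite /= map_nth_iota0 ?size_tuple.
Qed.

Lemma bump_measurable_nth_take k M D b psi n i : (k <= n)%N -> 0 <= D ->
  bump k.+1 M D b psi ->
  measurable_fun setT (fun v : n.-tuple E => psi (nth x0 v i :: take k v)).
Proof.
move=> kn D0 Hp; rewrite (_ : (fun v => _) =
    fun v : n.-tuple E => psi [seq nth x0 v j | j <- [tuple of i :: iota 0 k]]).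
  exact: bump_measurable_nths D0 Hp.
by apply/funext => v; rewrite /= map_nth_iota0 ?size_tuple.
Qed.

Lemma bump_measurable_section k M D b psi s : size s = k -> 0 <= D ->
  bump k.+1 M D b psi -> measurable_fun setT (fun x => psi (x :: s)).
Proof.
move=> sk D0 Hp; have sk' : size s == k by apply/eqP.
apply: (measurableT_comp (f := fun v : k.+1.-tuple E => psi v) (bump_measurable D0 Hp)
  (g := fun x => cons_tuple x (Tuple sk'))).
by apply: measurable_cons_tuple => //; exact: measurable_cst.
Qed.

(** The product of the [cauchy] factors is bounded below on the ball, which gives a majorant
    depending only on [M] and [b]. *)
Lemma compact_integral_bound (M b : R) : 0 <= M -> exists2 V : R, 0 <= V &
  forall f : E -> R, measurable_fun setT f -> (forall x, 0 <= f x <= M) ->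
    (forall x, b <= enorm x -> f x = 0) -> (\int[Lebd R d]_x (f x)%:E <= V%:E)%E.
Proof.
move=> M0; have := integral_prod_cauchy R d.
have p0 (x : E) : (0 <= (\prod_(i < d) cauchy (tnth x i))%:E)%E.
  by rewrite lee_fin prodr_ge0// => i _; exact: cauchy_ge0.
have mp : measurable_fun setT (fun x : E => (\prod_(i < d) cauchy (tnth x i))%:E).
  by apply/measurable_EFinP; exact: measurable_prod_cauchy.
have : (0 <= \int[Lebd R d]_x (\prod_(i < d) cauchy (tnth x i))%:E)%E by exact: integral_ge0.
case VE : (\int[_]_x _)%E => [V| |]//; rewrite lee_fin => V0 _.
have c0 : 0 <= M * (1 + b ^+ 2) ^+ d by rewrite mulr_ge0// exprn_ge0// addr_ge0// sqr_ge0.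
exists (M * (1 + b ^+ 2) ^+ d * V); first by rewrite mulr_ge0.
move=> f mf fM fb; rewrite EFinM -VE -ge0_integralZl//.
apply: ge0_le_integral => //.
- by move=> x _; rewrite lee_fin; case/andP: (fM x).
- exact/measurable_EFinP.
- exact: measurable_funeM.
move=> x _; rewrite -EFinM lee_fin.
have [bx|xb] := leP b (enorm x); first by rewrite fb// mulr_ge0// -lee_fin.
rewrite -mulrA; case/andP: (fM x) => _ /le_trans; apply.
rewrite ler_peMr// -[X in _ ^+ X]card_ord -prodr_const -big_split/=.
apply: (big_ind (fun u => 1 <= u)) => [//|u v u1 v1|i _]; first exact: mulr_ege1.
rewrite /cauchy ler_pdivlMr ?mul1r; last by rewrite ltr_pwDl// sqr_ge0.
rewrite lerD2l; have xi : `|tnth x i| <= enorm x.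
  rewrite enormE; apply: le_trans (coord_le_edist _ _ i).
  by rewrite (tnth_nth 0 [tuple of nseq d 0])/= nth_nseq if_same subr0.
rewrite -real_normK ?num_real//; have := normr_ge0 (tnth x i); nra.
Qed.

Definition marg (psi : seq E -> R) (s : seq E) : R := fine (\int[mu]_x (psi (x :: s))%:E)%E.

Section margin.
Variables (k : nat) (M D b : R) (psi : seq E -> R).
Hypotheses (D0 : 0 <= D) (Hp : bump k.+1 M D b psi).

Let bnd s x : size s = k -> 0 <= psi (x :: s) <= M.
Proof. by move=> sk; apply: (bump_bound Hp); rewrite /= sk. Qed.

Let ms s : size s = k -> measurable_fun setT (fun x => (psi (x :: s))%:E).
Proof. by move=> sk; apply/measurable_EFinP; exact: bump_measurable_section sk D0 Hp. Qed.

Let int_le s : size s = k -> (0 <= \int[mu]_x (psi (x :: s))%:E <= M%:E)%E.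
Proof.
move=> sk; apply/andP; split.
  by apply: integral_ge0 => x _; rewrite lee_fin; case/andP: (bnd x sk).
rewrite -(probability_integral_cst mu M%:E); apply: ge0_le_integral => //.
- by move=> x _; rewrite lee_fin; case/andP: (bnd x sk).
- exact: ms.
- by move=> x _; rewrite lee_fin; case/andP: (bnd x sk).
Qed.

Lemma margE s : size s = k -> (marg psi s)%:E = (\int[mu]_x (psi (x :: s))%:E)%E.
Proof.
move=> sk; have /andP[i0 iM] := int_le sk.
by rewrite fineK// ge0_fin_numE// (le_lt_trans iM) ?ltry.
Qed.

Lemma bump_marg : bump k M D b (marg psi).
Proof.
split.
- by move=> s sk; rewrite -!lee_fin margE//; exact: int_le.
- move=> s t sk tk; have c0 : 0 <= D * sdist s t by rewrite mulr_ge0// sdist_ge0.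
  rewrite -lee_fin EFinD !margE// -(integralDr_cst mu (ms tk) c0); last first.
    by move=> x; rewrite lee_fin addr_ge0//; case/andP: (bnd x tk).
  apply: ge0_le_integral => //.
  + by move=> x _; rewrite lee_fin; case/andP: (bnd x sk).
  + exact: ms.
  + by apply: emeasurable_funD; [exact: ms|exact: measurable_cst].
  move=> x _; rewrite -EFinD lee_fin.
  have := bump_lip Hp (s := x :: s) (t := x :: t).
  by rewrite sdist_cons edistxx add0r; apply; rewrite /= ?sk ?tk.
- move=> s x xs bx; rewrite /marg (eq_integral (fun=> 0%E)) ?integral0// => y _.
  by congr EFin; apply: (bump_supp Hp (x := x)) => //; rewrite inE xs orbT.
Qed.

Lemma integral_marg : (\int[tpm mu k]_v (marg psi v)%:E = \int[tpm mu k.+1]_v (psi v)%:E)%E.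
Proof.
have mp : measurable_fun setT (fun v : k.+1.-tuple E => (psi v)%:E).
  by apply/measurable_EFinP; exact: bump_measurable D0 Hp.
have p0 (v : k.+1.-tuple E) : (0 <= (psi v)%:E)%E.
  by rewrite lee_fin; case/andP: (bump_bound Hp (size_tuple v)).
rewrite ge0_tpmSE// (fubini_tonelli (fun p => (psi (cons_tuple p.1 p.2))%:E))//=; last first.
  by apply: (measurableT_comp mp); exact: measurable_cons_tuple.
by apply: eq_integral => v _; rewrite margE ?size_tuple.
Qed.

End margin.

Local Notation Z n := (\int[Ln n]_v (weight Q n v)%:E)%E.

(** Exchangeability: both sides become the integral of psi (t :: take k v) against the weight of t
    :: v, the coordinate [i] being moved to the front. *)
Lemma insert_marginal k M D b psi n i : 0 <= D -> bump k.+1 M D b psi ->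
  (k <= i)%N -> (i < n)%N ->
  (\int[Ln n]_v (psi (nth x0 v i :: take k v) * weight Q n v)%:E =
   \int[Ln n]_v (psi (take k.+1 v) * weight Q n v)%:E)%E.
Proof.
move=> D0 Hp ki; case: n => // n i_n.
have kn : (k <= n)%N by rewrite (leq_trans ki).
have mw : measurable_fun setT (fun v : n.+1.-tuple E => weight Q n.+1 v) by exact: measurable_weight.
have m1 : measurable_fun setT (fun v : n.+1.-tuple E => (psi (nth x0 v i :: take k v) * weight Q n.+1 v)%:E).
  apply/measurable_EFinP; apply: measurable_funM => //.
  by apply: (bump_measurable_nth_take _ _ D0 Hp); exact: leqW.
have m2 : measurable_fun setT (fun v : n.+1.-tuple E => (psi (take k.+1 v) * weight Q n.+1 v)%:E).
  by apply/measurable_EFinP; apply: measurable_funM => //; exact: (bump_measurable_take _ D0 Hp).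
(* [ge0_integral_insert] wants nonnegativity on all sequences, while the sign of [psi] is known only
   at length [k.+1]; other lengths are sent to 0. *)
pose cut (s : seq E) (r : R) : \bar R := if size s == n.+1 then r%:E else 0%E.
have cutE (v : n.+1.-tuple E) r : cut v r = r%:E by rewrite /cut size_tuple eqxx.
have cut0 s r : (size s = n.+1 -> 0 <= r) -> (0 <= cut s r)%E.
  by rewrite /cut; case: eqP => // h /(_ h); rewrite lee_fin.
have sz s : size s = n.+1 -> 0 <= psi (nth x0 s i :: take k s) * weight Q n.+1 s.
  move=> sn; rewrite mulr_ge0 ?weight_ge0//.
  have : size (nth x0 s i :: take k s) = k.+1 by rewrite /= size_takel// sn leqW.
  by case/(bump_bound Hp)/andP.
have sz2 s : size s = n.+1 -> 0 <= psi (take k.+1 s) * weight Q n.+1 s.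
  move=> sn; rewrite mulr_ge0 ?weight_ge0//.
  have : size (take k.+1 s) = k.+1 by rewrite size_takel// sn.
  by case/(bump_bound Hp)/andP.
transitivity (\int[Ln n.+1]_v cut v (psi (nth x0 v i :: take k v) * weight Q n.+1 v)%R)%E.
  by apply: eq_integral => v _; rewrite cutE.
rewrite (@ge0_integral_insert _ _ _ (Lebd R d) i n
  (fun s => cut s (psi (nth x0 s i :: take k s) * weight Q n.+1 s)))//; last 2 first.
- by under eq_fun do rewrite cutE.
- by move=> s; apply: cut0; exact: sz.
rewrite ge0_tpmSE//; last by move=> v; rewrite lee_fin sz2 ?size_tuple.
apply: eq_integral => t _; apply: eq_integral => v _.
have vn : size v = n by rewrite size_tuple.
have s1 : size (take i v ++ t :: drop i v) = n.+1.
  by rewrite size_cat/= addnS -size_cat cat_take_drop vn.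
have si : size (take i v) = i by rewrite size_takel// vn.
rewrite /cut s1 eqxx; congr (psi _ * _)%:E.
  rewrite nth_cat si ltnn subnn /=; congr cons.
  by rewrite takel_cat ?si// take_takel.
by apply: (weight_insert Q0 KQ); rewrite vn.
Qed.

(* Averaging the [k+1]-st coordinate over all particles replaces it by the
   empirical measure, which [empirical_bound] compares with [mu]. *)
Lemma marginal_lower k M D b psi kappa : 0 <= M -> 0 <= D -> bump k M D b psi -> 0 < kappa ->
  exists N, forall n, (N <= n)%N ->
  (\int[tpm mu k]_v (psi v)%:E * Z n <=
   \int[Ln n]_v (psi (take k v) * weight Q n v)%:E + kappa%:E * Z n)%E.
Proof.
elim: k psi kappa => [|k IH] psi kappa M0 D0 Hp k0.
  exists 0%N => n _.
  have psi0 : 0 <= psi [::] by case/andP: (bump_bound Hp (erefl : size [::] = 0%N)).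
  have W0 (v : n.-tuple E) : (0 <= (weight Q n v)%:E)%E by rewrite lee_fin weight_ge0.
  rewrite tpm0E//; last first.
    rewrite (_ : (fun v => _) = fun=> (psi [::])%:E); first exact: measurable_cst.
    by apply/funext => v; rewrite tuple0.
  rewrite -ge0_integralZl//; last by apply/measurable_EFinP; exact: measurable_weight.
  under [X in (_ <= X + _)%E]eq_integral do rewrite take0 EFinM.
  rewrite leeDl// mule_ge0 ?lee_fin ?(ltW k0)//.
  exact: integral_ge0.
have Hm := bump_marg D0 Hp.
(* Four losses of kappa/4: the induction hypothesis, the empirical comparison, the indices below
   [k], and the bad configurations. *)
pose ka := kappa / 4; have ka0 : 0 < ka by rewrite divr_gt0.
have [N1 HN1] := IH (marg psi) ka M0 D0 Hm ka0.
have [V V0 HV] := compact_integral_bound b M0.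
have [eta eta0 [N2 HN2]] := empirical_bound Q0 cQ C00 KQ QS d0 frullani cC muQ M0 D0 V0 ka0.
have ka1 : 0 < kappa / 4 / (M + 1) by rewrite divr_gt0//; lra.
have [N3 HN3] := partition_conc Q0 cQ C00 KQ QS d0 intQ muQ eta0 ka1.
have [N4 HN4] := ex_natr_ge (k%:R * M / ka).
exists (maxn k.+1 (maxn N1 (maxn N2 (maxn N3 N4)))) => n.
rewrite !geq_max => /andP[kn /andP[n1 /andP[n2 /andP[n3 n4]]]].
have kn' : (k <= n)%N by exact: ltnW.
have n0 : (0 < n)%N by exact: leq_trans kn.
have nR : 0 < n%:R :> R by rewrite ltr0n.
have Zfin : (Z n \is a fin_num)%E.
  rewrite ge0_fin_numE; first exact: (partition_fin Q0 cQ KQ intQ).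
  by apply: integral_ge0 => v _; rewrite lee_fin weight_ge0.
have Zge0 : (0 <= Z n)%E by apply: integral_ge0 => v _; rewrite lee_fin weight_ge0.
have szt (v : n.-tuple E) : size (take k v) = k by rewrite size_takel ?size_tuple.
pose G (v : n.-tuple E) := marg psi (take k v).
pose F (i : nat) (v : n.-tuple E) := psi (nth x0 v i :: take k v).
have FM i v : 0 <= F i v <= M by apply: (bump_bound Hp); rewrite /= szt.
pose G' (v : n.-tuple E) := n%:R^-1 * \sum_(i < n) F i v + ka.
have mF i : measurable_fun setT (F i) by exact: (bump_measurable_nth_take _ kn' D0 Hp).
have mG : measurable_fun setT G by exact: (bump_measurable_take kn' D0 Hm).
have mS : measurable_fun setT (fun v => \sum_(i < n) F i v) by exact: measurable_sum.
have mG' : measurable_fun setT G' by apply: measurable_funD => //; exact: measurable_funM.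
have S0 v : 0 <= \sum_(i < n) F i v.
  by apply: sumr_ge0 => i _; case/andP: (FM i v).
(* For a fixed configuration, the section of [psi] at [take k v] is a test function with the
   constants of [psi], to which the uniform bound applies. *)
have good (v : n.-tuple E) :
    (pairsum (KK Q C0) v + pairsum (KK Q C0) v < (n%:R ^+ 2 * (fine (JJ Q C0 mu mu) + 2 * eta))%:E)%E ->
    G v <= G' v.
  move=> gv; rewrite -lee_fin (margE D0 Hp (szt v)).
  have sM x : 0 <= psi (x :: take k v) <= M by apply: (bump_bound Hp); rewrite /= szt.
  have m1 := bump_measurable_section (szt v) D0 Hp.
  have := HN2 n n2 v gv (fun x => psi (x :: take k v)) m1 sM.
  rewrite big_tuple (eq_bigr (fun i : 'I_n => F i v)); last first.
    by move=> i _; rewrite /F (tnth_nth x0).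
  apply.
    move=> x z; have := bump_lip Hp (s := x :: take k v) (t := z :: take k v).
    by rewrite sdist_cons sdistss addr0; apply; rewrite /= szt.
  apply: HV => // x bx; apply: (bump_supp Hp (x := x)) => //; exact: mem_head.
have conc := HN3 n n3 G G' M mG mG' _ _ good.
have {}conc := conc (fun v => bump_bound Hm (szt v)).
have G'0 v : 0 <= G' v by rewrite /G' addr_ge0 ?(ltW ka0)// mulr_ge0 ?invr_ge0.
have {}conc := conc G'0.
have mW : measurable_fun setT (fun v : n.-tuple E => weight Q n v) by exact: measurable_weight.
have W0 (v : n.-tuple E) : 0 <= weight Q n v by exact: weight_ge0.
set X := (\int[Ln n]_v (psi (take k.+1 v) * weight Q n v)%:E)%E.
have FX i : (k <= i)%N -> (i < n)%N -> (\int[Ln n]_v (F i v * weight Q n v)%:E = X)%E.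
  by move=> ki i_n; exact: (insert_marginal D0 Hp).
have X0 : (0 <= X)%E.
  rewrite -(FX k (leqnn k) kn); apply: integral_ge0 => v _.
  by rewrite lee_fin mulr_ge0//; case/andP: (FM k v).
have FZ i : (\int[Ln n]_v (F i v * weight Q n v)%:E <= M%:E * Z n)%E.
  rewrite -ge0_integralZl//.
  - apply: ge0_le_integral => //.
    + by move=> v _; rewrite lee_fin mulr_ge0//; case/andP: (FM i v).
    + by apply/measurable_EFinP; exact: measurable_funM.
    + by apply: measurable_funeM; exact/measurable_EFinP.
    by move=> v _; rewrite -EFinM lee_fin ler_wpM2r//; case/andP: (FM i v).
  - exact/measurable_EFinP.
  - by move=> v _; rewrite lee_fin.
have mFW i : measurable_fun setT (fun v => (F i v * weight Q n v)%:E).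
  by apply/measurable_EFinP; exact: measurable_funM.
have FW0 i v : (0 <= (F i v * weight Q n v)%:E)%E.
  by rewrite lee_fin mulr_ge0//; case/andP: (FM i v).
have G'X : (\int[Ln n]_v (G' v * weight Q n v)%:E <= X + (2 * ka)%:E * Z n)%E.
  have -> : (\int[Ln n]_v (G' v * weight Q n v)%:E =
      n%:R^-1%:E * (\sum_(i < n) \int[Ln n]_v (F i v * weight Q n v)%:E) + ka%:E * Z n)%E.
    have mW' : measurable_fun setT (fun v : n.-tuple E => (weight Q n v)%:E) by exact/measurable_EFinP.
    have W0' (v : n.-tuple E) : (0 <= (weight Q n v)%:E)%E by rewrite lee_fin.
    have nV : (0 <= n%:R^-1%:E :> \bar R)%E by rewrite lee_fin invr_ge0.
    have kaE : (0 <= ka%:E)%E by rewrite lee_fin ltW.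
    have mSu : measurable_fun setT (fun v => \sum_(i < n) (F i v * weight Q n v)%:E)%E.
      by apply: emeasurable_sum => i; exact: mFW.
    have Su0 v : (0 <= \sum_(i < n) (F i v * weight Q n v)%:E)%E by apply: sume_ge0 => i _; exact: FW0.
    rewrite -ge0_integral_sum//.
    rewrite -[X in _ = (X + _)%E]ge0_integralZl// -[X in _ = (_ + X)%E]ge0_integralZl//.
    rewrite -ge0_integralD//; last 4 first.
    - by move=> v _; rewrite mule_ge0.
    - exact: measurable_funeM.
    - by move=> v _; rewrite mule_ge0.
    - exact: measurable_funeM.
    apply: eq_integral => v _; rewrite sumEFin -!EFinM -EFinD /G' -mulr_suml; congr EFin; ring.
  have [x Xx x0'] : exists2 x, X = x%:E & 0 <= x.
    have := FZ k; rewrite (FX k (leqnn k) kn) -(fineK Zfin) -EFinM => Xle.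
    have Xf : X \is a fin_num by rewrite ge0_fin_numE// (le_lt_trans Xle) ?ltry.
    by exists (fine X); rewrite ?fineK// fine_ge0.
  set z := fine (Z n); have zE : Z n = z%:E by rewrite fineK.
  have z0 : 0 <= z by rewrite fine_ge0.
  have sumle : (\sum_(i < n) \int[Ln n]_v (F i v * weight Q n v)%:E <=
      (k%:R * M * z + n%:R * x)%:E)%E.
    apply: (@le_trans _ _ (\sum_(i < n) ((if (i < k)%N then M * z else 0) + x)%:E)%E).
      (* An index below [k] repeats one of the first [k] particles, so it gets the crude bound;
         there are only [k] of them among [n]. *)
      apply: lee_sum => i _; case: ltnP => ik; last by rewrite add0r -Xx (FX i ik (ltn_ord i)).
      by apply: (le_trans (FZ i)); rewrite zE -EFinM lee_fin lerDl.
    rewrite sumEFin big_split/= -big_mkcond -(big_ord_widen n (fun=> M * z) kn').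
    by rewrite !sumr_const !card_ord -mulrA -[M * z *+ k]mulr_natl -[x *+ n]mulr_natl.
  have nV : (0 <= n%:R^-1%:E :> \bar R)%E by rewrite lee_fin invr_ge0.
  apply: (le_trans (leeD2r _ (lee_wpmul2l nV sumle))).
  rewrite zE Xx -!EFinM -!EFinD lee_fin mulrDr mulKf ?gt_eqF//.
  have kM : n%:R^-1 * (k%:R * M) <= ka.
    by have := HN4 n n4; rewrite ler_pdivrMr// [X in _ -> X <= _]mulrC ler_pdivrMr// (mulrC ka).
  by have := ler_wpM2r z0 kM; lra.
apply: (le_trans (_ : _ <= \int[Ln n]_v (G v * weight Q n v)%:E + ka%:E * Z n)%E).
  by rewrite -(integral_marg D0 Hp); exact: HN1.
apply: (@le_trans _ _ (X + (2 * ka)%:E * Z n + (M * (kappa / 4 / (M + 1)))%:E * Z n + ka%:E * Z n)%E).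
  by rewrite leeD2r// (le_trans conc)// leeD2r.
have Mk : M * (kappa / 4 / (M + 1)) <= ka.
  by rewrite /ka mulrCA ler_piMr ?divr_ge0 ?(ltW k0)// ler_pdivrMr; lra.
have z0 : 0 <= fine (Z n) by rewrite fine_ge0.
have zE : Z n = (fine (Z n))%:E by rewrite fineK.
move: zE z0; move: (fine (Z n)) => z -> z0.
clearbody X; rewrite -!EFinM -!addeA; apply: leeD2l; rewrite -!EFinD lee_fin.
by have := ler_wpM2r z0 Mk; rewrite /ka; lra.
Qed.

End marginals.

(** * Lipschitz minorants of bounded continuous functions *)

Section continuous_marginals.
Context (R : realType) (d : nat) (k : nat).
Local Notation E := (d.-tuple R).
Local Notation x0 := ([tuple of nseq d 0] : E).

(** Turns the prefix of a configuration back into a [k]-tuple, the domain of the continuous test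
    function; padding makes it total. *)
Definition prefix_tuple (s : seq E) : k.-tuple E := [tuple nth x0 s i | i < k].

Lemma prefix_tupleE (s : seq E) : (k <= size s)%N -> prefix_tuple s = take k s :> seq E.
Proof.
move=> ks; apply: (@eq_from_nth _ x0); first by rewrite size_tuple size_takel.
by move=> i; rewrite size_tuple => ik; rewrite (nth_mktuple _ _ (Ordinal ik)) nth_take.
Qed.

Lemma prefix_tuple_cat (y : k.-tuple E) s : prefix_tuple (y ++ s) = y.
Proof.
apply/val_inj; rewrite [LHS]prefix_tupleE ?size_cat ?size_tuple ?leq_addr//.
by rewrite take_size_cat ?size_tuple.
Qed.

Lemma measurable_prefix_tuple n : measurable_fun setT (fun v : n.-tuple E => prefix_tuple v).
Proof.
rewrite (_ : (fun v => _) = fun v : n.-tuple E =>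
    [tuple nth x0 v (tnth [tuple of iota 0 k] j) | j < k]); first exact: measurable_nths.
apply/funext => v; apply: eq_from_tnth => i; rewrite !tnth_mktuple.
by rewrite (tnth_nth 0%N) nth_iota.
Qed.

Variables (g : k.-tuple E -> R) (M : R).
Hypotheses (cg : continuous_Rdk g) (gM : forall v, 0 <= g v <= M).

Lemma sdist_triangle (w v u : k.-tuple E) : sdist v u <= sdist v w + sdist w u.
Proof.
by rewrite !sdistE -big_split/=; apply: ler_sum => i _; exact: edist_triangle.
Qed.

(** On [k]-tuples, the largest function below [g] that is [m]-Lipschitz for [sdist]. *)
Definition infconv (m : nat) (s : seq E) : R :=
  inf [set g y + m%:R * sdist s y | y in [set: k.-tuple E]].

Let lb0 m s : lbound [set g y + m%:R * sdist s y | y in [set: k.-tuple E]] 0.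
Proof.
by move=> _ [y _ <-]; rewrite addr_ge0 ?mulr_ge0 ?sdist_ge0//; case/andP: (gM y).
Qed.

Let ne m s : [set g y + m%:R * sdist s y | y in [set: k.-tuple E]] !=set0.
Proof. by exists (g [tuple of nseq k x0] + m%:R * sdist s [tuple of nseq k x0]); exists [tuple of nseq k x0]. Qed.

Let infconv_le m s (y : k.-tuple E) : infconv m s <= g y + m%:R * sdist s y.
Proof. by apply: ge_inf; [exists 0; exact: lb0|exists y]. Qed.

Let infconv_ge0 m s : 0 <= infconv m s.
Proof. by apply: lb_le_inf; [exact: ne|exact: lb0]. Qed.

Let infconv_leg m (v : k.-tuple E) : infconv m v <= g v.
Proof. by have := infconv_le m v v; rewrite sdistss mulr0 addr0. Qed.

Let infconv_lip m (v w : k.-tuple E) : infconv m v <= infconv m w + m%:R * sdist v w.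
Proof.
rewrite -lerBlDr; apply: lb_le_inf; first exact: ne.
move=> _ [y _ <-]; have h1 := infconv_le m v y.
have := ler_wpM2l (ler0n R m) (sdist_triangle w v y); lra.
Qed.

(** Vanishes as soon as one entry has norm at least [m], and at a fixed point exceeds any bound on
    [g] for large [m]. *)
Definition cutoff (m : nat) (s : seq E) : R := Num.max 0 (m%:R - \sum_(x <- s) enorm x).

Let cutoff_ge0 m s : 0 <= cutoff m s. Proof. by rewrite le_max lexx. Qed.

Let cutoff_lip m (v w : k.-tuple E) : cutoff m v <= cutoff m w + sdist v w.
Proof.
have sd0 := sdist_ge0 v w.
rewrite /cutoff ge_max; apply/andP; split; first by rewrite addr_ge0// le_max lexx.
have : \sum_(x <- w) enorm x <= \sum_(x <- v) enorm x + sdist v w.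
  rewrite sdistE !big_tuple -big_split/=; apply: ler_sum => i _; exact: enorm_le.
have : m%:R - \sum_(x <- w) enorm x <= Num.max 0 (m%:R - \sum_(x <- w) enorm x).
  by rewrite le_max lexx orbT.
by lra.
Qed.

Definition bump_approx (m : nat) (s : seq E) : R := Num.min (infconv m s) (cutoff m s).

Lemma bump_bump_approx m : bump k M (m%:R + 1) m%:R (bump_approx m).
Proof.
split.
- move=> s sk; have sk' : size s == k by apply/eqP.
  rewrite /bump_approx le_min infconv_ge0 cutoff_ge0/= ge_min; apply/orP; left.
  apply: (le_trans (infconv_leg m (Tuple sk'))); by case/andP: (gM (Tuple sk')).
- move=> s t sk tk; have sk' : size s == k by apply/eqP.
  have tk' : size t == k by apply/eqP.
  have h1 := infconv_lip m (Tuple sk') (Tuple tk').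
  have h2 := cutoff_lip m (Tuple sk') (Tuple tk').
  have sd0 := sdist_ge0 s t; rewrite /= in h1 h2.
  have md0 : 0 <= m%:R * sdist s t by rewrite mulr_ge0.
  rewrite /bump_approx {2}/Order.min; case: ifPn => _; rewrite ge_min; apply/orP; [left|right]; lra.
- move=> s x xs mx; rewrite /bump_approx /cutoff max_l; last first.
    rewrite subr_le0 (le_trans mx)// (perm_big _ (perm_to_rem xs)) big_cons lerDl.
    by apply: sumr_ge0 => y _; exact: enorm_ge0.
  by rewrite min_r.
Qed.

Lemma bump_approx_le m (v : k.-tuple E) : bump_approx m v <= g v.
Proof. by rewrite /bump_approx ge_min infconv_leg. Qed.

(** For m >= M / dl, points at distance at least [dl] cost at least [M] in the infimum; the nearer
    ones are handled by continuity. *)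
Lemma bump_approx_cvg (v : k.-tuple E) : bump_approx m v @[m --> \oo] --> g v.
Proof.
have /andP[g0 gMv] := gM v.
apply/cvgrPdist_le => e e0.
have [dl dl0 Hdl] := cg v e0.
have [N1 HN1] := ex_natr_ge (M / dl).
have [N2 HN2] := ex_natr_ge (M + \sum_(x <- v) enorm x).
exists (maxn N1 N2) => // m /=; rewrite geq_max => /andP[m1 m2].
rewrite ger0_norm ?subr_ge0 ?bump_approx_le// lerBlDr addrC -lerBlDr.
rewrite /bump_approx le_min; apply/andP; split; last first.
  rewrite /cutoff le_max; apply/orP; right; have := HN2 m m2; lra.
apply: lb_le_inf; first exact: ne.
move=> _ [y _ <-]; have sd0 := sdist_ge0 v y.
have /andP[gy0 _] := gM y.
have [near|/existsNP[i /negP]] := pselect (forall i, edist (tnth v i) (tnth y i) < dl).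
  have := Hdl y near; rewrite ltr_norml => /andP[_ h].
  have : 0 <= m%:R * sdist v y by rewrite mulr_ge0.
  by lra.
rewrite -leNgt => dli.
have h : dl <= sdist v y.
  rewrite (le_trans dli)// sdistE (bigD1 i)//= lerDl.
  by apply: sumr_ge0 => j _; exact: edist_ge0.
have := HN1 m m1; rewrite ler_pdivrMr// => h2.
have := ler_wpM2l (ler0n R m) h; lra.
Qed.

End continuous_marginals.

(** * Convergence of the correlation functions *)

Section limit.
Context (R : realType) (d : nat) (Q : d.-tuple R -> R) (C0 c : R).
Local Notation E := (d.-tuple R).
Hypothesis Q0 : forall x, 0 <= Q x.
Hypothesis cQ : continuous_Rd Q.
Hypothesis C00 : 0 <= C0.
Hypothesis KQ : forall x y, x != y ->
  (Q x + Q y) / 4 <= - ln (edist x y) + Q x / 2 + Q y / 2 + C0.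
Hypothesis QS : forall e, 0 < e ->
  exists2 dl : R, 0 < dl & forall x y, edist x y <= dl -> Q y <= (1 + e) * Q x + e.
Hypothesis d0 : (0 < d)%N.
Hypothesis frullani : forall a : R, 0 <= a ->
  ((if (a == 0)%R then +oo else (- (2^-1 * ln a))%:E) + rfun a = pfun a + c%:E)%E.
Hypothesis cC : 0 <= c + C0.
Hypothesis lnQ : forall th, 0 < th ->
  exists2 C : R, 0 <= C & forall x, ln (1 + enorm x) <= th * Q x + C.
Variable mu : probability E R.
Hypothesis muQ : is_equilibrium_measure Q mu.
Local Notation Ln n := (tpm (Lebd R d) n).
Local Notation Z n := (\int[Ln n]_v (weight Q n v)%:E)%E.
Local Notation h := (fun x : E => expR (- Q x)).

Let intQ : (\int[Lebd R d]_x (h x)%:E < +oo)%E.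
Proof. exact: integral_expNQ. Qed.

Let mh : measurable_fun setT h. Proof. exact: measurable_expNQ. Qed.

Let leb_intE (G : R -> \bar R) : measurable_fun setT G -> (forall t, 0 <= G t)%E ->
  leb_int G = (\int[Leb1 R]_t G t)%E.
Proof. by move=> mG G0; rewrite ge0_integral_onR. Qed.

Let leb_int_RdE (G : E -> \bar R) : measurable_fun setT G -> (forall t, 0 <= G t)%E ->
  leb_int_Rd G = (\int[Lebd R d]_t G t)%E.
Proof. exact: (ge0_iter_intE leb_intE). Qed.

Let leb_int_RdmE n (F : n.-tuple E -> \bar R) : measurable_fun setT F ->
  (forall v, 0 <= F v)%E -> leb_int_Rdm F = (\int[Ln n]_v F v)%E.
Proof. exact: (ge0_iter_intE leb_int_RdE). Qed.

(** The test function is signed, so domination is used at two levels: inside R^d by a product of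
    [cauchy] factors, which bounds exp(-Q), and across the particles by a product of exp(-Q). *)
Let dom_leb_int_RdE (G : E -> \bar R) : measurable_fun setT G ->
  (exists a : R, forall t, `|G t| <= (a * h t)%:E)%E ->
  leb_int_Rd G = (\int[Lebd R d]_t G t)%E.
Proof.
move=> mG [a aG]; have [C Cge0 HC] := expNQ_le lnQ.
apply: (@dom_iter_intE _ _ _ (Leb1 R) _ d (@cauchy R) (`|a| * C)) => //.
- move=> F mF [b bF]; rewrite /leb_int integral_onR//.
  apply: (@le_lt_trans _ _ (\int[lebesgue_measure]_t (`|b| * cauchy t)%:E)%E).
    apply: ge0_le_integral => //.
    + exact: measurableT_comp.
    + by apply/measurable_EFinP; apply: measurable_funM => //; exact: measurable_cauchy.
    move=> t _; apply: (le_trans (bF t)); rewrite lee_fin.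
    by rewrite ler_wpM2r ?cauchy_ge0// ler_norm.
  have mc : measurable_fun setT (fun t : R => (cauchy t)%:E).
    by apply/measurable_EFinP; exact: measurable_cauchy.
  have c0 (t : R) : (0 <= (cauchy t)%:E)%E by rewrite lee_fin cauchy_ge0.
  rewrite -ge0_integral_onR; last 2 first.
  + by apply/measurable_EFinP; apply: measurable_funM => //; exact: measurable_cauchy.
  + by move=> t; rewrite lee_fin mulr_ge0 ?cauchy_ge0.
  under eq_integral do rewrite EFinM.
  rewrite ge0_integralZl//.
  have := integral_cauchy R; have := @integral_ge0 _ _ _ (Leb1 R) setT _ (fun x _ => c0 x).
  by case: (\int[_]_x _)%E => [r| |]// _ _; rewrite -EFinM ltry.
- exact: measurable_cauchy.
- exact: cauchy_ge0.
- exact: integral_cauchy.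
- by rewrite mulr_ge0.
move=> v; apply: (le_trans (aG v)); rewrite lee_fin -mulrA.
apply: (@le_trans _ _ (`|a| * h v)); first by rewrite ler_wpM2r ?expR_ge0// ler_norm.
by rewrite ler_wpM2l.
Qed.

Let dom_leb_int_RdmE k (C : R) (F : k.-tuple E -> \bar R) : measurable_fun setT F ->
  0 <= C -> (forall v, `|F v| <= (C * \prod_(i < k) h (tnth v i))%:E)%E ->
  leb_int_Rdm F = (\int[Ln k]_v F v)%E.
Proof.
move=> mF Cge0 FC.
by apply: (dom_iter_intE dom_leb_int_RdE mh _ intQ mF Cge0 FC) => t; exact: expR_ge0.
Qed.

Let mW n m : measurable_fun setT (fun v : m.-tuple E => (weight Q n v)%:E).
Proof. by apply/measurable_EFinP; exact: measurable_weight. Qed.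

Let W0 n s : (0 <= (weight Q n s)%:E)%E. Proof. by rewrite lee_fin weight_ge0. Qed.

Let ZnE n : Zn Q n = Z n. Proof. exact: leb_int_RdmE. Qed.

Let Zfin n : Z n \is a fin_num.
Proof.
rewrite ge0_fin_numE; first exact: (partition_fin Q0 cQ KQ intQ).
by apply: integral_ge0 => v _.
Qed.

Section at_n.
Variables (k m : nat).
Local Notation n := (k + m)%N.
Hypothesis Zgt0 : 0 < fine (Z n).
Local Notation z := (fine (Z n)).

Let mWcat : measurable_fun setT (fun p : k.-tuple E * m.-tuple E => (weight Q n (p.1 ++ p.2))%:E).
Proof. by apply: (measurableT_comp (@mW n n)); exact: measurable_cat_tuple. Qed.

Let RknE (y : k.-tuple E) :
  Rkn Q n y = (z^-1%:E * \int[Ln m]_u (weight Q n (y ++ u))%:E)%E.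
Proof.
rewrite /Rkn /Dn ZnE; congr (_ * _)%E; rewrite addKn; apply: leb_int_RdmE => //.
exact: (measurableT_comp mWcat (pair1_measurable y)).
Qed.

Let B : R := fine (\int[Lebd R d]_x (h x)%:E)%E.

(** Makes the correlation function finite at every point and integrable against bounded
    functions. *)
Let inner_le (y : k.-tuple E) : (\int[Ln m]_u (weight Q n (y ++ u))%:E <=
  (wcst C0 n * B ^+ m * \prod_(i < k) h (tnth y i))%:E)%E.
Proof.
have mhE : measurable_fun setT (fun x => (h x)%:E) by exact/measurable_EFinP.
have h0 x : (0 <= (h x)%:E)%E by rewrite lee_fin expR_ge0.
have hB : (\int[Lebd R d]_x (h x)%:E)%E = B%:E by rewrite fineK// ge0_fin_numE// integral_ge0.
have mp : measurable_fun setT (fun u : m.-tuple E => \prod_(i < m) (h (tnth u i))%:E)%E.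
  by apply: emeasurable_prod => i; exact: (measurableT_comp mhE (measurable_tnth i)).
pose a := wcst C0 n * \prod_(i < k) h (tnth y i).
have a0 : 0 <= a.
  by rewrite /a mulr_ge0 ?(ltW (wcst_gt0 _ _))// prodr_ge0// => i _; exact: expR_ge0.
apply: (@le_trans _ _ (\int[Ln m]_u (a%:E * \prod_(i < m) (h (tnth u i))%:E))%E).
  apply: ge0_le_integral => //.
  - exact: (measurableT_comp mWcat (pair1_measurable y)).
  - exact: measurable_funeM.
  move=> u _; rewrite prodEFin -EFinM lee_fin.
  have := @weight_le _ _ _ _ Q0 KQ n (y ++ u) 0.
  rewrite size_cat !size_tuple oppr0 expR0 mulr1 big_cat/= !big_tuple /a -mulrA; apply=> //.
  by rewrite adde_ge0// pairsum_ge0// => x x'; exact: KK_ge0.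
rewrite ge0_integralZl//; last by move=> u _; exact: prode_ge0.
rewrite (@ge0_integral_prod _ _ _ (Lebd R d) m (fun _ x => (h x)%:E))//.
by rewrite hB prodEFin prodr_const card_ord -EFinM lee_fin /a mulrAC.
Qed.

Let r (y : k.-tuple E) : R := fine (Rkn Q n y).

Let inner_ge0 (y : k.-tuple E) : (0 <= \int[Ln m]_u (weight Q n (y ++ u))%:E)%E.
Proof. exact: integral_ge0. Qed.

Let rE (y : k.-tuple E) : Rkn Q n y = (r y)%:E.
Proof.
rewrite fineK// RknE fin_numM// ge0_fin_numE//.
exact: le_lt_trans (inner_le y) (ltry _).
Qed.

Let zV : 0 <= z^-1. Proof. by rewrite invr_ge0 ltW. Qed.

Let r_ge0 y : 0 <= r y.
Proof. by rewrite -lee_fin -rE RknE mule_ge0 ?lee_fin. Qed.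

Let mr : measurable_fun setT r.
Proof.
apply/measurable_EFinP; rewrite (_ : _ \o _ = fun y : k.-tuple E =>
    (z^-1%:E * \int[Ln m]_u (weight Q n (y ++ u))%:E)%E); last first.
  by apply/funext => y /=; rewrite -rE RknE.
by apply: measurable_funeM; exact: (measurable_fun_fubini_tonelli_F _ mWcat).
Qed.

Let C1 : R := z^-1 * (wcst C0 n * B ^+ m).

Let r_le y : r y <= C1 * \prod_(i < k) h (tnth y i).
Proof.
rewrite -lee_fin -rE RknE /C1 -mulrA EFinM lee_wpmul2l ?lee_fin//.
Qed.

Let C1_ge0 : 0 <= C1.
Proof.
rewrite /C1 mulr_ge0// mulr_ge0 ?(ltW (wcst_gt0 _ _))// exprn_ge0// fine_ge0//.
by apply: integral_ge0 => x _; rewrite lee_fin expR_ge0.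
Qed.

Let int_gr (g : k.-tuple E -> R) : measurable_fun setT g -> (forall y, 0 <= g y) ->
  (\int[Ln k]_y (g y * r y)%:E =
   z^-1%:E * \int[Ln n]_v (g (prefix_tuple k v) * weight Q n v)%:E)%E.
Proof.
move=> mg g0.
have mgw : measurable_fun setT (fun v : n.-tuple E => (g (prefix_tuple k v) * weight Q n v)%:E).
  apply/measurable_EFinP; apply: measurable_funM; last exact: measurable_weight.
  exact: (measurableT_comp mg (@measurable_prefix_tuple R d k n)).
have gw0 s : (0 <= (g (prefix_tuple k s) * weight Q n s)%:E)%E.
  by rewrite lee_fin mulr_ge0 ?weight_ge0.
rewrite -(ge0_integral_cat _ mgw gw0) -ge0_integralZl//; last 2 first.
- apply: (measurable_fun_fubini_tonelli_F (fun p : k.-tuple E * m.-tuple E =>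
    (g (prefix_tuple k (p.1 ++ p.2)) * weight Q n (p.1 ++ p.2))%:E)) => //.
  by apply: (measurableT_comp mgw); exact: measurable_cat_tuple.
- by move=> y _; exact: integral_ge0.
apply: eq_integral => y _.
rewrite [X in _ = (_ * X)%E](eq_integral (fun u : m.-tuple E => (g y)%:E * (weight Q n (y ++ u))%:E)%E); last first.
  move=> u _; have e := prefix_tuple_cat y u.
  by rewrite -EFinM; congr (g _ * _)%:E.
rewrite ge0_integralZl//; last 2 first.
- exact: (measurableT_comp mWcat (pair1_measurable y)).
- by rewrite lee_fin.
by rewrite muleCA -RknE rE -EFinM.
Qed.

Lemma correlation_integrable (phi : k.-tuple E -> R) (M : R) :
  measurable_fun setT phi -> (forall y, `|phi y| <= M) ->
  (Ln k).-integrable setT (fun y => (phi y * fine (Rkn Q n y))%:E) /\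
  leb_int_Rdm (fun y => ((phi y)%:E * Rkn Q n y)%E) =
    (\int[Ln k]_y (phi y * fine (Rkn Q n y))%:E)%E.
Proof.
move=> mphi phiM.
have M0 : 0 <= M by exact: le_trans (normr_ge0 _) (phiM [tuple of nseq k [tuple of nseq d 0]]).
have mF : measurable_fun setT (fun y => (phi y * r y)%:E).
  by apply/measurable_EFinP; exact: measurable_funM.
have F_le y : (`|(phi y * r y)%:E| <= (M * C1 * \prod_(i < k) h (tnth y i))%:E)%E.
  rewrite abse_EFin lee_fin normrM (ger0_norm (r_ge0 y)) -mulrA.
  by apply: ler_pM.
have MC0 : 0 <= M * C1 by rewrite mulr_ge0.
have h0 x : 0 <= h x by exact: expR_ge0.
split; first by have [] := dom_integrable mh h0 intQ mF MC0 F_le.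
rewrite -(dom_leb_int_RdmE mF MC0 F_le); congr leb_int_Rdm; apply/funext => y.
by rewrite rE -EFinM.
Qed.

(** Both measures have mass one, so the constant [M] that makes the test function nonnegative
    contributes equally to the two sides. *)
Lemma correlation_lower (phi : k.-tuple E -> R) (M kappa : R) :
  measurable_fun setT phi -> (forall y, `|phi y| <= M) ->
  (\int[tpm mu k]_v (M + phi v)%:E * Z n <=
   \int[Ln n]_v ((M + phi (prefix_tuple k v)) * weight Q n v)%:E + kappa%:E * Z n)%E ->
  fine (\int[tpm mu k]_v (phi v)%:E)%E - kappa <=
    fine (\int[Ln k]_y (phi y * fine (Rkn Q n y))%:E)%E.
Proof.
move=> mphi phiM low.
have M0 : 0 <= M by exact: le_trans (normr_ge0 _) (phiM [tuple of nseq k [tuple of nseq d 0]]).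
have Mphi0 y : 0 <= M + phi y by have := phiM y; rewrite ler_norml => /andP[]; lra.
have [iF _] := correlation_integrable mphi phiM.
have afin := integrable_fin_num measurableT iF.
have MM y : `|(fun=> M) (y : k.-tuple E)| <= M by rewrite ger0_norm.
have [iM _] := correlation_integrable (measurable_cst M) MM.
have one : (\int[Ln k]_y (M * r y)%:E = M%:E)%E.
  rewrite (int_gr (g := fun=> M))//.
  have -> : (\int[Ln n]_v (M * weight Q n v)%:E = M%:E * Z n)%E.
    rewrite -ge0_integralZl//; last exact: mW.
  have zE : Z n = z%:E by rewrite fineK.
  set zz := z in zE *; rewrite zE -!EFinM mulrCA mulVf ?mulr1//.
  by rewrite gt_eqF.
have sum : (\int[Ln k]_y ((M + phi y) * r y)%:E = M%:E + \int[Ln k]_y (phi y * r y)%:E)%E.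
  rewrite -one -integralD//; apply: eq_integral => y _.
  by rewrite -EFinD mulrDl.
have mMp : measurable_fun setT (fun y => M + phi y) by exact: measurable_funD.
rewrite (int_gr mMp Mphi0) in sum.
have mu1 : (mu : {sigma_finite_measure set E -> \bar R}) setT = 1%E by exact: probability_setT.
have iphi : (tpm mu k).-integrable setT (fun v => (phi v)%:E).
  apply/integrableP; split; first exact/measurable_EFinP.
  apply: (@le_lt_trans _ _ (\int[tpm mu k]_v (cst M%:E v))%E).
    apply: ge0_le_integral => //.
    - by apply: measurableT_comp => //; exact/measurable_EFinP.
    by move=> v _; rewrite lee_fin.
  by rewrite integral_cst// [X in (_ * X)%E](tpm_setT mu1) mule1 ltry.
have icst : (tpm mu k).-integrable setT (fun v => M%:E).
  apply/integrableP; split; first exact: measurable_cst.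
  under eq_integral do rewrite abse_EFin.
  by rewrite integral_cst// [X in (_ * X)%E](tpm_setT mu1) mule1 ltry.
have phifin := integrable_fin_num measurableT iphi.
have sum2 : (\int[tpm mu k]_v (M + phi v)%:E = M%:E + \int[tpm mu k]_v (phi v)%:E)%E.
  under eq_integral do rewrite EFinD.
  by rewrite integralD// integral_cst// [X in (_ * X + _)%E](tpm_setT mu1) mule1.
rewrite sum2 in low.
set X := (\int[Ln n]_v ((M + _) * _)%:E)%E in low sum.
have XE : X = (z * (M + fine (\int[Ln k]_y (phi y * r y)%:E)%E))%:E.
  rewrite EFinM EFinD (fineK afin) -sum muleA -EFinM divff ?mul1e//.
  by rewrite gt_eqF.
have zE : Z n = z%:E by rewrite fineK.
rewrite XE -(fineK phifin) zE in low.
move: low; rewrite -EFinD -!EFinM -EFinD lee_fin (mulrC z) -mulrDl.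
by rewrite (ler_pM2r Zgt0) -addrA lerD2l lerBlDr.
Qed.

End at_n.

Let Z_gt0 : exists N, forall n, (N <= n)%N -> 0 < fine (Z n).
Proof.
have [N HN] := partition_lower Q0 cQ C00 KQ QS d0 intQ muQ ltr01.
exists N => n Nn; rewrite -lte_fin (fineK (Zfin n)); apply: lt_le_trans (HN n Nn).
by rewrite lte_fin mulr_gt0 ?expR_gt0// wcst_gt0.
Qed.

Let continuous_lower k (g : k.-tuple E -> R) (M kappa : R) :
  continuous_Rdk g -> (forall v, 0 <= g v <= M) -> 0 < kappa ->
  exists N, forall n, (N <= n)%N ->
  (\int[tpm mu k]_v (g v)%:E * Z n <=
   \int[Ln n]_v (g (prefix_tuple k v) * weight Q n v)%:E + kappa%:E * Z n)%E.
Proof.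
move=> cg gM k0.
have M0 : 0 <= M by have /andP[+ h] := gM [tuple of nseq k [tuple of nseq d 0]]; move/le_trans; apply.
have Hb m := bump_bump_approx gM m.
have m0 m : 0 <= m%:R + 1 :> R by rewrite addr_ge0.
have mg : measurable_fun setT g by exact: continuous_Rdk_measurable.
have ma m := bump_measurable (m0 m) (Hb m).
have mu1 : (mu : {sigma_finite_measure set E -> \bar R}) setT = 1%E by exact: probability_setT.
have icst : (tpm mu k).-integrable setT (fun v => M%:E).
  apply/integrableP; split; first exact: measurable_cst.
  under eq_integral do rewrite abse_EFin.
  by rewrite integral_cst// [X in (_ * X)%E](tpm_setT mu1) mule1 ltry.
have ab m (v : k.-tuple E) : 0 <= bump_approx g m v <= M.
  exact: (bump_bound (Hb m) (size_tuple v)).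
have cvg : ((\int[tpm mu k]_v (bump_approx g m v)%:E)%E @[m --> \oo] --> (\int[tpm mu k]_v (g v)%:E)%E).
  apply: (@dominated_cvg _ _ _ (tpm mu k) setT measurableT (fun m v => (bump_approx g m v)%:E)
    (fun v => (g v)%:E) (fun=> M%:E)) => //.
  - by move=> m; apply/measurable_EFinP; exact: ma.
  - move=> v _; apply: cvg_EFin; first exact: nearW.
    exact: bump_approx_cvg.
  - by move=> m v _; rewrite abse_EFin lee_fin ger0_norm; case/andP: (ab m v).
have gint : (\int[tpm mu k]_v (g v)%:E <= M%:E)%E.
  rewrite -[leRHS]mule1 -(tpm_setT mu1 k) -integral_cst//; apply: ge0_le_integral => //.
  - by move=> v _; rewrite lee_fin; case/andP: (gM v).
  - exact/measurable_EFinP.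
  - by move=> v _; rewrite lee_fin; case/andP: (gM v).
have gint0 : (0 <= \int[tpm mu k]_v (g v)%:E)%E.
  by apply: integral_ge0 => v _; rewrite lee_fin; case/andP: (gM v).
have gfin : (\int[tpm mu k]_v (g v)%:E)%E \is a fin_num.
  by rewrite ge0_fin_numE// (le_lt_trans gint) ?ltry.
rewrite -(fineK gfin) in cvg *; set ig := fine _ in cvg *.
have k2 : 0 < kappa / 2 by rewrite divr_gt0.
have [near1 near2] := (fine_cvgP _ _).1 cvg.
move/cvgrPdist_le : near2 => /(_ _ k2) near3.
(* One index [m] is fixed by convergence under [mu]; under the Gibbs weight only
   [bump_approx g m <= g] is used. *)
have [m [afin aclose]] := @filter_ex _ \oo _ _ (filterI near1 near3).
have ma0 : 0 <= m%:R :> R by [].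
have [N HN] := marginal_lower Q0 cQ C00 KQ QS d0 frullani cC intQ muQ M0 (m0 m) (Hb m) k2.
exists (maxn k N) => n; rewrite geq_max => /andP[kn Nn].
have := HN n Nn.
have pre (v : n.-tuple E) : take k v = prefix_tuple k v.
  by rewrite prefix_tupleE ?size_tuple.
have XY : (\int[Ln n]_v (bump_approx g m (take k v) * weight Q n v)%:E <=
   \int[Ln n]_v (g (prefix_tuple k v) * weight Q n v)%:E)%E.
  apply: ge0_le_integral => //.
  - by move=> v _; rewrite lee_fin pre mulr_ge0 ?weight_ge0//; case/andP: (ab m (prefix_tuple k v)).
  - apply/measurable_EFinP; apply: measurable_funM; last exact: measurable_weight.
    exact: (bump_measurable_take kn (m0 m) (Hb m)).
  - apply/measurable_EFinP; apply: measurable_funM; last exact: measurable_weight.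
    exact: (measurableT_comp mg (@measurable_prefix_tuple R d k n)).
  by move=> v _; rewrite lee_fin pre ler_wpM2r ?weight_ge0// (bump_approx_le gM).
move=> low; have {low} := le_trans low (leeD2r _ XY).
move: aclose; rewrite /= ler_norml => /andP[_ ac].
have z0 : 0 <= fine (Z n) by rewrite fine_ge0// integral_ge0.
rewrite -(fineK afin) -(fineK (Zfin n)).
set X := (\int[Ln n]_v (g (prefix_tuple k v) * _)%:E)%E; set ia := fine _ in ac *.
have X0 : (0 <= X)%E.
  by apply: integral_ge0 => v _; rewrite lee_fin mulr_ge0 ?weight_ge0//; case/andP: (gM (prefix_tuple k v)).
clearbody X; case: X X0 => [x| |]// _; last by move=> _; rewrite -EFinM addye// leey.
rewrite -!EFinM -!EFinD !lee_fin => lo.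
by have := ler_wpM2r z0 ac; lra.
Qed.

Let limit_lower k (phi : k.-tuple E -> R) (M kappa : R) :
  continuous_Rdk phi -> (forall y, `|phi y| <= M) -> 0 < kappa ->
  exists N, forall n, (N <= n)%N ->
  fine (\int[tpm mu k]_v (phi v)%:E)%E - kappa <=
    fine (\int[Ln k]_y (phi y * fine (Rkn Q n y))%:E)%E.
Proof.
move=> cphi phiM k0.
have cM : continuous_Rdk (fun y => M + phi y).
  move=> x e e0; have [dl dl0 H] := cphi x e e0; exists dl => // y xy.
  by rewrite opprD addrACA subrr add0r; exact: H.
have bM v : 0 <= M + phi v <= M + M.
  by have := phiM v; rewrite ler_norml => /andP[h1 h2]; apply/andP; split; lra.
have [N1 HN1] := continuous_lower cM bM k0.
have [N2 HN2] := Z_gt0.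
exists (maxn k (maxn N1 N2)) => n; rewrite !geq_max => /andP[kn /andP[n1 n2]].
have low := HN1 n n1; have zn := HN2 n n2.
move: low zn; rewrite -(subnKC kn) => low zn.
apply: (correlation_lower zn _ phiM low).
exact: continuous_Rdk_measurable.
Qed.

Lemma correlation_cvg k (phi : k.-tuple E -> R) :
  continuous_Rdk phi -> bounded_fun_on phi ->
  (fun n : nat => leb_int_Rdm (fun y => ((phi y)%:E * Rkn Q n y)%E))
    @ \oo --> mu_int_k mu (fun x => (phi x)%:E).
Proof.
move=> cphi [M phiM].
have M0 : 0 <= M by exact: le_trans (normr_ge0 _) (phiM [tuple of nseq k [tuple of nseq d 0]]).
have mphi : measurable_fun setT phi by exact: continuous_Rdk_measurable.
have mphiE : measurable_fun setT (fun v => (phi v)%:E) by exact/measurable_EFinP.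
have mu1 : (mu : {sigma_finite_measure set E -> \bar R}) setT = 1%E by exact: probability_setT.
have one : (\int[mu]_x (cst (1%R : R) x)%:E < +oo)%E.
  by have := probability_integral_cst mu (1%R)%:E; rewrite /cst/= => ->; rewrite ltry.
have phi_le v : (`|(phi v)%:E| <= (M * \prod_(i < k) cst (1%R : R) (tnth v i))%:E)%E.
  by rewrite abse_EFin lee_fin big1 ?mulr1.
have c1 (t : E) : 0 <= cst (1 : R) t by [].
have muE : mu_int_k mu (fun x => (phi x)%:E) = (\int[tpm mu k]_v (phi v)%:E)%E.
  exact: (@dom_iter_intE _ _ _ mu _ k (cst 1%R) M _ _ (measurable_cst (1%R : R)) c1 one mphiE M0 phi_le).
have [iphi _] := @dom_integrable _ _ _ mu k (cst (1%R : R)) M _ (measurable_cst _) c1 one mphiE M0 phi_le.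
have phifin := integrable_fin_num measurableT iphi.
rewrite muE -(fineK phifin).
have cN : continuous_Rdk (fun y => - phi y).
  move=> x e e0; have [dl dl0 H] := cphi x e e0; exists dl => // y xy.
  by rewrite -opprD normrN; exact: H.
have bN v : `|- phi v| <= M by rewrite normrN.
have oppE dT (T : measurableType dT) (m : {measure set T -> \bar R}) (f : T -> R) :
    m.-integrable setT (fun x => (f x)%:E) ->
    fine (\int[m]_x (- f x)%:E)%E = - fine (\int[m]_x (f x)%:E)%E.
  move=> fi; have ffin := integrable_fin_num measurableT fi.
  under eq_integral do rewrite -mulN1r EFinM.
  by rewrite integralZl// -[X in (_ * X)%E](fineK ffin) -EFinM mulN1r.
have [NZ HNZ] := Z_gt0.
have key n : (maxn k NZ <= n)%N ->
    leb_int_Rdm (fun y => ((phi y)%:E * Rkn Q n y)%E) =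
      (fine (\int[Ln k]_y (phi y * fine (Rkn Q n y))%:E)%E)%:E /\
    (Ln k).-integrable setT (fun y => (phi y * fine (Rkn Q n y))%:E).
  rewrite geq_max => /andP[kn nz]; have := HNZ n nz; rewrite -(subnKC kn) => zn.
  have [ii ->] := correlation_integrable zn mphi phiM.
  by rewrite fineK// integrable_fin_num.
apply/fine_cvgP; split.
  by exists (maxn k NZ) => // n /key[-> _].
apply/cvgrPdist_le => e e0.
have [N1 HN1] := limit_lower cphi phiM e0.
(* The lower bound for [- phi] is the upper bound for [phi]. *)
have [N2 HN2] := limit_lower cN bN e0.
exists (maxn (maxn k NZ) (maxn N1 N2)) => // n /=.
rewrite geq_max => /andP[/key[keyE keyi]]; rewrite geq_max => /andP[n1 n2].
rewrite keyE /=; have := HN1 n n1; have := HN2 n n2.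
rewrite oppE//; under [X in _ <= fine X -> _]eq_integral do rewrite mulNr.
rewrite oppE// => h1 h2; rewrite ler_norml; apply/andP; split; lra.
Qed.

End limit.

Unset Implicit Arguments.
Set Strict Implicit.
Set Printing Implicit Defensive.

Theorem theorem3p9 (R : realType) (d : nat) (Q : d.-tuple R -> R)
    (alpha gamma eps : R) (mu : probability (d.-tuple R) R) (k : nat)
    (phi : k.-tuple (d.-tuple R) -> R) :
  (0 < d)%N ->
  (forall x, 0 <= Q x) ->
  continuous_Rd Q ->
  0 < alpha -> 0 < gamma -> 0 < eps ->
  growth_condition Q alpha gamma eps ->
  is_equilibrium_measure Q mu ->
  (0 < k)%N ->
  continuous_Rdk phi -> bounded_fun_on phi ->
  (fun n : nat => leb_int_Rdm (fun y => ((phi y)%:E * Rkn Q n y)%E))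
    @ \oo --> mu_int_k mu (fun x => (phi x)%:E).
Proof.
move=> d0 Q0 cQ alpha0 gamma0 eps0 growQ muQ _ cphi bphi.
have lnQ := ln_enorm_le Q0 alpha0 gamma0 eps0 growQ.
have QS := Q_shift Q0 cQ alpha0 gamma0 eps0 growQ.
have [c frullani] := frullani_split R.
(* One quarter of [Q] at each of the two points is taken from the half present in the kernel,
   leaving the quarter asked for in [KQ]. *)
have [C C_ge0 HC] : exists2 C : R, 0 <= C &
  forall x, ln (1 + enorm x) <= 4^-1 * Q x + C by exact: lnQ.
(* 2C pays for the two points; |c| makes c + C0 nonnegative, which keeps the one-body terms of the
   energy identity nonnegative. *)
have C00 : 0 <= 2 * C + `|c| by rewrite addr_ge0 ?mulr_ge0.
have cC : 0 <= c + (2 * C + `|c|).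
  by have := ler_norm (- c); rewrite normrN; lra.
have KQ x y : x != y ->
    (Q x + Q y) / 4 <= - ln (edist x y) + Q x / 2 + Q y / 2 + (2 * C + `|c|).
  move=> xy; have ex := enorm_ge0 x; have ey := enorm_ge0 y.
  have e0 : 0 < edist x y by rewrite edist_gt0.
  have le : edist x y <= (1 + enorm x) * (1 + enorm y).
    by apply: (le_trans (edist_le_enorm x y)); nra.
  have l1 : 0 < 1 + enorm x by lra.
  have l2 : 0 < 1 + enorm y by lra.
  have : ln (edist x y) <= ln (1 + enorm x) + ln (1 + enorm y).
    by rewrite -lnM ?posrE// ler_ln ?posrE// mulr_gt0.
  by have := HC x; have := HC y; have := normr_ge0 c; lra.
exact: (correlation_cvg Q0 cQ C00 KQ QS d0 frullani cC lnQ muQ).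
Qed.
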